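(* Let $B\subset W$ be a good lattice and $l=l(B)$. Let $S^{B,\pm}_n$ and $S^{B,\pm}_{n,1}$ ($n\in\mathbb{N}$) be the representations of $K_B$ on the subspaces $\mathcal{E}^{B,\pm}_n$ and $\mathcal{E}^{B,\pm}_{n,1}$ of the Weil representation (when these are non-zero). (i) If $l=0$, $S^{B,+}_0$ is the trivial representation. (ii) If $l>0$, then for every $n\in\mathbb{N}$ $$S^{B,\pm}_n=\mathrm{Ind}_{\widetilde{K_B(\hat x)}}^{K_B}\sigma^\pm_{\dot x},\qquad x\in(\varpi^{-n}B^*\setminus\varpi^{-n}B)+B^*.$$ (iii) If $l<r$, then for every $n\in\mathbb{N}$ $$S^{B,\pm}_{n,1}=\mathrm{Ind}_{\widetilde{K_B(\hat x)}}^{K_B}\sigma^\pm_{\dot x},\qquad x\in(\varpi^{-(n+1)}B\setminus\varpi^{-n}B^* )+B^*.$$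
   Context: $k$ is a non-archimedean local field of characteristic $0$ with ring of integers $\mathcal{O}$, uniformizer $\varpi$, residue field $\mathbb{F}_q$ of characteristic $p\neq2$; $\psi$ is a non-trivial unitary character of $(k,+)$ with conductor $\lambda_\psi$ (trivial on $\varpi^{\lambda_\psi}\mathcal{O}$, not on $\varpi^{\lambda_\psi-1}\mathcal{O}$); $\overline\psi$ is the character of $\mathbb{F}_q$ with $\overline\psi(x\bmod\varpi)=\psi(\varpi^{\lambda_\psi-1}x)$. $(W,\beta)$ is a symplectic $k$-space of dimension $2r$. A lattice is a compact open $\mathcal{O}$-submodule; $B^*=\{v\in W:\beta(v,b)\in\varpi^{\lambda_\psi}\mathcal{O}\ \forall b\in B\}$; $B$ is good if $\varpi B^*\subset B\subset B^*$, self-dual if $B=B^*$. $K_B$ is the stabilizer of $B$ in $Sp(W)$. $\mathrm{b}^*=B^*/B$ is an $\mathbb{F}_q$-space with symplectic form $\beta_{\mathrm{b}^*}(\bar v,\bar w)=\varpi^{1-\lambda_\psi}\beta(v,w)\bmod\varpi$, of dimension $2l$, $l=l(B)$; $p_{Sp(\mathrm{b}^* )}:K_B\to Sp(\mathrm{b}^* )$ is the induced morphism. Fix a self-dual lattice $A$ with $B\subset A\subset B^*$; $\mathrm{x}=A/B$ is a Lagrangian of $\mathrm{b}^*$. For a symplectic $F$-space $V$, $H(V)=V\times F$ with $(w,t)(w',t')=(w+w',t+t'+\frac12\beta(w,w'))$. **Weil representation of $Sp(\mathrm b^* )$.** Put $j(g)=l-\dim(\mathrm{x}\cap g\mathrm{x})$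 for $g\in Sp(\mathrm b^* )$, $\omega(a)=q^{-1/2}\sum_{t\in\mathbb{F}_q}\overline\psi(\frac12at^2)$ for $a\in\mathbb F_q^\times$ (depends only on $a$ mod squares), and let $\theta:Sp(\mathrm{b}^* )\to\mathbb{F}_q^\times/(\mathbb{F}_q^\times)^2$ be the function with $\theta(p_1gp_2)=\theta(p_1)\theta(g)\theta(p_2)$ for $p_1,p_2$ in the stabilizer $P$ of $\mathrm{x}$, $\theta(p)=\det(p_{|\mathrm{x}})$ for $p\in P$, and $\theta(\tau_S)=1$ for $S\subset\{1,\dots,l\}$, where, for a symplectic basis $(\epsilon_i,\phi_i)$ of $\mathrm b^*$ with the $\epsilon_i$ spanning $\mathrm{x}$, $\tau_S \epsilon_i=\phi_i,\ \tau_S\phi_i=-\epsilon_i$ for $i\in S$ and $\tau_S$ fixes $\epsilon_i,\phi_i$ for $i\notin S$. Put $m(g)=\omega(\theta(g))^{-1}\omega(1)^{1-j(g)}$. On the space $\mathcal{H}_{\overline\psi}$ of functions $\varphi:\mathrm{b}^*\to\mathbb{C}$ with $\varphi(a+w)=\overline\psi(\frac12\beta_{\mathrm b^*}(w,a))\varphi(w)$ for $a\in\mathrm{x}$, put $\rho_{\overline\psi}(w,t)\varphi(w')=\overline\psi(t+\frac12\beta_{\mathrm b^*}(w',w))\varphi(w'+w)$ and $S_{\overline\psi}(g)\varphi(w)=m(g)q^{j(g)/2}q^{-l}\sum_{x\in\mathrm{x}}\overline\psi(\frac12\beta_{\mathrm b^*}(x,w))\varphi(g^{-1}(w+x))$.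 Let $\widetilde\rho_{\overline\psi}(b,t)=\psi(t)\rho_{\overline\psi}(b+B,0)$ for $(b,t)\in B^*\times k$, and $\widetilde S_{\overline\psi}=S_{\overline\psi}\circ p_{Sp(\mathrm{b}^* )}$. **Weil representation on $K_B$.** $\mathcal{H}^A_\psi$ is the Hilbert space of functions $\varphi:W\to\mathbb{C}$ with $\varphi(a+w)=\psi(\frac12\beta(w,a))\varphi(w)$ ($a\in A$) and $\int_{W/A}|\varphi|^2<\infty$; for $g\in Sp(W)$, $M_A(g)\varphi(w)=[A:A\cap gA]^{-1}\sum_{a\in A/(A\cap gA)}\psi(\frac12\beta(a,w))\varphi(g^{-1}(a+w))$; for $g\in K_B$ the Weil representation is $S^A_\psi(g)=m(p_{Sp(\mathrm{b}^* )}(g))\,q^{\frac12j(p_{Sp(\mathrm{b}^* )}(g))}M_A(g)$. Subspaces of $\mathcal{H}^A_\psi$: $\mathcal{E}^B_0=\{f:\mathrm{Supp} f\subset B^*\}$; $\mathcal{E}^B_n=\{f:\mathrm{Supp} f\subset\varpi^{-n}(B^*\setminus B)\}$ ($n\ge1$); $\mathcal{E}^B_{n,1}=\{f:\mathrm{Supp} f\subset\varpi^{-(n+1)}B\setminus\varpi^{-n}B^*\}$ ($n\ge0$); $\mathcal{E}^{\pm}$ is the subspace of even ($+$), resp. odd ($-$), functions. These are $K_B$-invariant. **Inducing data.** For $x\in W$ let $\hat x=x+B^*\in W/B^*$, $\dot x=x+B\in W/B$, $K_B(\hat x)$ the stabilizer of $\hat x$ in $K_B$, $\widetilde{K_B(\hat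 x)}=\{\pm\mathrm{Id}\}K_B(\hat x)$, and $$\sigma_{\dot x}(g)=\psi(\tfrac12\beta(x,g^{-1}x))\,\widetilde S_{\overline\psi}(g)\,\widetilde\rho_{\overline\psi}(g^{-1}x-x,0),\quad g\in K_B(\hat x),$$ a representation of $K_B(\hat x)$ on $\mathcal{H}_{\overline\psi}$ depending only on $\dot x$. If $x\in B^*$, then $\widetilde{K_B(\hat x)}=K_B(\hat x)=K_B$ and $\sigma^\pm_{\dot x}$ is the subrepresentation of $\sigma_{\dot x}$ on the eigenspace of $-\mathrm{Id}\in K_B$ for the eigenvalue $\pm1$ (when this eigenspace is non-zero). If $x\notin B^*$, then $-\mathrm{Id}\notin K_B(\hat x)$ and $\sigma^\pm_{\dot x}$ is the extension of $\sigma_{\dot x}$ to $\widetilde{K_B(\hat x)}$ with $\sigma^\pm_{\dot x}(-\mathrm{Id})=\pm\mathrm{Id}$. Equalities of representations mean equivalence.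
   Formalization: In (ii) and (iii) the sign is corrected: even/odd functions with sign ε correspond to Ind σ^{m(-Id)ε}, where m(-Id) is the scalar by which -Id acts on even functions; it is -1 exactly when l is odd and q ≡ 3 mod 4, where the literal matching of signs fails. *)

(* Defs.v *)
From HB Require Import structures.
From mathcomp Require Import all_boot all_order all_algebra all_field.
From mathcomp Require Import sesquilinear finmap.
From mathcomp Require Import boolp classical_sets functions cardinality fsbigop.
From mathcomp Require Import reals ereal topology esum.
From mathcomp Require Import complex.

Set Implicit Arguments.
Unset Strict Implicit.
Unset Printing Implicit Defensive.

Import Order.TTheory GRing.Theory Num.Theory.
Local Open Scope classical_set_scope.
Local Open Scope ring_scope.

(* [val_ge v n] is the fractional ideal of elements of valuation >= n; the
   value of [v] at 0 is irrelevant. *)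
Definition val_ge (k : fieldType) (v : k -> int) (n : int) : set k :=
  [set x | x = 0 \/ n <= v x].

(* A complete discretely valued field with finite residue field.  The residue
   field is given as a finite field with a reduction map, of which only the
   restriction to the valuation ring is meaningful. *)
Record localField := LocalField {
  lf_field :> fieldType;
  lf_val : lf_field -> int;
  unif : lf_field;
  residue : finFieldType;
  red : lf_field -> residue;
  lf_valM : forall x y, x != 0 -> y != 0 -> lf_val (x * y) = lf_val x + lf_val y;
  lf_valD : forall x y, x != 0 -> y != 0 -> x + y != 0 ->
    Num.min (lf_val x) (lf_val y) <= lf_val (x + y);
  unif_neq0 : unif != 0;
  val_unif : lf_val unif = 1;
  lf_complete : forall u : nat -> lf_field,
    (forall n : int, exists N : nat, forall i j : nat,
      (N <= i)%N -> (N <= j)%N -> val_ge lf_val n (u i - u j)) ->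
    exists x, forall n : int, exists N : nat, forall i : nat,
      (N <= i)%N -> val_ge lf_val n (u i - x);
  red1 : red 1 = 1;
  redD : forall x y, val_ge lf_val 0 x -> val_ge lf_val 0 y ->
    red (x + y) = red x + red y;
  redM : forall x y, val_ge lf_val 0 x -> val_ge lf_val 0 y ->
    red (x * y) = red x * red y;
  red_eq0 : forall x, val_ge lf_val 0 x -> (red x = 0 <-> val_ge lf_val 1 x);
  red_surj : forall y, exists2 x, val_ge lf_val 0 x & red x = y
}.

Definition integers (K : localField) : set K := val_ge (@lf_val K) 0.
Arguments integers : clear implicits.

(* [fracid n] is the fractional ideal generated by the n-th power of the
   uniformizer. *)
Definition fracid (K : localField) (n : int) : set K :=
  [set unif K ^ n * y | y in integers K].
Arguments fracid : clear implicits.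

(* Unitary character of (K, +) with its conductor; continuity and
   non-triviality are consequences of the last two fields. *)
Record addChar (R : realType) (K : localField) := AddChar {
  ac_fun :> K -> R[i];
  conductor : int;
  ac_add : forall x y, ac_fun (x + y) = ac_fun x * ac_fun y;
  ac_unitary : forall x, `|ac_fun x| = 1;
  ac_triv : forall x, fracid K conductor x -> ac_fun x = 1;
  ac_ntriv : exists2 x, fracid K (conductor - 1) x & ac_fun x != 1
}.

(* The topology of a finite-dimensional K-space, carried by an alias of it. *)
Definition vtop (K : localField) (W : vectType K) : Type := W.
HB.instance Definition _ (K : localField) (W : vectType K) :=
  Choice.on (vtop W).

Section VectorTopology.
Variables (K : localField) (W : vectType K).

Definition vopen (U : set (vtop W)) : Prop :=
  forall x : W, U x -> exists n : int, forall y : W,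
    (forall i, val_ge (@lf_val K) n (coord (vbasis {:W}) i (y - x))) -> U y.

Lemma vopenT : vopen setT.
Proof. by move=> x _; exists 0. Qed.

Lemma vopenI : setI_closed vopen.
Proof.
move=> U V oU oV x [/oU [m hm] /oV [n hn]]; exists (Num.max m n) => y hy; split.
- apply: hm => i; case: (hy i) => [|h]; [by left | right].
  by apply: le_trans h; rewrite le_max lexx.
- apply: hn => i; case: (hy i) => [|h]; [by left | right].
  by apply: le_trans h; rewrite le_max lexx orbT.
Qed.

Lemma vopenU (I : Type) (U : I -> set (vtop W)) :
  (forall i, vopen (U i)) -> vopen (\bigcup_i U i).
Proof.
move=> oU x [i _ /oU [n hn]]; exists n => y /hn Uy; by exists i.
Qed.

HB.instance Definition _ := isOpenTopological.Build (vtop W) vopenT vopenI vopenU.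

End VectorTopology.

Section Lattices.
Variables (R : realType) (K : localField) (psi : addChar R K).
Variables (W : vectType K) (beta : {skew_symmetric W}).
Implicit Types B : set W.

Record lattice (L : set W) : Prop := Lattice {
  lattice0 : L 0;
  latticeD : forall x y, L x -> L y -> L (x + y);
  latticeZ : forall a x, integers K a -> L x -> L (a *: x);
  lattice_compact : compact (L : set (vtop W));
  lattice_open : open (L : set (vtop W))
}.

Definition dual B : set W :=
  [set v | forall b, B b -> fracid K (conductor psi) (beta v b)].

Definition uscale (n : int) (D : set W) : set W := [set unif K ^ n *: x | x in D].

Definition setsum (D D' : set W) : set W := [set x + y | x in D & y in D'].

Definition good_lattice B : Prop :=
  [/\ lattice B, uscale 1 (dual B) `<=` B & B `<=` dual B].

Definition selfdual_lattice B : Prop := lattice B /\ B = dual B.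

Definition Sp : set 'End(W) :=
  [set g | forall u v, beta (g u) (g v) = beta u v].

Definition stabB B : set 'End(W) := [set g | Sp g /\ g @` B = B].

(* D/L as the set of cosets x + L, x in D, and a chosen representative. *)
Definition cosets (D L : set W) : set (set W) :=
  [set [set x + u | u in L] | x in D].
Definition repr (Z : set W) : W := xget 0 Z.

(* A model of the residual space dual B / B: [qpr] is meaningful on dual B
   only, where it is the quotient map. *)
Record resQuotient B := ResQuotient {
  qspace :> vectType (residue K);
  qpr : W -> qspace;
  qprD : forall v w, dual B v -> dual B w -> qpr (v + w) = qpr v + qpr w;
  qprZ : forall a v, integers K a -> dual B v ->
    qpr (a *: v) = red a *: qpr v;
  qpr_eq0 : forall v, dual B v -> (qpr v = 0 <-> B v);
  qpr_surj : forall u, exists2 v, dual B v & qpr v = u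
}.

End Lattices.

Section Representations.
Variables (C : fieldType) (k : fieldType) (W : vectType k).
Implicit Types G H : set 'End(W).

(* [G] acts linearly on the subspace [E] of [V] through [a]; the values of
   [a g] outside [E], and of [a] outside [G], are irrelevant. *)
Record is_rep G (V : lmodType C) (E : set V) (a : 'End(W) -> V -> V) : Prop :=
  IsRep {
  rep_sub0 : E 0;
  rep_subL : forall c u v, E u -> E v -> E (c *: u + v);
  rep_stable : forall g u, G g -> E u -> E (a g u);
  rep_linear : forall g c u v, G g -> E u -> E v ->
    a g (c *: u + v) = c *: a g u + a g v;
  rep_1 : forall u, E u -> a \1%VF u = u;
  rep_M : forall g h u, G g -> G h -> E u -> a (g \o h)%VF u = a g (a h u)
}.

Definition rep_equiv G (V V' : lmodType C)
    (E : set V) (a : 'End(W) -> V -> V) (E' : set V') (a' : 'End(W) -> V' -> V') :=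
  [/\ is_rep G E a, is_rep G E' a' &
   exists T : V -> V',
   [/\ set_bij E E' T,
       forall c u v, E u -> E v -> T (c *: u + v) = c *: T u + T v &
       forall g u, G g -> E u -> T (a g u) = a' g (T u)]].

(* Ind_H^G: functions on G, extended by 0 outside G, on which G acts by right
   translation.  All the subgroups induced from below are open of finite
   index, so that no smoothness condition is needed. *)
Definition ind_space G H (V : lmodType C) (E : set V) (a : 'End(W) -> V -> V) :
    set ('End(W) -> V) :=
  [set Phi | [/\ forall g, ~ G g -> Phi g = 0,
                 forall g, G g -> E (Phi g) &
                 forall h g, H h -> G g -> Phi (h \o g)%VF = a h (Phi g)]].

Definition ind_act (V : lmodType C) (g : 'End(W)) (Phi : 'End(W) -> V) :
  'End(W) -> V := fun g' => Phi (g' \o g)%VF.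

End Representations.

Section FiniteWeil.
Variables (R : realType) (K : localField) (psi : addChar R K).
Variables (W : vectType K) (beta : {skew_symmetric W}) (B A : set W).
Variable b : resQuotient psi beta B.

Local Notation C := (R[i]).
Local Notation F := (residue K).
Local Notation "'Bdual'" := (dual psi beta B).

Definition red_lift (y : F) : K := xget 0 [set x | integers K x /\ red x = y].

Definition psibar (y : F) : C := psi (unif K ^ (conductor psi - 1) * red_lift y).

Definition qlift (u : b) : W := xget 0 [set v | Bdual v /\ qpr b v = u].

Definition betab (u v : b) : F :=
  red (unif K ^ (1 - conductor psi) * beta (qlift u) (qlift v)).

Definition Spb : set 'End(b) :=
  [set g | forall u v, betab (g u) (g v) = betab u v].

Definition pSp (g : 'End(W)) : 'End(b) := linfun (fun u : b => qpr b (g (qlift u))).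

(* A/B: the image of A is already a subspace, so taking the span adds nothing. *)
Definition lagr : {vspace b} :=
  <<[seq u : b <- enum {: finvect_type b} | `[< exists2 a, A a & qpr b a = u >]]>>%VS.

Definition stabP : set 'End(b) := [set g | Spb g /\ (g @: lagr)%VS = lagr].

Definition det_lagr (g : 'End(b)) : F :=
  \det (\matrix_(i < \dim lagr, j < \dim lagr)
          coord (vbasis lagr) j (g (vbasis lagr)`_i)).

Definition symplectic_basis (l : nat) (e f : 'I_l -> b) : Prop :=
  [/\ forall i j, betab (e i) (e j) = 0,
      forall i j, betab (f i) (f j) = 0,
      forall i j, betab (e i) (f j) = (i == j)%:R &
      <<[seq e i | i : 'I_l]>>%VS = lagr].

Definition is_tau (l : nat) (e f : 'I_l -> b) (S : {set 'I_l}) (t : 'End(b)) :=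
  forall i, if i \in S then t (e i) = f i /\ t (f i) = - e i
            else t (e i) = e i /\ t (f i) = f i.

Definition eq_modsq (x y : F) : Prop := exists2 c, c != 0 & x = y * c ^+ 2.

(* The class modulo squares is represented by a non-zero element of F. *)
Record is_theta (l : nat) (e f : 'I_l -> b) (theta : 'End(b) -> F) : Prop :=
  IsTheta {
  theta_neq0 : forall g, Spb g -> theta g != 0;
  theta_bi : forall p1 g p2, stabP p1 -> Spb g -> stabP p2 ->
    eq_modsq (theta (p1 \o g \o p2)%VF) (theta p1 * theta g * theta p2);
  theta_P : forall p, stabP p -> eq_modsq (theta p) (det_lagr p);
  theta_tau : forall S t, is_tau e f S t -> eq_modsq (theta t) 1
}.

Variable theta : 'End(b) -> F.

Definition sqrtq : C := sqrtC #|F|%:R.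

Definition omega (a : F) : C := sqrtq^-1 * \sum_(t : F) psibar (2^-1 * a * t ^+ 2).

Definition half_dim : nat := (\dim {:b})./2.

Definition jb (g : 'End(b)) : nat := (half_dim - \dim (lagr :&: (g @: lagr)))%N.

Definition mb (g : 'End(b)) : C := (omega (theta g))^-1 * omega 1 ^ (1 - (jb g)%:Z).

Definition Hbar : set (b -> C^o) :=
  [set phi | forall a w, a \in lagr ->
     phi (a + w) = psibar (2^-1 * betab w a) * phi w].

Definition rho_bar (w : b) (t : F) (phi : b -> C^o) : b -> C^o :=
  fun w' => psibar (t + 2^-1 * betab w' w) * phi (w' + w).

Definition S_bar (g : 'End(b)) (phi : b -> C^o) : b -> C^o :=
  fun w => mb g * sqrtq ^+ jb g * (#|F|%:R ^+ half_dim)^-1 *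
    \sum_(x : finvect_type b | (x : b) \in lagr)
      psibar (2^-1 * betab (x : b) w) * phi ((g^-1)%VF (w + (x : b))).

Definition rho_tilde (v : W) (t : K) (phi : b -> C^o) : b -> C^o :=
  psi t *: rho_bar (qpr b v) 0 phi.

Definition S_tilde (g : 'End(W)) : (b -> C^o) -> (b -> C^o) := S_bar (pSp g).

Definition K_hat (x : W) : set 'End(W) :=
  [set g | stabB beta B g /\ Bdual (g x - x)].

Definition K_hat_pm (x : W) : set 'End(W) := [set g | K_hat x g \/ K_hat x (- g)].

Definition sigma (x : W) (g : 'End(W)) (phi : b -> C^o) : b -> C^o :=
  psi (2^-1 * beta x ((g^-1)%VF x)) *:
    S_tilde g (rho_tilde ((g^-1)%VF x - x) 0 phi).

(* sigma^{eps}, eps = 1 or -1.  For x in the dual of B it is the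
   eps-eigenspace of -Id; otherwise it is the whole space, on which
   -Id acts by eps. *)
Definition sigma_space (x : W) (eps : C) : set (b -> C^o) :=
  [set phi | Hbar phi /\ (Bdual x -> sigma x (- \1%VF) phi = eps *: phi)].

Definition sigma_pm (x : W) (eps : C) (g : 'End(W)) (phi : b -> C^o) : b -> C^o :=
  if `[< K_hat x g >] then sigma x g phi else eps *: sigma x (- g) phi.

(* The sign by which -Id acts on even functions through the Weil
   representation: it converts the parity of functions into the eigenvalue of
   -Id that indexes sigma^{eps}.  It equals ((-1)/q)^l (quadratic character),
   hence is -1 exactly when l is odd and q = 3 mod 4. *)
Definition central_sign : C := mb (pSp (- \1%VF)).

Definition HA : set (W -> C^o) :=
  [set f | (forall a w, A a -> f (a + w) = psi (2^-1 * beta w a) * f w) /\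
     (\esum_(Z in cosets setT A) (Normc.normc (f (repr Z)) ^+ 2)%:E < +oo)%E].

Definition MA (g : 'End(W)) (f : W -> C^o) : W -> C^o :=
  let Q := cosets A (A `&` g @` A) in
  fun w => (#|` fset_set Q|%:R)^-1 *
    \sum_(Z \in Q) psi (2^-1 * beta (repr Z) w) * f ((g^-1)%VF (repr Z + w)).

Definition SA (g : 'End(W)) (f : W -> C^o) : W -> C^o :=
  (mb (pSp g) * sqrtq ^+ jb (pSp g)) *: MA g f.

Definition layer (n : nat) : set W :=
  if n is 0 then Bdual else uscale (- n%:Z) (Bdual `\` B).

Definition layer1 (n : nat) : set W :=
  uscale (- n.+1%:Z) B `\` uscale (- n%:Z) Bdual.

(* Functions supported in D that are even (eps = 1) or odd (eps = -1). *)
Definition E_supp (D : set W) (eps : C) : set (W -> C^o) :=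
  [set f | [/\ HA f, forall w, f w != 0 -> D w &
               forall w, f (- w) = eps * f w]].

Definition ind_sigma_space (x : W) (eps : C) :=
  ind_space (stabB beta B) (K_hat_pm x) (sigma_space x eps) (sigma_pm x eps).

End FiniteWeil.

(* Main.v *)
(* For x in W, restricting a function f of the lattice model to the coset x + B^* gives
   an element ev_x f of the lattice model of the finite space B^*/B, and
     ev_x (S(g) f) = S~(g) (ev_(g^-1 x) f)      for g in K_B.
   So S is multiplicative on K_B as soon as the finite operators S~ are, the stabilizer
   of x + B^* acts on ev_x f through sigma_x, and f |-> (g |-> ev_x (S(g) f)) is the
   isomorphism with the induced representation once K_B is transitive on the layer
   modulo B^*.  Transitivity holds because two symplectic transvections preserving B
   move any primitive vector of B^* (resp. of B) to any other.

   For the finite operators, S~ is bi-equivariant under the stabilizer P of the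
   Lagrangian x, so multiplicativity has to be checked on the generators tau_{i} only.
   Writing M(g) for the unnormalized average, M(tau_{i}) M(h) = c M(tau_{i} h), where c
   is 1, 1/q or the normalized Gauss sum of a rank one form, according to the relative
   position of the Lagrangians x, tau_{i} x and tau_{i} h x; the three cases match the
   factors m(g) q^(j(g)/2) because omega(1) omega(-1) = 1 and omega(a)/omega(1) is the
   quadratic character. *)

Require Import Defs.
From HB Require Import structures.
From mathcomp Require Import all_boot all_order all_algebra all_field.
From mathcomp Require Import ring zify boolp.

Set Implicit Arguments.
Unset Strict Implicit.
Unset Printing Implicit Defensive.

Import Order.TTheory GRing.Theory Num.Theory.
Local Open Scope ring_scope.

(** * Quadratic Gauss sums *)

(** The rule for S~(tau_{i}) S~(h) can be transported only along factors p of P for which tau_{i}^-1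
    p tau_{i} lies in P too. This shapes the reduction: every move on the left involves some e_m
    with m distinct from i, which tau_{i} fixes, and the plane of e_i and f_i is left to the end,
    where the position of one line in it decides between the three values of c. Used a second time,
    the same reduction shows that P and the tau_S generate Sp. On the lattice side, restriction to x
    + B^* has to be twisted by psi(beta(u, x)/2) to depend on u only modulo B. The average in M_A
    runs over A modulo the intersection of A and gA, the finite one over A/B; they agree because the
    summand is constant along that intersection, which contains B. Surjectivity onto the induced
    representation requires a preimage defined pointwise through a chosen g, and the definition of
    sigma is exactly what makes it independent of g. Finally -Id acts on functions of parity eps by
    [central_sign] times eps, whence the index of sigma. *)

Section GaussSums.
Variables (F : finFieldType) (C : numFieldType) (psi : F -> C).
Hypothesis two_neq0 : 2 != 0 :> F.
Hypothesis psiD : forall x y, psi (x + y) = psi x * psi y.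
Hypothesis psi_neq0 : forall x, psi x != 0.
Hypothesis psi_ntriv : exists x, psi x != 1.

Lemma addchar0 : psi 0 = 1.
Proof.
have := psiD 0 0; rewrite addr0 => h; apply: (mulfI (psi_neq0 0)).
by rewrite mulr1 -h.
Qed.

(** Shifting t by x / d multiplies the sum by [psi x], and some [psi x] differs from 1. *)
Lemma sum_addchar_scaled d :
  \sum_(t : F) psi (t * d) = if d == 0 then #|F|%:R else 0.
Proof.
case: eqVneq => [->|d0].
  under eq_bigr do rewrite mulr0 addchar0.
  by rewrite sumr_const.
have [x psix] := psi_ntriv.
set s := \sum_(t : F) _.
have : s = psi x * s.
  rewrite [LHS](reindex_inj (addrI (x / d))) mulr_sumr.
  by apply: eq_bigr => t _ /=; rewrite mulrDl divfK // psiD.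
move/eqP; rewrite -subr_eq0 -{1}[s]mul1r -mulrBl mulf_eq0.
by rewrite subr_eq0 eq_sym (negPf psix) => /eqP.
Qed.

Definition gauss (a : F) : C := \sum_(t : F) psi (2^-1 * a * t ^+ 2).

Lemma gauss_sqr a c : c != 0 -> gauss (a * c ^+ 2) = gauss a.
Proof.
move=> c0; rewrite [RHS](reindex_inj (mulfI c0)) /=.
by apply: eq_bigr => t _; congr psi; ring.
Qed.

Lemma card_residue_neq0 : #|F|%:R != 0 :> C.
Proof. by rewrite pnatr_eq0 -lt0n; apply/card_gt0P; exists 0. Qed.

(** Putting s = t + d turns (s^2 - t^2)/2 into d^2/2 + t d, and the sum over t leaves only d = 0.
    This replaces the computation of the absolute value of a Gauss sum. *)
Lemma gaussN1 : gauss 1 * gauss (-1) = #|F|%:R.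
Proof.
transitivity (\sum_(d : F) psi (2^-1 * d ^+ 2) * \sum_(t : F) psi (t * d)).
  rewrite /gauss big_distrl /=.
  under eq_bigr do rewrite big_distrr /=.
  rewrite exchange_big /=.
  under eq_bigr => t _.
    rewrite (reindex_inj (addrI t)) /=.
    over.
  rewrite exchange_big; apply: eq_bigr => d _ /=.
  rewrite big_distrr; apply: eq_bigr => t _ /=.
  by rewrite -!psiD; congr psi; field.
rewrite (bigD1 0) //= sum_addchar_scaled eqxx big1 => [|d d0].
  by rewrite expr0n /= mulr0 addchar0 mul1r addr0.
by rewrite sum_addchar_scaled (negPf d0) mulr0.
Qed.

Lemma gauss1_neq0 : gauss 1 != 0.
Proof.
by have := card_residue_neq0; rewrite -gaussN1 mulf_eq0 negb_or => /andP[].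
Qed.

Definition nsqrt (u : F) := #|[set t : F | t ^+ 2 == u]|.

Lemma sum_nsqrt : (\sum_(u : F) nsqrt u = #|F|)%N.
Proof.
rewrite -sum1_card [RHS](partition_big (fun t : F => t ^+ 2) xpredT) //=.
by apply: eq_bigr => u _; rewrite /nsqrt -sum1_card; apply: eq_bigl => t; rewrite inE.
Qed.

Lemma nsqrt_le2 u : (nsqrt u <= 2)%N.
Proof.
rewrite /nsqrt; have [->|[t]] := set_0Vmem [set t : F | t ^+ 2 == u].
  by rewrite cards0.
rewrite inE => /eqP <-; apply: (@leq_trans #|[set t; - t]|); last by rewrite cards2; case: eqP.
by apply/subset_leq_card/subsetP => s; rewrite !inE eqf_sqr.
Qed.
Lemma nsqrt0 : nsqrt 0 = 1%N.
Proof.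
rewrite -[RHS](cards1 (0 : F)); apply: eq_card => t.
by rewrite !inE sqrf_eq0.
Qed.

Lemma nsqrt_gt0P u : reflect (exists t, u = t ^+ 2) (0 < nsqrt u)%N.
Proof.
apply: (iffP card_gt0P) => [[t]|[t ->]]; last by exists t; rewrite inE.
by rewrite inE => /eqP <-; exists t.
Qed.

(* Each sum is at most 2, and over all u the sums add up to 2 #|F|. *)
Lemma nsqrt_nonsquare a u : nsqrt a = 0%N -> (nsqrt u + nsqrt (a * u)%R = 2)%N.
Proof.
move=> na.
have a0 : a != 0 by apply: contra_eq_neq na => ->; rewrite nsqrt0.
have le2 v : (nsqrt v + nsqrt (a * v)%R <= 2)%N.
  have [->|v0] := eqVneq v 0; first by rewrite mulr0 nsqrt0.
  have [->|] := posnP (nsqrt v); first exact: nsqrt_le2.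
  case/nsqrt_gt0P => s sE; have [->|] := posnP (nsqrt (a * v)).
    by rewrite addn0 nsqrt_le2.
  case/nsqrt_gt0P => t tE; suff: (0 < nsqrt a)%N by rewrite na.
  apply/nsqrt_gt0P; exists (t / s).
  by rewrite expr_div_n -sE -tE mulfK.
have sum2 : (\sum_(v : F) (nsqrt v + nsqrt (a * v)%R) = \sum_(v : F) 2)%N.
  have := reindex_inj (mulfI a0) (P := xpredT) (F := nsqrt) (op := addn) (x := 0%N).
  rewrite big_split /= => <-; rewrite sum_nsqrt.
  by rewrite sum_nat_const muln2 addnn.
apply/eqP; rewrite eqn_leq le2 /= leqNgt; apply/negP => lt2.
suff: (\sum_(v : F) (nsqrt v + nsqrt (a * v)%R) < \sum_(v : F) 2)%N.
  by rewrite sum2 ltnn.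
rewrite (bigD1 u) //= [X in (_ < X)%N](bigD1 u) //= -addSn leq_add //.
by apply: leq_sum => v _.
Qed.

Lemma gaussE a :
  gauss a = \sum_(u : F) (nsqrt u)%:R * psi (2^-1 * a * u).
Proof.
rewrite /gauss (partition_big (fun t : F => t ^+ 2) xpredT) //=.
apply: eq_bigr => u _; rewrite (eq_bigr (fun=> psi (2^-1 * a * u))); last first.
  by move=> t /eqP ->.
rewrite sumr_const mulr_natl; congr (_ *+ _).
by apply: eq_card => t; rewrite !inE.
Qed.

(** Replacing u by a u in [gauss 1] gives u the weight [nsqrt u + nsqrt (a * u)] in
    [gauss a + gauss 1]. This weight is always 2, and a nontrivial character sums to 0. *)
Lemma gauss_nonsquare a : nsqrt a = 0%N -> gauss a = - gauss 1.
Proof.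
move=> na; have a0 : a != 0 by apply: contra_eq_neq na => ->; rewrite nsqrt0.
apply/eqP; rewrite -addr_eq0 !gaussE [X in _ + X](reindex_inj (mulfI a0)) /=.
rewrite -big_split /=; apply/eqP.
transitivity (\sum_(u : F) 2 * psi (u * (2^-1 * a))).
  apply: eq_bigr => u _; rewrite mulr1 -(mulrA _ a) [u * _]mulrC -[2^-1 * a * u]mulrA.
  by rewrite -mulrDl -natrD nsqrt_nonsquare.
rewrite -mulr_sumr sum_addchar_scaled mulf_eq0 invr_eq0 (negPf two_neq0) (negPf a0).
by rewrite mulr0.
Qed.

Lemma gauss_neq0 a : a != 0 -> gauss a != 0.
Proof.
move=> a0; have [na|] := posnP (nsqrt a).
  by rewrite gauss_nonsquare // oppr_eq0 gauss1_neq0.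
case/nsqrt_gt0P => t aE; have t0 : t != 0 by rewrite -sqrf_eq0 -aE.
by rewrite aE -[t ^+ 2]mul1r gauss_sqr // gauss1_neq0.
Qed.

(** The quadratic character, in the form omega(1)/omega(a) in which it enters m(g). *)
Definition gsign (a : F) : C := gauss 1 / gauss a.

Lemma gsign1 : gsign 1 = 1.
Proof. by rewrite /gsign divff // gauss1_neq0. Qed.

Lemma gsign_sqr a c : c != 0 -> gsign (a * c ^+ 2) = gsign a.
Proof. by move=> c0; rewrite /gsign gauss_sqr. Qed.

Lemma gsign_nonsquare a : nsqrt a = 0%N -> gsign a = -1.
Proof. by move=> na; rewrite /gsign (gauss_nonsquare na) invrN mulrN divff // gauss1_neq0. Qed.

(** Squares do not change [gsign], and a product of two nonsquares is a square by
    [nsqrt_nonsquare]. *)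
Lemma gsignM a b : a != 0 -> b != 0 -> gsign (a * b) = gsign a * gsign b.
Proof.
have sqE c : c != 0 -> (0 < nsqrt c)%N -> exists2 t, t != 0 & c = t ^+ 2.
  by move=> c0 /nsqrt_gt0P[t cE]; exists t => //; rewrite -sqrf_eq0 -cE.
have sq1 t : t != 0 -> gsign (t ^+ 2) = 1.
  by move=> t0; rewrite -[t ^+ 2]mul1r gsign_sqr // gsign1.
move=> a0 b0; have [na|] := posnP (nsqrt a); last first.
  by case/(sqE _ a0) => t t0 ->; rewrite mulrC gsign_sqr // sq1 // mul1r.
have [nb|] := posnP (nsqrt b); last first.
  by case/(sqE _ b0) => t t0 ->; rewrite gsign_sqr // sq1 // mulr1.
rewrite (gsign_nonsquare na) (gsign_nonsquare nb) mulrNN mulr1.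
have : (0 < nsqrt (a * b)%R)%N by have := nsqrt_nonsquare b na; rewrite nb add0n => ->.
by case/sqE => [|t t0 ->]; rewrite ?mulf_neq0 // sq1.
Qed.

Lemma gsign_sqr1 a : a != 0 -> gsign a * gsign a = 1.
Proof. by move=> a0; rewrite -gsignM // -expr2 -[a ^+ 2]mul1r gsign_sqr // gsign1. Qed.

End GaussSums.

(** * Alternating forms, isometries and symplectic bases *)

Lemma linfun_linear (k : fieldType) (U V : vectType k) (g : U -> V) :
  linear g -> linfun g =1 g.
Proof.
move=> lg w; pose gL := GRing.isLinear.Build _ _ _ _ g lg.
pose G : {linear U -> V} := HB.pack g gL.
exact: (lfunE G w).
Qed.

(** A predicate on bare functions, so that it covers both the bundled form [beta] and the residual
    form [betab], which is defined through chosen lifts. *)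
Record alternating (k : fieldType) (V : lmodType k) (beta : V -> V -> k) : Prop :=
  Alternating {
  alt_linear : forall c u v w, beta (c *: u + v) w = c * beta u w + beta v w;
  altC : forall u v, beta u v = - beta v u;
  altxx : forall v, beta v v = 0
}.

Section AlternatingForm.
Variables (k : fieldType) (V : lmodType k) (beta : V -> V -> k).
Hypothesis altb : alternating beta.

Lemma altDl u v w : beta (u + v) w = beta u w + beta v w.
Proof. by rewrite -[u]scale1r alt_linear // !mul1r scale1r. Qed.

Lemma alt0l w : beta 0 w = 0.
Proof. by apply: (addrI (beta 0 w)); rewrite addr0 -altDl addr0. Qed.

Lemma altZl c u w : beta (c *: u) w = c * beta u w.
Proof. by rewrite -[c *: u]addr0 alt_linear // alt0l addr0. Qed.

Lemma altNl u w : beta (- u) w = - beta u w.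
Proof. by rewrite -scaleN1r altZl mulN1r. Qed.

Lemma altDr u v w : beta w (u + v) = beta w u + beta w v.
Proof. by rewrite !(altC altb w) altDl opprD. Qed.

Lemma alt0r w : beta w 0 = 0.
Proof. by rewrite altC // alt0l oppr0. Qed.

Lemma altZr c u w : beta w (c *: u) = c * beta w u.
Proof. by rewrite !(altC altb w) altZl mulrN. Qed.

Lemma altNr u w : beta w (- u) = - beta w u.
Proof. by rewrite -scaleN1r altZr mulN1r. Qed.

Definition altE := (altDl, altDr, altNl, altNr, altZl, altZr, alt0l, alt0r).

Lemma alt_suml (I : finType) (P : pred I) (u : I -> V) w :
  beta (\sum_(i | P i) u i) w = \sum_(i | P i) beta (u i) w.
Proof. exact: (big_morph (beta^~ w) (fun x y => altDl x y w) (alt0l w)). Qed.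

Lemma alt_sumr (I : finType) (P : pred I) (u : I -> V) w :
  beta w (\sum_(i | P i) u i) = \sum_(i | P i) beta w (u i).
Proof. exact: (big_morph (beta w) (fun x y => altDr x y w) (alt0r w)). Qed.

End AlternatingForm.

Section Isometries.
Variables (k : fieldType) (V : vectType k) (beta : V -> V -> k).
Hypothesis altb : alternating beta.
Hypothesis nondeg : forall u, (forall v, beta u v = 0) -> u = 0.

Definition isom (g : 'End(V)) := forall u v, beta (g u) (g v) = beta u v.

Lemma isom_ker g : isom g -> lker g == 0%VS.
Proof.
move=> ig; apply/lker0P => u v guv; apply/eqP; rewrite -subr_eq0; apply/eqP.
apply: nondeg => w; rewrite -ig linearB /= guv subrr; exact: alt0l altb _.
Qed.

Lemma isomK g : isom g -> cancel g (g^-1)%VF.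
Proof. by move=> /isom_ker h; apply: lker0_lfunK. Qed.

Lemma isomVK g : isom g -> cancel (g^-1)%VF g.
Proof. by move=> /isom_ker h; apply: lker0_lfunVK. Qed.

Lemma isomV g : isom g -> isom (g^-1)%VF.
Proof. by move=> ig u v; rewrite -ig !isomVK. Qed.

Lemma isom_comp g h : isom g -> isom h -> isom (g \o h)%VF.
Proof. by move=> ig ih u v; rewrite !comp_lfunE ig ih. Qed.

Lemma isom1 : isom \1%VF.
Proof. by move=> u v; rewrite !id_lfunE. Qed.

Lemma isomN g : isom g -> isom (- g).
Proof. by move=> ig u v; rewrite !opp_lfunE altNl // altNr // opprK. Qed.

Lemma isom_compV g : isom g -> (g \o g^-1)%VF = \1%VF.
Proof. by move=> ig; apply/lfunP => u; rewrite comp_lfunE isomVK // id_lfunE. Qed.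

Lemma isom_Vcomp g : isom g -> (g^-1 \o g)%VF = \1%VF.
Proof. by move=> ig; apply/lfunP => u; rewrite comp_lfunE isomK // id_lfunE. Qed.

Lemma isom_inv_uniq g h : isom g -> cancel h g -> (g^-1)%VF =1 h.
Proof. by move=> ig hK u; rewrite -{1}[u]hK isomK. Qed.

Lemma isom_invM g h : isom g -> isom h -> ((g \o h)^-1)%VF =1 (h^-1 \o g^-1)%VF.
Proof.
move=> ig ih; apply: isom_inv_uniq; first exact: isom_comp.
by move=> u; rewrite !comp_lfunE isomVK // isomVK.
Qed.

Lemma isom_invV g : isom g -> ((g^-1)^-1)%VF =1 g.
Proof. by move=> ig; apply: isom_inv_uniq (isomV ig) _ => u; rewrite isomK. Qed.

(* [Esp u v] is the exponential of the element of sp(V) = Sym^2 V given by the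
   product u v, which squares to 0 when u and v are orthogonal. *)
Definition Esp (u v : V) : 'End(V) :=
  linfun (fun w => w + beta w u *: v + beta w v *: u).

Lemma EspE u v w : Esp u v w = w + beta w u *: v + beta w v *: u.
Proof.
rewrite linfun_linear // => c x y; rewrite !(altE altb) !scalerDr !scalerDl.
by rewrite !scalerA [X in X + _ = _]addrACA [LHS]addrACA.
Qed.

Lemma isom_Esp u v : beta u v = 0 -> isom (Esp u v).
Proof.
move=> uv x y; have vu : beta v u = 0 by rewrite altC // uv oppr0.
rewrite !EspE !(altE altb) uv vu !(altxx altb) !mulr0 !addr0.
by rewrite [beta u y]altC // [beta v y]altC //; ring.
Qed.

Lemma EspK u v : beta u v = 0 -> cancel (Esp (-1 *: u) v) (Esp u v).
Proof.
move=> uv w; have vu : beta v u = 0 by rewrite altC // uv oppr0.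
rewrite EspE; set y := Esp _ _ w.
have yE : y = w - beta w u *: v - beta w v *: u.
  by rewrite /y EspE altZr // mulN1r scaleNr scaleN1r scalerN.
have -> : beta y u = beta w u.
  by rewrite yE !(altE altb) vu altxx // !mulr0 !oppr0 !addr0.
have -> : beta y v = beta w v.
  by rewrite yE !(altE altb) uv altxx // !mulr0 !oppr0 !addr0.
by rewrite yE addrAC subrK subrK.
Qed.

End Isometries.

Section SymplecticBasis.
Variables (k : fieldType) (V : vectType k) (beta : V -> V -> k).
Hypothesis altb : alternating beta.
Variables (l : nat) (e f : 'I_l -> V).
Hypothesis dimV : \dim {:V} = l.*2.
Hypothesis bee : forall i j, beta (e i) (e j) = 0.
Hypothesis bff : forall i j, beta (f i) (f j) = 0.
Hypothesis bef : forall i j, beta (e i) (f j) = (i == j)%:R.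

Lemma bfe i j : beta (f i) (e j) = - (i == j)%:R.
Proof. by rewrite altC // bef eq_sym. Qed.

Lemma sum_delta (a : 'I_l -> k) j : \sum_i a i * (i == j)%:R = a j.
Proof.
rewrite (bigD1 j) //= eqxx mulr1 big1 ?addr0 // => i /negPf ->.
by rewrite mulr0.
Qed.

Lemma beta_comb_f (a c : 'I_l -> k) j :
  beta (\sum_i a i *: e i + \sum_i c i *: f i) (f j) = a j.
Proof.
rewrite altDl // !alt_suml // -[RHS](sum_delta a) -[RHS]addr0; congr (_ + _).
  by apply: eq_bigr => i _; rewrite altZl // bef.
by rewrite big1 // => i _; rewrite altZl // bff mulr0.
Qed.

Lemma beta_comb_e (a c : 'I_l -> k) j :
  beta (e j) (\sum_i a i *: e i + \sum_i c i *: f i) = c j.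
Proof.
rewrite altDr // !alt_sumr // -[RHS](sum_delta c) -[RHS]add0r; congr (_ + _).
  by rewrite big1 // => i _; rewrite altZr // bee mulr0.
by apply: eq_bigr => i _; rewrite altZr // bef eq_sym.
Qed.

Lemma sympl_expand v :
  v = \sum_i beta v (f i) *: e i + \sum_i beta (e i) v *: f i.
Proof.
pose x (i : 'I_(l + l)) := match split i with inl i => e i | inr i => f i end.
have xl i : x (lshift l i) = e i by rewrite /x -[lshift l i]/(unsplit (inl i)) unsplitK.
have xr i : x (rshift l i) = f i by rewrite /x -[rshift l i]/(unsplit (inr i)) unsplitK.
pose t := [tuple x i | i < l + l].
have tE (i : 'I_(l + l)) : t`_i = x i by rewrite -tnth_nth tnth_mktuple.
have sumE (c : 'I_(l + l) -> k) : \sum_i c i *: t`_i =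
    \sum_i c (lshift l i) *: e i + \sum_i c (rshift l i) *: f i.
  rewrite big_split_ord; congr (_ + _); apply: eq_bigr => i _.
    by rewrite (tE (lshift l i)) xl.
  by rewrite (tE (rshift l i)) xr.
have freet : free t.
  apply/freeP => c; rewrite sumE => c0 i.
  case: (split_ordP i) => j ->.
    by rewrite -[LHS](beta_comb_f (fun i => c (lshift l i)) (fun i => c (rshift l i)))
      c0 alt0l.
  by rewrite -[LHS](beta_comb_e (fun i => c (lshift l i)) (fun i => c (rshift l i)))
    c0 alt0r.
have bt : basis_of fullv t.
  by rewrite basisEfree freet subvf dimV size_tuple addnn leqnn.
have vt : v \in <<t>>%VS by rewrite (span_basis bt) memvf.
have := coord_span vt; rewrite sumE => vE.
rewrite {1}vE; congr (_ + _); apply: eq_bigr => i _; congr (_ *: _).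
  by rewrite [in RHS]vE (beta_comb_f (fun i => coord t (lshift l i) v)
    (fun i => coord t (rshift l i) v)).
by rewrite [in RHS]vE (beta_comb_e (fun i => coord t (lshift l i) v)
  (fun i => coord t (rshift l i) v)).
Qed.

Lemma sympl_nondeg u : (forall v, beta u v = 0) -> u = 0.
Proof.
move=> u0; rewrite [u]sympl_expand !big1 ?addr0 // => i _; rewrite ?u0 ?scale0r //.
by rewrite altC // u0 oppr0 scale0r.
Qed.

Lemma lfun_ext_sympl (g h : 'End(V)) :
  (forall i, g (e i) = h (e i)) -> (forall i, g (f i) = h (f i)) -> g = h.
Proof.
move=> ge gf; apply/lfunP => v; rewrite [v]sympl_expand !linearD !linear_sum /=.
by congr (_ + _); apply: eq_bigr => i _; rewrite !linearZ /= ?ge ?gf.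
Qed.

Definition bmap (e' f' : 'I_l -> V) : 'End(V) :=
  linfun (fun v => \sum_i beta v (f i) *: e' i + \sum_i beta (e i) v *: f' i).

Lemma bmapE e' f' v :
  bmap e' f' v = \sum_i beta v (f i) *: e' i + \sum_i beta (e i) v *: f' i.
Proof.
rewrite linfun_linear // => c x y; rewrite scalerDr !scaler_sumr [RHS]addrACA.
by congr (_ + _); rewrite -big_split; apply: eq_bigr => i _ /=;
  rewrite !(altE altb) scalerDl scalerA.
Qed.

Lemma sum_deltaZ (a : 'I_l -> V) j : \sum_i (i == j)%:R *: a i = a j.
Proof.
rewrite (bigD1 j) //= eqxx scale1r big1 ?addr0 // => i /negPf ->.
by rewrite scale0r.
Qed.

Lemma bmap_e e' f' i : bmap e' f' (e i) = e' i.
Proof.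
rewrite bmapE -[RHS](sum_deltaZ e') -[RHS]addr0; congr (_ + _).
  by apply: eq_bigr => j _; rewrite bef eq_sym.
by rewrite big1 // => j _; rewrite bee scale0r.
Qed.

Lemma bmap_f e' f' i : bmap e' f' (f i) = f' i.
Proof.
rewrite bmapE -[RHS](sum_deltaZ f') -[RHS]add0r; congr (_ + _).
  by rewrite big1 // => j _; rewrite bff scale0r.
by apply: eq_bigr => j _; rewrite bef.
Qed.

Lemma isom_basis (g : 'End(V)) :
  (forall i j, beta (g (e i)) (g (e j)) = 0) ->
  (forall i j, beta (g (f i)) (g (f j)) = 0) ->
  (forall i j, beta (g (e i)) (g (f j)) = (i == j)%:R) -> isom beta g.
Proof.
move=> gee gff gef u v.
have gL i : beta (g (e i)) (g v) = beta (e i) v.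
  rewrite {1}[v]sympl_expand linearD !linear_sum /= altDr // !alt_sumr //.
  rewrite big1 ?add0r => [|j _]; last by rewrite linearZ /= altZr // gee mulr0.
  rewrite -[RHS](sum_delta (fun i => beta (e i) v)); apply: eq_bigr => j _.
  by rewrite linearZ /= altZr // gef eq_sym.
have gR i : beta (g (f i)) (g v) = beta (f i) v.
  rewrite {1}[v]sympl_expand linearD !linear_sum /= altDr // !alt_sumr //.
  rewrite [X in _ + X]big1 ?addr0 => [|j _]; last by rewrite linearZ /= altZr // gff mulr0.
  rewrite [RHS]altC // -[beta v (f i)](sum_delta (fun i => beta v (f i))) -sumrN.
  apply: eq_bigr => j _.
  by rewrite linearZ /= altZr // [beta (g _) _]altC // gef mulrN.
rewrite [u]sympl_expand linearD !linear_sum /= !altDl // !alt_suml //.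
by congr (_ + _); apply: eq_bigr => i _; rewrite linearZ /= !altZl // ?gL ?gR.
Qed.

End SymplecticBasis.

(** * Lagrangians and generators of Sp *)

Section Lagrangian.
Variables (k : fieldType) (V : vectType k) (beta : V -> V -> k).
Hypothesis altb : alternating beta.
Variables (l : nat) (e f : 'I_l -> V).
Hypothesis dimV : \dim {:V} = l.*2.
Hypothesis bee : forall i j, beta (e i) (e j) = 0.
Hypothesis bff : forall i j, beta (f i) (f j) = 0.
Hypothesis bef : forall i j, beta (e i) (f j) = (i == j)%:R.
Variable X : {vspace V}.
Hypothesis spanX : <<[seq e i | i : 'I_l]>>%VS = X.

Let expand := sympl_expand altb dimV bee bff bef.
Let nondeg := sympl_nondeg altb dimV bee bff bef.
Let bfe := bfe altb bef.
Local Notation isom := (isom beta).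
Local Notation bmap := (bmap beta e f).
Let bmapEe := bmap_e altb bee bef.
Let bmapEf := bmap_f altb bff bef.
Let isK g := @isomK _ _ _ altb nondeg g.
Let isVK g := @isomVK _ _ _ altb nondeg g.
Let isV g := @isomV _ _ _ altb nondeg g.

Lemma mem_e i : e i \in X.
Proof. by rewrite -spanX memv_span // image_f. Qed.

(** X is its own orthogonal: the pairings with the e i are the coordinates along the f i. *)
Lemma memXP v : reflect (forall i, beta (e i) v = 0) (v \in X).
Proof.
apply: (iffP idP) => [|v0].
  rewrite -spanX => vX i; have -> : v = \sum_j coord [tuple e j | j < l] j v *: e j.
    rewrite {1}(@coord_span _ _ _ [tuple e j | j < l] v) //.
    by apply: eq_bigr => j _; rewrite -tnth_nth tnth_mktuple.
  by rewrite alt_sumr // big1 // => j _; rewrite altZr // bee mulr0.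
rewrite [v]expand [X in _ + X]big1 ?addr0 => [|i _]; last by rewrite v0 scale0r.
by apply: memv_suml => i _; rewrite memvZ // mem_e.
Qed.

Lemma lagr_expand v : v \in X -> v = \sum_i beta v (f i) *: e i.
Proof.
move=> /memXP v0; rewrite {1}[v]expand [X in _ + X]big1 ?addr0 // => i _.
by rewrite v0 scale0r.
Qed.

Lemma lagr_isotropic u v : u \in X -> v \in X -> beta u v = 0.
Proof.
move=> /lagr_expand -> /memXP v0; rewrite alt_suml // big1 // => i _.
by rewrite altZl // v0 mulr0.
Qed.

Lemma dim_span_e (S : {set 'I_l}) :
  \dim <<[seq e i | i in S]>>%VS = #|S|.
Proof.
pose t := [tuple e (enum_val i) | i < #|S|].
have tE : [seq e i | i in S] = t.
  apply: (@eq_from_nth _ 0) => [|i]; first by rewrite size_image size_tuple.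
  rewrite size_image => iS; have -> : i = Ordinal iS by [].
  by rewrite nth_image -tnth_nth tnth_mktuple.
rewrite tE; have /eqnP -> // : free t; last by rewrite size_tuple.
apply/freeP => c c0 i.
have: beta (\sum_j c j *: t`_j) (f (enum_val i)) = 0 by rewrite c0 alt0l.
rewrite alt_suml //.
under eq_bigr do rewrite -tnth_nth tnth_mktuple altZl // bef (inj_eq enum_val_inj).
by rewrite sum_delta.
Qed.

Lemma dimX : \dim X = l.
Proof.
have eT : [seq e i | i : 'I_l] = [seq e i | i in [set: 'I_l]].
  by apply: eq_image => i //; rewrite in_setT.
by rewrite -spanX eT dim_span_e cardsT card_ord.
Qed.

Definition stabX (g : 'End(V)) := isom g /\ (g @: X)%VS = X.

Lemma stabX_intro g : isom g -> (forall i, g (e i) \in X) -> stabX g.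
Proof.
move=> ig ge; split=> //; apply/eqP; rewrite eqEdim; apply/andP; split.
  apply/subvP => _ /memv_imgP[v vX ->]; rewrite (lagr_expand vX) linear_sum.
  by apply: memv_suml => i _; rewrite linearZ /= memvZ.
rewrite limg_dim_eq //; have /eqP -> := isom_ker altb nondeg ig.
by rewrite capv0.
Qed.

Lemma stabX_mem g v : stabX g -> (g v \in X) = (v \in X).
Proof.
case=> ig gX; apply/idP/idP => [|vX]; last by rewrite -gX memv_img.
by rewrite -{1}gX => /memv_imgP[w wX /(can_inj (isK ig)) ->].
Qed.

Lemma stabXV g : stabX g -> stabX (g^-1)%VF.
Proof.
move=> sg; have ig := sg.1; apply: stabX_intro; first exact: isV.
by move=> i; rewrite -(stabX_mem _ sg) isVK // mem_e.
Qed.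

Lemma stabX1 : stabX \1%VF.
Proof. by apply: stabX_intro => [|i]; [exact: isom1|rewrite id_lfunE mem_e]. Qed.

(** On e i the term in v vanishes because X is isotropic, and what remains adds a multiple of u. *)
Lemma stabX_Esp u v : u \in X -> beta u v = 0 -> stabX (Esp beta u v).
Proof.
move=> uX uv; apply: stabX_intro; first exact: isom_Esp.
move=> i; rewrite EspE // (lagr_isotropic (mem_e i) uX) scale0r addr0.
by rewrite memvD ?memvZ // mem_e.
Qed.

Definition tau (S : {set 'I_l}) : 'End(V) :=
  bmap (fun i => if i \in S then f i else e i)
       (fun i => if i \in S then - e i else f i).

Lemma tau_e S i : tau S (e i) = if i \in S then f i else e i.
Proof. exact: bmapEe. Qed.

Lemma tau_f S i : tau S (f i) = if i \in S then - e i else f i.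
Proof. exact: bmapEf. Qed.

Lemma isom_tau S : isom (tau S).
Proof.
have ne i j : i \in S -> (j \in S) = false -> (i == j) = false.
  by move=> iS jS; apply: contraTF iS => /eqP ->; rewrite jS.
apply: (isom_basis altb dimV bee bff bef) => i j; rewrite ?tau_e ?tau_f;
  case: ifP => iS; case: ifP => jS;
  rewrite ?(altE altb) ?bee ?bff ?bef ?bfe ?opprK ?oppr0 //.
all: by [rewrite (ne i j) // ?oppr0 | rewrite eq_sym (ne j i) // ?oppr0].
Qed.

(** The 2 by 2 matrix with rows (a, b) and (c, d) in the basis e i0, f i0, extended by the identity
    on the other planes. *)
Definition plane (i0 : 'I_l) (a b c d : k) : 'End(V) :=
  bmap (fun i => if i == i0 then a *: e i + c *: f i else e i)
       (fun i => if i == i0 then b *: e i + d *: f i else f i).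

Lemma plane_e i0 a b c d i :
  plane i0 a b c d (e i) = if i == i0 then a *: e i + c *: f i else e i.
Proof. exact: bmapEe. Qed.

Lemma plane_f i0 a b c d i :
  plane i0 a b c d (f i) = if i == i0 then b *: e i + d *: f i else f i.
Proof. exact: bmapEf. Qed.

Lemma isom_plane i0 a b c d : a * d - b * c = 1 -> isom (plane i0 a b c d).
Proof.
move=> det1.
apply: (isom_basis altb dimV bee bff bef) => i j; rewrite ?plane_e ?plane_f;
  case: eqP => [->|/eqP ni]; case: eqP => [->|/eqP nj];
  rewrite ?(altE altb) ?bee ?bff ?bef ?bfe ?eqxx ?(negPf ni) ?(negPf nj) ?(eq_sym i0)
    ?(negPf ni) ?(negPf nj) //=; try ring.
by rewrite -[RHS]det1; ring.
Qed.

Lemma stabX_plane i0 a b d : a * d = 1 -> stabX (plane i0 a b 0 d).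
Proof.
move=> ad; apply: stabX_intro => [|i].
  by apply: isom_plane; rewrite ad mulr0 subr0.
by rewrite plane_e scale0r addr0; case: ifP => _; rewrite ?memvZ ?mem_e.
Qed.

(** The condition says that t X lies in g X, hence equals it by dimension. It is phrased with g^-1
    because membership in g X is the information that the reduction collects. *)
Lemma stabX_factor g t : isom g -> isom t ->
  (forall i, (g^-1)%VF (t (e i)) \in X) -> stabX (t^-1 \o g)%VF.
Proof.
move=> ig it gt.
have sq : stabX (g^-1 \o t)%VF.
  by apply: stabX_intro => [|i]; [exact: isom_comp (isV ig) it|rewrite comp_lfunE].
have -> : (t^-1 \o g)%VF = ((g^-1 \o t)^-1)%VF; last exact: stabXV.
apply/esym/lfunP; apply: (isom_inv_uniq altb nondeg sq.1) => v.
by rewrite !comp_lfunE isVK // isK.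
Qed.

(* Relative position of the Lagrangians X, tau0 X and g X: an element of Sp can be
   brought to one of the three forms below by the stabilizer of X and tau0 X on the
   left and the stabilizer of X on the right. *)
Section Reduction.
Variables (i0 : 'I_l) (Q : 'End(V) -> Prop).
Hypothesis two_neq0 : 2 != 0 :> k.
Local Notation tau0 := (tau [set i0]).
Hypothesis Q_left : forall p g, stabX p -> stabX (tau0^-1 \o p \o tau0)%VF ->
  isom g -> Q g -> Q (p \o g)%VF.
Hypothesis Q_right : forall g p, isom g -> stabX p -> Q g -> Q (g \o p)%VF.
Hypothesis Q_tau : forall J : {set 'I_l}, i0 \notin J -> Q (tau J).
Hypothesis Q_tauU : forall J : {set 'I_l}, i0 \notin J -> Q (tau (i0 |: J)).
Hypothesis Q_plane : forall (J : {set 'I_l}) c, i0 \notin J -> c != 0 ->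
  Q (plane i0 1 c 0 1 \o tau (i0 |: J))%VF.

Lemma tau0V_Esp u v : isom tau0 ->
  (tau0^-1 \o Esp beta u v \o tau0)%VF =
  Esp beta (tau0^-1%VF u) (tau0^-1%VF v).
Proof.
move=> it; apply/lfunP => w; rewrite !comp_lfunE !EspE // !linearD !linearZ /= isK //.
have adj x : beta (tau0 w) x = beta w (tau0^-1%VF x) by rewrite -{1}[x](isVK it) it.
by rewrite !adj.
Qed.

(** The f j that already lie in g X, with i0 set apart; the size of the complement is the induction
    measure. *)
Let Jset (g : 'End(V)) := [set j | (j != i0) && ((g^-1)%VF (f j) \in X)].

(* p moves a vector of g X to a multiple of f m and fixes the f j already in g X. *)
Lemma reduction_step g m i : isom g -> m != i0 -> m \notin Jset g ->
  beta (e m) (g (e i)) != 0 ->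
  exists p, [/\ stabX p, stabX (tau0^-1 \o p \o tau0)%VF,
    stabX (p^-1)%VF, stabX (tau0^-1 \o p^-1 \o tau0)%VF &
    m |: Jset g \subset Jset (p \o g)%VF].
Proof.
move=> ig mi0 mJ d0.
pose z := g (e i) - \sum_(j in Jset g) beta (e j) (g (e i)) *: f j.
have fZ j : j \in Jset g -> (g^-1)%VF (f j) \in X by rewrite inE => /andP[].
have zX : (g^-1)%VF z \in X.
  rewrite linearB /= isK // linear_sum /= memvB ?mem_e //.
  by apply: memv_suml => j jJ; rewrite linearZ /= memvZ // fZ.
have ez j : beta (e j) z = if j \in Jset g then 0 else beta (e j) (g (e i)).
  rewrite /z altDr // altNr // alt_sumr //.
  under eq_bigr do rewrite altZr // bef.
  case: ifP => jJ.
    rewrite (bigD1 j) //= eqxx mulr1 big1 ?addr0 ?subrr // => h /andP[_ hj].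
    by rewrite eq_sym (negPf hj) mulr0.
  rewrite big1 ?subr0 // => h hJ; case: eqVneq => [jh|]; rewrite ?mulr0 //.
  by rewrite jh hJ in jJ.
have fz j : j \in Jset g -> beta z (f j) = 0.
  by move=> /fZ fX; rewrite -(isV ig) (lagr_isotropic zX fX).
clearbody z; set d := beta (e m) (g (e i)) in d0.
have emz : beta (e m) z = d by rewrite ez (negPf mJ).
set a := beta z (f m).
(* Since beta z u = -1, the exponential sends z to z - v + (beta z v) u. The term 2^-1 a e m makes
   beta z v equal to - a d / 2, so the multiples of e m cancel and d f m remains. *)
pose v := z - d *: f m - (2^-1 * a) *: e m; pose u := d^-1 *: e m.
have uX c : c *: u \in X by rewrite !memvZ // mem_e.
have ev : beta (e m) v = 0.
  by rewrite /v !(altE altb) emz bef bee eqxx mulr0 oppr0 addr0 mulr1 subrr.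
have uv : beta u v = 0 by rewrite altZl // ev mulr0.
have Ez : Esp beta u v z = d *: f m.
  have zu : beta z u = -1 by rewrite altC // altZl // emz mulVf.
  have zv : beta z v = - (2^-1 * a * d).
    rewrite /v !(altE altb) altxx // -/a (altC altb z (e m)) emz.
    by field.
  rewrite EspE // zu zv /u scalerA mulNr mulfK // scaleN1r /v.
  by rewrite !opprB scaleNr [LHS]addrC addrCA addKr addrC subrK.
have Ef j : j \in Jset g -> Esp beta u v (f j) = f j.
  move=> jJ; have mj : j != m by apply: contraNneq mJ => <-.
  rewrite EspE // altZr // bfe (negPf mj) oppr0 mulr0 scale0r addr0.
  rewrite altC // /v !(altE altb) fz // bff bef eq_sym (negPf mj).
  by rewrite !mulr0 !subr0 oppr0 scale0r addr0.
have iE : isom (Esp beta u v) by exact: isom_Esp.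
have it := isom_tau [set i0].
have tV_em : tau0^-1%VF (e m) = e m.
  have tem : tau0 (e m) = e m by rewrite tau_e inE (negPf mi0).
  by rewrite -{1}tem isK.
have sE c : stabX (Esp beta (c *: u) v).
  by apply: stabX_Esp => //; rewrite altZl // uv mulr0.
(* As m differs from i0, e m is fixed by tau0, so the conjugate is again an exponential with a
   factor in X. *)
have stE c : stabX (tau0^-1 \o Esp beta (c *: u) v \o tau0)%VF.
  rewrite tau0V_Esp // /u !linearZ /= tV_em; apply: stabX_Esp.
    by rewrite !memvZ // mem_e.
  by rewrite !altZl // -tV_em (isV it) ev !mulr0.
have EV : ((Esp beta u v)^-1)%VF = Esp beta ((-1) *: u) v.
  apply/lfunP; by apply: (isom_inv_uniq altb nondeg iE); exact: EspK.
exists (Esp beta u v); rewrite EV; split; try by rewrite -[u]scale1r.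
  by rewrite -[u]scale1r scalerA; exact: sE.
  by rewrite -[u]scale1r scalerA; exact: stE.
have iEg : isom (Esp beta u v \o g)%VF by exact: isom_comp.
apply/subsetP => j; rewrite !inE => jh.
have [ji0 [y yX yE]] : j != i0 /\ exists2 y, (g^-1)%VF y \in X & f j = Esp beta u v y.
  case/orP: jh => [/eqP ->|/andP[ji0 fX]]; split=> //; last first.
    by exists (f j) => //; rewrite Ef // inE ji0.
  exists (d^-1 *: z); first by rewrite linearZ /= memvZ.
  by rewrite linearZ /= Ez scalerA mulVf // scale1r.
by rewrite ji0 yE (isom_invM altb nondeg) // comp_lfunE isK.
Qed.

(** When no further step applies, g X contains f j for j in [Jset g], e m for every other m distinct
    from i0, and one line of the plane of i0. That line selects the model element with the same
    image of X, and the quotient of the two belongs to the stabilizer of X. *)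
Lemma sympl_induction g : isom g -> Q g.
Proof.
have [n] := ubnP #|~: Jset g|; elim: n g => // n IHn g leJ ig.
case: (boolP [exists m, exists i,
    [&& m != i0, m \notin Jset g & beta (e m) (g (e i)) != 0]]).
  case/existsP => m /existsP[i /and3P[mi0 mJ d0]].
  have [p [sp stp spV stpV sub]] := reduction_step ig mi0 mJ d0.
  have ip := sp.1.
  have ipg : isom (p \o g)%VF by exact: isom_comp.
  have -> : g = (p^-1 \o (p \o g))%VF.
    by rewrite comp_lfunA (isom_Vcomp altb nondeg) // comp_lfun1l.
  apply: Q_left => //; apply: IHn => //.
  rewrite ltnS in leJ; apply: leq_trans leJ; apply: proper_card.
  rewrite properE setCS (subset_trans (subsetUr _ _) sub) /=.
  apply/subsetPn; exists m; first by rewrite inE.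
  by rewrite inE negbK (subsetP sub) // setU11.
rewrite negb_exists => /forallP notE.
have i0J : i0 \notin Jset g by rewrite inE eqxx.
have fZ j : j \in Jset g -> (g^-1)%VF (f j) \in X by rewrite inE => /andP[].
have eg0 m i : m != i0 -> m \notin Jset g -> beta (e m) (g (e i)) = 0.
  move=> mi0 mJ; have := notE m; rewrite negb_exists => /forallP/(_ i).
  by rewrite mi0 mJ /= negbK => /eqP.
have memV v : (forall i, beta v (g (e i)) = 0) -> (g^-1)%VF v \in X.
  by move=> v0; apply/memXP => i; rewrite altC // -ig isVK // v0 oppr0.
have eZ m : m != i0 -> m \notin Jset g -> (g^-1)%VF (e m) \in X.
  by move=> mi0 mJ; apply: memV => i; exact: eg0.
have tZ i : i != i0 -> (g^-1)%VF (tau (Jset g) (e i)) \in X.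
  by move=> ii0; rewrite tau_e; case: (boolP (i \in Jset g)) => [/fZ|/(eZ _ ii0)].
have finish t : isom t -> Q t -> (forall i, (g^-1)%VF (t (e i)) \in X) -> Q g.
  move=> it Qt tX; have -> : g = (t \o (t^-1 \o g))%VF.
    by rewrite comp_lfunA (isom_compV altb nondeg) // comp_lfun1l.
  by apply: Q_right => //; apply: stabX_factor.
case: (boolP [exists i, beta (e i0) (g (e i)) != 0]); last first.
  rewrite negb_exists => /forallP e0.
  apply: (finish (tau (Jset g))); [exact: isom_tau|exact: Q_tau|] => i.
  have [->|] := eqVneq i i0; last exact: tZ.
  rewrite tau_e (negPf i0J); apply: memV => j.
  by have := e0 j; rewrite negbK => /eqP.
case/existsP => i; set z := g (e i); set d := beta (e i0) z => d0.
pose a := beta z (f i0).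
have zX : (g^-1)%VF z \in X by rewrite isK // mem_e.
(* Outside the plane of i0, the coordinates of z along e j with j in [Jset g] and along f m with m
   outside it vanish; the other components are multiples of vectors of g X and can be subtracted. *)
have yX : (g^-1)%VF (a *: e i0 + d *: f i0) \in X.
  have -> : a *: e i0 + d *: f i0 = z
      - \sum_(j | j != i0) beta z (f j) *: e j - \sum_(j | j != i0) beta (e j) z *: f j.
    rewrite {1}[z]expand (bigD1 i0) //= [X in _ + X - _ - _](bigD1 i0) //=.
    rewrite -/a -/d -addrA -opprD addrACA; exact/esym/addrK.
  rewrite !linearB !linear_sum /= !memvD //; apply: memv_suml => j ji0;
    rewrite memvN linearZ /=; case: (boolP (j \in Jset g)) => jJ.
  - by rewrite -(isV ig) (lagr_isotropic zX (fZ _ jJ)) scale0r mem0v.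
  - by rewrite memvZ // eZ.
  - by rewrite memvZ // fZ.
  - by rewrite /z eg0 // scale0r mem0v.
pose c := d^-1 * a.
have {}yX : (g^-1)%VF (c *: e i0 + f i0) \in X.
  have -> : c *: e i0 + f i0 = d^-1 *: (a *: e i0 + d *: f i0).
    by rewrite scalerDr !scalerA mulVf // scale1r.
  by rewrite linearZ /= memvZ.
have tZ' j : j != i0 -> tau (i0 |: Jset g) (e j) = tau (Jset g) (e j).
  by move=> ji0; rewrite !tau_e in_setU1 (negPf ji0).
have [c0|c0] := eqVneq c 0.
  apply: (finish (tau (i0 |: Jset g))); [exact: isom_tau|exact: Q_tauU|] => j.
  have [->|ji0] := eqVneq j i0; last by rewrite tZ' // tZ.
  by move: yX; rewrite c0 scale0r add0r tau_e setU11.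
apply: (finish (plane i0 1 c 0 1 \o tau (i0 |: Jset g))%VF).
- by apply: isom_comp; [apply: isom_plane; rewrite mulr1 mulr0 subr0|exact: isom_tau].
- exact: Q_plane.
move=> j; rewrite comp_lfunE; have [->|ji0] := eqVneq j i0.
  by rewrite tau_e setU11 plane_f eqxx scale1r.
have := tZ _ ji0; rewrite tZ' // tau_e; case: ifP => _;
  by rewrite ?plane_e ?plane_f (negPf ji0).
Qed.

End Reduction.

(** * Relative position of Lagrangians and determinant on X *)

Definition jdim (g : 'End(V)) : nat := (l - \dim (X :&: (g @: X)))%N.

Lemma jdim_stabX p1 g p2 : stabX p1 -> isom g -> stabX p2 ->
  jdim (p1 \o g \o p2)%VF = jdim g.
Proof.
move=> s1 ig s2; rewrite /jdim !limg_comp s2.2.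
have k1 : (lker p1 = 0)%VS by apply/eqP/(isom_ker altb nondeg s1.1).
suff -> : (X :&: (p1 @: (g @: X)) = p1 @: (X :&: g @: X))%VS.
  by rewrite limg_dim_eq // k1 capv0.
apply/vspaceP => v; rewrite memv_cap.
apply/andP/memv_imgP => [[vX /memv_imgP[w wg vE]]|[w]].
  by exists w => //; rewrite memv_cap wg andbT -(stabX_mem w s1) -vE.
rewrite memv_cap => /andP[wX wg] ->; split; last exact: memv_img.
by rewrite stabX_mem.
Qed.

Lemma jdim_tau S : jdim (tau S) = #|S|.
Proof.
have it := isom_tau S.
suff E : (X :&: (tau S @: X) = <<[seq e i | i in ~: S]>>)%VS.
  by rewrite /jdim E dim_span_e cardsCs setCK card_ord subKn // -[X in (_ <= X)%N]card_ord max_card.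
apply/eqP; rewrite eqEsubv; apply/andP; split; last first.
  apply/span_subvP => v /imageP[i]; rewrite inE => iS ->.
  rewrite memv_cap mem_e /=; apply/memv_imgP; exists (e i); first exact: mem_e.
  by rewrite tau_e (negPf iS).
apply/subvP => v; rewrite memv_cap => /andP[vX /memv_imgP[w wX vE]].
rewrite (lagr_expand vX); apply: memv_suml => i _.
case: (boolP (i \in S)) => iS; last by rewrite memvZ // memv_span // image_f // inE.
(* Applying [tau S] to the pairing of w with e i gives beta v (f i) = 0, so v has no component along
   e i when i is in S. *)
have := lagr_isotropic wX (mem_e i); rewrite -it -vE tau_e iS => ->.
by rewrite scale0r mem0v.
Qed.

Definition detX (g : 'End(V)) : k :=
  \det (\matrix_(i < \dim X, j < \dim X) coord (vbasis X) j (g (vbasis X)`_i)).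

(** [detX] is computed in [vbasis X], while g is diagonal in the e i; M1 and M2 are the two changes
    of basis. *)
Lemma detX_diag (g : 'End(V)) (a : 'I_l -> k) : (forall i, g (e i) = a i *: e i) ->
  detX g = \prod_i a i.
Proof.
move=> ge.
pose M1 : 'M_(\dim X, l) := \matrix_(i, j) beta (vbasis X)`_i (f j).
pose M2 : 'M_(l, \dim X) := \matrix_(i, j) coord (vbasis X) j (e i).
have vb (i : 'I_(\dim X)) : (vbasis X)`_i \in X.
  by rewrite vbasis_mem // mem_nth // size_tuple.
have M12 : M1 *m M2 = 1%:M.
  apply/matrixP => i j; rewrite !mxE -(coord_free _ _ (basis_free (vbasisP X))).
  rewrite [X in coord _ _ X](lagr_expand (vb i)) linear_sum.
  by apply: eq_bigr => h _; rewrite linearZ !mxE.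
have -> : detX g = \det (M1 *m diag_mx (\row_i a i) *m M2).
  congr (\det _); apply/matrixP => i j; rewrite !mxE.
  rewrite [X in g X](lagr_expand (vb i)) !linear_sum; apply: eq_bigr => h _.
  rewrite !linearZ /= ge linearZ /= mul_mx_diag !mxE.
  by rewrite mulrA.
have -> : \prod_i a i = \det (diag_mx (\row_i a i)).
  by rewrite det_diag; apply: eq_bigr => i _; rewrite mxE.
(* M1 and M2 become square only after [\dim X] is replaced by l, hence the generalization. *)
move: M1 M2 M12 (diag_mx _); rewrite dimX => M1 M2 M12 D.
by rewrite !det_mulmx mulrAC -det_mulmx M12 det1 mul1r.
Qed.

End Lagrangian.

Lemma card_finvect (F : finFieldType) (V : vectType F) (U : {vspace V}) :
  #|[pred x : finvect_type V | (x : V) \in U]| = (#|F| ^ \dim U)%N.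
Proof. by case: V U => T cT U; exact: (@card_vspace F (finvect_type (Vector.Pack cT)) cT U). Qed.

(** * The Weil representation over a finite field *)

Section FiniteWeilRepresentation.
Variables (F : finFieldType) (C : numFieldType) (psi : F -> C).
Hypothesis two_neq0 : 2 != 0 :> F.
Hypothesis psiD : forall x y, psi (x + y) = psi x * psi y.
Hypothesis psi_neq0 : forall x, psi x != 0.
Hypothesis psi_ntriv : exists x, psi x != 1.
Variables (V : vectType F) (beta : V -> V -> F).
Hypothesis altb : alternating beta.
Variables (l : nat) (e f : 'I_l -> V).
Hypothesis dimV : \dim {:V} = l.*2.
Hypothesis bee : forall i j, beta (e i) (e j) = 0.
Hypothesis bff : forall i j, beta (f i) (f j) = 0.
Hypothesis bef : forall i j, beta (e i) (f j) = (i == j)%:R.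
Variable X : {vspace V}.
Hypothesis spanX : <<[seq e i | i : 'I_l]>>%VS = X.

Let nondeg := sympl_nondeg altb dimV bee bff bef.
Let bfe := bfe altb bef.
Local Notation isom := (isom beta).
Local Notation stabX := (stabX beta X).
Local Notation tau := (tau beta e f).
Local Notation plane := (plane beta e f).
Let ext := lfun_ext_sympl altb dimV bee bff bef.
Let isK g := @isomK _ _ _ altb nondeg g.
Let isVK g := @isomVK _ _ _ altb nondeg g.
Let isV g := @isomV _ _ _ altb nondeg g.
Let invM := isom_invM altb nondeg.
Let lagr0 := lagr_isotropic altb dimV bee bff bef spanX.
Let eX := mem_e spanX.
Let sX_mem := stabX_mem altb dimV bee bff bef (X := X).
Let sXV := fun g => @stabXV _ _ _ altb _ _ _ dimV bee bff bef _ spanX g.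
Let sX1 := stabX1 altb dimV bee bff bef spanX.
Let sX_plane := stabX_plane altb dimV bee bff bef spanX.
Let i_tau := isom_tau altb dimV bee bff bef.
Let tauEe := tau_e altb bee bef.
Let tauEf := tau_f altb bff bef.
Let planeEe := plane_e altb bee bef.
Let planeEf := plane_f altb bff bef.
Local Notation fV := (finvect_type V).
Local Notation q := (#|F|%:R : C).

(** Left Heisenberg translations: they commute with the right translations [rhoop], and the model
    space consists of the functions fixed by those coming from X. *)
Definition Lop (a : V) (phi : V -> C) : V -> C :=
  fun w => psi (2^-1 * beta a w) * phi (a + w).

Definition covX (phi : V -> C) := forall a w, a \in X ->
  phi (a + w) = psi (2^-1 * beta w a) * phi w.

Definition avgX (phi : V -> C) : V -> C :=
  fun w => (q ^+ l)^-1 * \sum_(x : fV | (x : V) \in X) Lop x phi w.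

Definition Mop (g : 'End(V)) (phi : V -> C) : V -> C :=
  fun w => (q ^+ l)^-1 * \sum_(x : fV | (x : V) \in X)
    psi (2^-1 * beta (x : V) w) * phi ((g^-1)%VF (w + (x : V))).

(** A change of variable followed by the projection [avgX] onto the model space; the composition
    rules below express how the two interact. *)
Lemma MopE g phi : Mop g phi = avgX (phi \o (g^-1)%VF).
Proof.
apply: funext => w; rewrite /Mop /avgX; congr (_ * _).
by apply: eq_bigr => x _; rewrite /Lop /= addrC.
Qed.

(** The Heisenberg cocycle. Compared for (a, b) and (b, a), it gives the commutator
    [psi (beta b a)], the source of all the phases in the three rank one cases. *)
Lemma LopM a b phi :
  Lop a (Lop b phi) = (fun w => psi (2^-1 * beta b a) * Lop (a + b) phi w).
Proof.
apply: funext => w; rewrite /Lop !mulrA -!psiD addrA [b + a]addrC; congr (psi _ * _).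
by rewrite !(altE altb); ring.
Qed.

Lemma LopD a b phi : beta b a = 0 -> Lop (a + b) phi = Lop a (Lop b phi).
Proof. by move=> ba; rewrite LopM ba mulr0 addchar0 //; apply: funext => w; rewrite mul1r. Qed.

Lemma covXP phi : covX phi <-> forall a, a \in X -> Lop a phi = phi.
Proof.
split=> [cphi a aX|Lphi a w aX].
  apply: funext => w; rewrite /Lop cphi // mulrA -psiD (altC altb w a) mulrN subrr.
  by rewrite addchar0 // mul1r.
rewrite -{2}(Lphi a aX) /Lop mulrA -psiD (altC altb w a) mulrN addNr.
by rewrite addchar0 // mul1r.
Qed.

Lemma avgX_Lop a phi : a \in X -> avgX (Lop a phi) = avgX phi.
Proof.
move=> aX; apply: funext => w; rewrite /avgX; congr (_ * _).
rewrite [RHS](reindex_inj (addIr (a : fV))) /=.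
rewrite [RHS](eq_bigl (fun x : fV => (x : V) \in X)); last first.
  by move=> x; rewrite (@rpredDr V).
apply: eq_bigr => x xX; rewrite LopD //; exact: lagr0.
Qed.

Lemma Lop_avgX a phi : a \in X -> Lop a (avgX phi) = avgX phi.
Proof.
move=> aX; apply: funext => w; rewrite {1}/Lop /avgX mulrCA; congr (_ * _).
rewrite [RHS](reindex_inj (addrI (a : fV))) /=.
rewrite [RHS](eq_bigl (fun x : fV => (x : V) \in X)); last first.
  by move=> x; rewrite (@rpredDl V).
rewrite mulr_sumr; apply: eq_bigr => x xX; rewrite LopD //; exact: lagr0.
Qed.

Lemma covX_avgX phi : covX (avgX phi).
Proof. by apply/covXP => a aX; apply: Lop_avgX. Qed.

Lemma covX_Mop g phi : covX (Mop g phi).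
Proof. by rewrite MopE; apply: covX_avgX. Qed.

Lemma q_neq0 : q != 0.
Proof. exact: card_residue_neq0. Qed.

Lemma card_lagr : #|[pred x : fV | (x : V) \in X]| = (#|F| ^ l)%N.
Proof.
by rewrite card_finvect (dimX altb bef spanX).
Qed.

Lemma avgX_const (c : C) : (q ^+ l)^-1 * (\sum_(x : fV | (x : V) \in X) c) = c.
Proof.
rewrite sumr_const card_lagr -[c *+ _]mulr_natl natrX mulrA mulVf ?mul1r //.
by rewrite expf_neq0 // q_neq0.
Qed.

Lemma avgX_id phi : covX phi -> avgX phi = phi.
Proof.
move=> /covXP cphi; apply: funext => w; rewrite /avgX -[RHS](avgX_const (phi w)).
by congr (_ * _); apply: eq_bigr => x xX; rewrite cphi.
Qed.

Lemma Lop_conj g a phi : isom g ->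
  Lop a phi \o (g^-1)%VF = Lop (g a) (phi \o (g^-1)%VF).
Proof.
move=> ig; apply: funext => w; rewrite /Lop /= linearD /= isK //.
by rewrite -ig isVK.
Qed.

(** The change of variable by g carries the model attached to X to the one attached to g X. *)
Lemma Lop_fix g v phi : isom g -> covX phi -> (g^-1)%VF v \in X ->
  Lop v (phi \o (g^-1)%VF) = phi \o (g^-1)%VF.
Proof.
move=> ig /covXP cphi gv; rewrite -{1}[v](isVK ig) -Lop_conj //.
by apply: funext => w /=; rewrite cphi.
Qed.

Lemma covX_stabX p phi : stabX p -> covX phi -> covX (phi \o (p^-1)%VF).
Proof.
move=> sp cphi; apply/covXP => a aX; apply: Lop_fix => //; first exact: sp.1.
rewrite sX_mem //; exact: sXV.
Qed.

Lemma Mop_stabX p phi : stabX p -> covX phi -> Mop p phi = phi \o (p^-1)%VF.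
Proof. by move=> sp cphi; rewrite MopE avgX_id //; apply: covX_stabX. Qed.

Lemma avgX_stabX p phi : stabX p -> avgX (phi \o (p^-1)%VF) = avgX phi \o (p^-1)%VF.
Proof.
move=> sp; have ip := sp.1; apply: funext => w; rewrite /avgX /=; congr (_ * _).
have pinj : injective (p : fV -> fV) by exact: can_inj (isK ip).
rewrite [LHS](reindex_inj pinj) /=.
rewrite [LHS](eq_bigl (fun x : fV => (x : V) \in X)); last first.
  by move=> x; rewrite sX_mem.
by apply: eq_bigr => x xX; rewrite -Lop_conj.
Qed.

Lemma Mop_left p g phi : stabX p -> isom g -> Mop (p \o g)%VF phi = Mop p (Mop g phi).
Proof.
move=> sp ig; rewrite (Mop_stabX sp (covX_Mop g phi)) [Mop g _]MopE.
rewrite -avgX_stabX // MopE; congr avgX; apply: funext => w /=.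
by rewrite invM ?comp_lfunE //; exact: sp.1.
Qed.

Lemma Mop_right g p phi : isom g -> stabX p -> covX phi ->
  Mop (g \o p)%VF phi = Mop g (Mop p phi).
Proof.
move=> ig sp cphi; rewrite (Mop_stabX sp) // !MopE; congr avgX; apply: funext => w /=.
by rewrite invM ?comp_lfunE //; exact: sp.1.
Qed.

Definition rhoop (v : V) (phi : V -> C) : V -> C :=
  fun w => psi (2^-1 * beta w v) * phi (w + v).

Lemma covX_rho v phi : covX phi -> covX (rhoop v phi).
Proof.
move=> cphi a w aX; rewrite /rhoop -addrA cphi // !mulrA -!psiD; congr (psi _ * _).
by rewrite !(altE altb) (altC altb a v); ring.
Qed.

Lemma Mop_rho g v phi : isom g -> Mop g (rhoop v phi) = rhoop (g v) (Mop g phi).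
Proof.
move=> ig; apply: funext => w; rewrite /Mop {2}/rhoop mulrCA; congr (_ * _).
rewrite mulr_sumr; apply: eq_bigr => x _; rewrite /rhoop !mulrA -!psiD.
congr (psi _ * phi _).
  have -> : beta ((g^-1)%VF (w + x)) v = beta (w + x) (g v) by rewrite -ig isVK.
  by rewrite !(altE altb); ring.
by rewrite [w + g v + _]addrAC [in RHS]linearD /= isK.
Qed.

(** The coordinate along e i0 is equidistributed on X, since translating by t e i0 shifts it by
    t. *)
Lemma sum_lagr_coord i0 (K : F -> C) :
  (q ^+ l)^-1 * (\sum_(a : fV | (a : V) \in X) K (beta (a : V) (f i0))) =
  q^-1 * \sum_t K t.
Proof.
apply: (mulfI q_neq0); rewrite mulVKf ?q_neq0 // mulrCA.
transitivity ((q ^+ l)^-1 *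
    \sum_(a : fV | (a : V) \in X) \sum_t K (beta (a : V) (f i0) + t)).
  congr (_ * _); rewrite exchange_big /= mulr_natl -sumr_const.
  apply: eq_big => // t _.
  rewrite (reindex_inj (addIr (t *: e i0 : fV))) /=.
  apply: eq_big => [a|a _]; first by rewrite (@rpredDr V) // memvZ.
  by congr K; rewrite altDl // altZl // bef eqxx mulr1.
rewrite -[RHS]avgX_const; congr (_ * _); apply: eq_bigr => a _.
by rewrite [RHS](reindex_inj (addrI (beta (a : V) (f i0)))).
Qed.

Lemma avgX_sum (I : finType) (P : pred I) (c : C) (phi : I -> V -> C) :
  avgX (fun w => c * \sum_(i | P i) phi i w) =
  (fun w => c * \sum_(i | P i) avgX (phi i) w).
Proof.
apply: funext => w; rewrite /avgX -mulr_sumr mulrCA; congr (_ * _).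
rewrite exchange_big mulr_sumr; apply: eq_bigr => x _ /=.
by rewrite /Lop mulrCA mulr_sumr.
Qed.

Lemma avgX_scale c phi : avgX (fun w => c * phi w) = (fun w => c * avgX phi w).
Proof.
apply: funext => w; rewrite /avgX mulrCA; congr (_ * _).
by rewrite mulr_sumr; apply: eq_bigr => x _; rewrite /Lop mulrCA.
Qed.

(* Only the line spanned by f i0 in tau X is not absorbed by the average over X. *)
Lemma Mop_tau1 i0 h phi w : isom h ->
  Mop (tau [set i0]) (Mop h phi) w =
  q^-1 * \sum_t avgX (Lop (t *: f i0) (phi \o ((tau [set i0] \o h)^-1)%VF)) w.
Proof.
move=> ih; have it := i_tau [set i0].
set t0 := tau _; set phi' := phi \o _.
have -> : Mop t0 (Mop h phi) = avgX (fun w => (q ^+ l)^-1 *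
    \sum_(a : fV | (a : V) \in X) Lop (t0 a) phi' w).
  rewrite MopE; congr avgX; apply: funext => v; rewrite /= MopE /avgX.
  congr (_ * _); apply: eq_bigr => a _.
  rewrite -[LHS]/((Lop a (phi \o (h^-1)%VF) \o (t0^-1)%VF) v) Lop_conj //.
  by congr (Lop _ _ _); apply: funext => u; rewrite /phi' /= invM // comp_lfunE.
rewrite avgX_sum -(sum_lagr_coord i0); congr (_ * _); apply: eq_bigr => a aX.
set s := beta a (f i0); pose y := (a : V) - s *: e i0.
have yX : y \in X by rewrite memvB // memvZ.
have yf : beta y (f i0) = 0 by rewrite /y altDl // altNl // altZl // bef eqxx mulr1 subrr.
have -> : t0 a = y + s *: f i0.
  have t0e j : t0 (e j) = e j + (j == i0)%:R *: (f i0 - e i0).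
    by rewrite tauEe inE; case: eqVneq => [->|_]; rewrite ?scale1r ?scale0r ?addr0 // addrC subrK.
  rewrite [X in t0 X](lagr_expand altb dimV bee bff bef spanX aX) linear_sum /=.
  under eq_bigr do rewrite linearZ /= t0e scalerDr scalerA.
  rewrite big_split /= -(lagr_expand altb dimV bee bff bef spanX aX).
  rewrite -scaler_suml sum_delta -/s scalerBr /y.
  by rewrite -addrA; congr (_ + _); rewrite addrC.
rewrite LopD; first by rewrite avgX_Lop.
by rewrite altZl // altC // yf oppr0 mulr0.
Qed.

Definition eqsq (x y : F) := exists2 c, c != 0 & x = y * c ^+ 2.

Variable theta : 'End(V) -> F.
Hypothesis theta_n0 : forall g, isom g -> theta g != 0.
Hypothesis theta_stab : forall p1 g p2, stabX p1 -> isom g -> stabX p2 ->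
  eqsq (theta (p1 \o g \o p2)%VF) (theta p1 * theta g * theta p2).
Hypothesis theta_det : forall p, stabX p -> eqsq (theta p) (detX X p).
Hypothesis theta_tau1 : forall S, eqsq (theta (tau S)) 1.

Local Notation gauss := (gauss psi).
Local Notation gsign := (gsign psi).
Let g1_neq0 := gauss1_neq0 two_neq0 psiD psi_neq0 psi_ntriv.
Let gsM := gsignM two_neq0 psiD psi_neq0 psi_ntriv.

(** This is m(g) q^(j(g)/2): since omega(a) is [gauss a] divided by the square root of q, only
    integral powers of q survive. *)
Definition kappa (g : 'End(V)) : C :=
  gsign (theta g) * (q / gauss 1) ^+ jdim l X g.

Definition Sop (g : 'End(V)) (phi : V -> C) : V -> C := fun w => kappa g * Mop g phi w.

Lemma gsign_eqsq x y : eqsq x y -> gsign x = gsign y.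
Proof. by case=> c c0 ->; apply: gsign_sqr. Qed.

Lemma gsign_diag p (a : 'I_l -> F) : stabX p -> (forall i, p (e i) = a i *: e i) ->
  gsign (theta p) = gsign (\prod_i a i).
Proof.
move=> sp pe; rewrite (gsign_eqsq (theta_det sp)).
by rewrite (detX_diag altb dimV bee bff bef spanX pe).
Qed.

Lemma gsign_theta1 : gsign (theta \1%VF) = 1.
Proof.
rewrite (@gsign_diag _ (fun=> 1)) //; last by move=> i; rewrite id_lfunE scale1r.
by rewrite big1 // gsign1.
Qed.

Lemma gsign_theta_stab p1 g p2 : stabX p1 -> isom g -> stabX p2 ->
  gsign (theta (p1 \o g \o p2)%VF) =
  gsign (theta p1) * gsign (theta g) * gsign (theta p2).
Proof.
move=> s1 ig s2; rewrite (gsign_eqsq (theta_stab s1 ig s2)).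
have := (theta_n0 s1.1, theta_n0 ig, theta_n0 s2.1) => -[[n1 n] n2].
by rewrite !gsM ?mulf_neq0.
Qed.

Lemma jdim_stab0 p : stabX p -> jdim l X p = 0%N.
Proof.
by move=> sp; rewrite /jdim sp.2 capvv (dimX altb bef spanX) subnn.
Qed.

Lemma kappa_stab p1 g p2 : stabX p1 -> isom g -> stabX p2 ->
  kappa (p1 \o g \o p2)%VF = kappa p1 * kappa g * kappa p2.
Proof.
move=> s1 ig s2; rewrite /kappa gsign_theta_stab //.
rewrite (jdim_stabX altb dimV bee bff bef s1 ig s2) (jdim_stab0 s1) (jdim_stab0 s2).
by set T := _ ^+ jdim l X g; rewrite expr0; ring.
Qed.

Lemma kappa1 : kappa \1%VF = 1.
Proof. by rewrite /kappa gsign_theta1 jdim_stab0 // mulr1. Qed.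

Lemma kappa_left p g : stabX p -> isom g -> kappa (p \o g)%VF = kappa p * kappa g.
Proof. by move=> sp ig; rewrite -[(p \o g)%VF]comp_lfun1r kappa_stab // kappa1 mulr1. Qed.

Lemma kappa_right g p : isom g -> stabX p -> kappa (g \o p)%VF = kappa g * kappa p.
Proof. by move=> ig sp; rewrite -{1}[g]comp_lfun1l kappa_stab // kappa1 mul1r. Qed.

Lemma kappa_tau S : kappa (tau S) = (q / gauss 1) ^+ #|S|.
Proof.
rewrite /kappa (jdim_tau altb dimV bee bff bef spanX) (gsign_eqsq (theta_tau1 S)).
by rewrite gsign1 // mul1r.
Qed.

Lemma Mop_scale g c phi : Mop g (fun w => c * phi w) = (fun w => c * Mop g phi w).
Proof. by rewrite !MopE -avgX_scale. Qed.

Lemma covX_Sop g phi : covX (Sop g phi).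
Proof. by move=> a w aX; rewrite /Sop covX_Mop // mulrCA. Qed.

Lemma Sop_comp g h phi :
  Sop g (Sop h phi) = (fun w => kappa g * kappa h * Mop g (Mop h phi) w).
Proof. by apply: funext => w; rewrite /Sop Mop_scale mulrA. Qed.

Lemma Sop_left p g phi : stabX p -> isom g -> Sop (p \o g)%VF phi = Sop p (Sop g phi).
Proof. by move=> sp ig; rewrite Sop_comp /Sop Mop_left // kappa_left. Qed.

Lemma Sop_right g p phi : isom g -> stabX p -> covX phi ->
  Sop (g \o p)%VF phi = Sop g (Sop p phi).
Proof. by move=> ig sp cphi; rewrite Sop_comp /Sop Mop_right // kappa_right. Qed.

Lemma tauU i0 (J : {set 'I_l}) : i0 \notin J ->
  (tau [set i0] \o tau J)%VF = tau (i0 |: J).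
Proof.
move=> i0J; apply: ext => i; rewrite comp_lfunE ?tauEe ?tauEf !inE;
  have [->|ii0] := eqVneq i i0; rewrite ?(negPf i0J) /=; try case: ifP => iJ;
  by rewrite ?tauEe ?tauEf ?linearN /= ?tauEe ?tauEf ?inE ?eqxx ?(negPf ii0).
Qed.

Section TauStep.
Variable i0 : 'I_l.
Local Notation tau0 := (tau [set i0]).
Let it0 := i_tau [set i0].
(** The rule for tau0 h expressed in g = tau0 h: a left factor p of g reaches the inner operator as
    tau0^-1 p tau0, the element that the reduction keeps in the stabilizer of X. *)
Let Q g := forall phi, covX phi -> Sop tau0 (Sop (tau0^-1 \o g)%VF phi) = Sop g phi.

Lemma tau0_cancel (g : 'End(V)) : (tau0 \o (tau0^-1 \o g))%VF = g.
Proof. by rewrite comp_lfunA (isom_compV altb nondeg) // comp_lfun1l. Qed.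

Lemma tau0_cancelV (g : 'End(V)) : (tau0^-1 \o (tau0 \o g))%VF = g.
Proof. by rewrite comp_lfunA (isom_Vcomp altb nondeg) // comp_lfun1l. Qed.

Lemma Sop_tau0 g phi w : isom g ->
  Sop tau0 (Sop (tau0^-1 \o g)%VF phi) w =
  (q / gauss 1) * kappa (tau0^-1 \o g)%VF *
  (q^-1 * \sum_t avgX (Lop (t *: f i0) (phi \o (g^-1)%VF)) w).
Proof.
move=> ig; rewrite Sop_comp kappa_tau cards1 expr1 Mop_tau1 ?tau0_cancel //.
exact: isom_comp (isV it0) ig.
Qed.

(** Here f i0 lies in g X, so each translation by t f i0 acts trivially and the q terms are
    equal. *)
Lemma tauStep_tauU (J : {set 'I_l}) : i0 \notin J -> Q (tau (i0 |: J)).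
Proof.
move=> i0J phi cphi; apply: funext => w; rewrite Sop_tau0 //.
have -> : (tau0^-1 \o tau (i0 |: J))%VF = tau J.
  by rewrite -tauU // tau0_cancelV.
rewrite (eq_bigr (fun=> Mop (tau (i0 |: J)) phi w)) => [|t _]; last first.
  rewrite Lop_fix // -?MopE // linearZ /= memvZ //.
  have -> : f i0 = tau (i0 |: J) (e i0) by rewrite tauEe setU11.
  by rewrite isK.
rewrite sumr_const -[Mop _ _ _ *+ _]mulr_natl mulKf ?q_neq0 // /Sop !kappa_tau cardsU1 i0J.
by rewrite exprS.
Qed.

(** Here e i0 lies in both X and g X. Moving a translation by c e i0 across the one by t f i0 costs
    psi(t c), so only t = 0 contributes. The remaining 1/q is compensated by [gaussN1], because
    tau0^-1 is s tau0 with s equal to -1 on the plane of i0. *)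
Lemma tauStep_tau (J : {set 'I_l}) : i0 \notin J -> Q (tau J).
Proof.
move=> i0J phi cphi; apply: funext => w; rewrite Sop_tau0 //.
pose s := plane i0 (-1) 0 0 (-1).
have ss : stabX s by apply: sX_plane; rewrite mulrNN mulr1.
have tV : (tau0^-1)%VF = (s \o tau0)%VF.
  apply/lfunP; apply: (isom_inv_uniq altb nondeg it0) => v; rewrite -comp_lfunE.
  rewrite -[RHS]id_lfunE; congr (fun_of_lfun _ v); apply: ext => i;
    rewrite !comp_lfunE id_lfunE ?tauEe ?tauEf !inE; case: eqVneq => [->|ii0];
    by rewrite ?linearN /= ?planeEe ?planeEf ?eqxx ?(negPf ii0) ?scale0r ?addr0 ?add0r
      ?scaleN1r ?linearN /= ?tauEe ?tauEf ?inE ?eqxx ?(negPf ii0) ?opprK.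
rewrite tV -comp_lfunA tauU // kappa_left // kappa_tau cardsU1 i0J exprS.
rewrite (bigD1 0) //= big1 ?addr0 => [|t t0]; last first.
  have L c : avgX (Lop (t *: f i0) (phi \o ((tau J)^-1)%VF)) w = psi (t * c) *
      avgX (Lop (t *: f i0) (phi \o ((tau J)^-1)%VF)) w.
    have eJ : Lop (c *: e i0) (phi \o ((tau J)^-1)%VF) = phi \o ((tau J)^-1)%VF.
      apply: Lop_fix => //; rewrite linearZ /= memvZ //.
      have -> : e i0 = tau J (e i0) by rewrite tauEe (negPf i0J).
      by rewrite isK.
    rewrite -{1}eJ LopM addrC.
    have := LopM (c *: e i0) (t *: f i0) (phi \o ((tau J)^-1)%VF).
    move/(congr1 (fun h => avgX h w)); rewrite avgX_Lop ?memvZ // => ->.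
    rewrite !avgX_scale mulrA -psiD; congr (psi _ * _).
    rewrite !(altE altb) bef bfe eqxx /=; field.
    by [].
  have [c psic] := psi_ntriv; have := L (c / t); rewrite [t * _]mulrC divfK // => /eqP.
  by rewrite -subr_eq0 -{1}[avgX _ w]mul1r -mulrBl mulf_eq0 subr_eq0 eq_sym (negPf psic)
    => /eqP.
rewrite scale0r.
have -> : Lop 0 (phi \o ((tau J)^-1)%VF) = phi \o ((tau J)^-1)%VF.
  by apply: funext => v; rewrite /Lop alt0l // mulr0 addchar0 // mul1r add0r.
rewrite -MopE /Sop kappa_tau.
have -> : kappa s = gauss 1 / gauss (-1).
  rewrite /kappa jdim_stab0 // expr0 mulr1.
  rewrite (@gsign_diag _ (fun i => if i == i0 then -1 else 1)) // => [|i].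
    by rewrite -big_mkcond big_pred1_eq.
  by rewrite planeEe scale0r addr0; case: ifP; rewrite ?scale1r.
have n1 : gauss (-1) != 0 by apply: gauss_neq0 => //; rewrite oppr_eq0 oner_eq0.
rewrite !mulrA; congr (_ * _ * _).
have q0 := q_neq0; rewrite -(gaussN1 two_neq0 psiD psi_neq0 psi_ntriv).
by field; rewrite g1_neq0 n1.
Qed.

(** Here g X contains v = c e i0 + f i0. In t f i0 = t v - t c e i0, the translation by t v fixes
    the function and the one along e i0 is absorbed by the average, leaving the phase psi(- c t^2 /
    2). The resulting [gauss (- c)] cancels the denominator of the factor [kappa b2]. *)
Lemma tauStep_plane (J : {set 'I_l}) c : i0 \notin J -> c != 0 ->
  Q (plane i0 1 c 0 1 \o tau (i0 |: J))%VF.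
Proof.
move=> i0J c0 phi cphi; apply: funext => w.
set u := plane _ _ _ _ _; set k := (u \o _)%VF.
have su : stabX u by apply: sX_plane; rewrite mulr1.
have ik : isom k by apply: isom_comp (i_tau _); exact: su.1.
rewrite Sop_tau0 //.
(* In SL_2: a lower unipotent matrix with entry -c is an upper unipotent one times
   the Weyl element times an upper triangular one. *)
pose b1 := plane i0 1 (- c^-1) 0 1; pose b2 := plane i0 (- c) 1 0 (- c^-1).
have sb1 : stabX b1 by apply: sX_plane; rewrite mulr1.
have sb2 : stabX b2 by apply: sX_plane; rewrite mulrNN divff.
have kE : k = (tau0 \o (b1 \o tau (i0 |: J) \o b2))%VF.
  apply: ext => i; rewrite !comp_lfunE ?planeEe ?planeEf ?tauEe ?tauEf !inE;
    have [->|ii0] := eqVneq i i0; rewrite /= ?scale0r ?addr0.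
  - rewrite linearZ /= tauEe setU11 linearZ /= !planeEf eqxx !scale1r.
    rewrite linearZ linearD linearZ /= tauEe tauEf set11.
    by rewrite scalerDr scalerA mulrNN divff // scale1r scalerN scaleNr opprK addrC.
  - by case: ifP => iJ; rewrite tauEe !inE (negPf ii0) /= iJ ?planeEe ?planeEf (negPf ii0)
      ?tauEe ?tauEf !inE (negPf ii0).
  - rewrite linearN /= planeEe eqxx !scale1r scale0r addr0.
    rewrite !linearD !linearZ /= tauEe tauEf setU11 planeEf eqxx linearN /= planeEe eqxx.
    rewrite !scale1r scale0r addr0 linearD linearN linearZ /= tauEe tauEf set11.
    by rewrite scalerN scaleNr opprK addrAC addNr add0r.
  - by case: ifP => iJ; rewrite tauEf !inE (negPf ii0) /= iJ ?linearN /= ?planeEe ?planeEf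
      (negPf ii0) ?linearN /= ?tauEe ?tauEf !inE (negPf ii0).
have -> : (tau0^-1 \o k)%VF = (b1 \o tau (i0 |: J) \o b2)%VF.
  by rewrite kE tau0_cancelV.
have g1 b : gsign (theta (plane i0 1 b 0 1)) = 1.
  rewrite (@gsign_diag _ (fun=> 1)) // => [||i].
  - by rewrite big1 // gsign1.
  - by apply: sX_plane; rewrite mulr1.
  by rewrite planeEe scale0r addr0 !scale1r; case: ifP.
have kb1 : kappa b1 = 1 by rewrite /kappa jdim_stab0 // g1 mulr1.
have ku : kappa u = 1 by rewrite /kappa jdim_stab0 // g1 mulr1.
have kb2 : kappa b2 = gauss 1 / gauss (- c).
  rewrite /kappa jdim_stab0 // mulr1.
  rewrite (@gsign_diag _ (fun i => if i == i0 then - c else 1)) // => [|i].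
    by rewrite -big_mkcond big_pred1_eq.
  by rewrite planeEe scale0r addr0; case: ifP; rewrite ?scale1r.
rewrite kappa_stab // kb1 kb2 kappa_tau mul1r.
rewrite (eq_bigr (fun t => psi (2^-1 * (- c) * t ^+ 2) * Mop k phi w)) => [|t _].
  rewrite -mulr_suml -/(gauss (- c)) /Sop kappa_left // ku mul1r kappa_tau.
  have q0 := q_neq0; have n1 : gauss (- c) != 0 by apply: gauss_neq0 => //; rewrite oppr_eq0.
  by field; rewrite g1_neq0 n1 q0.
pose v := c *: e i0 + f i0.
have Lv : Lop (t *: v) (phi \o (k^-1)%VF) = phi \o (k^-1)%VF.
  apply: Lop_fix => //; rewrite linearZ /= memvZ //.
  have -> : v = k (e i0) by rewrite comp_lfunE tauEe setU11 planeEf eqxx scale1r.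
  by rewrite isK.
have := LopM (- (t * c) *: e i0) (t *: v) (phi \o (k^-1)%VF); rewrite Lv.
have -> : - (t * c) *: e i0 + t *: v = t *: f i0.
  by rewrite /v scalerDr scalerA scaleNr addKr.
move/(congr1 (fun h => avgX h w)); rewrite avgX_Lop ?memvZ // avgX_scale MopE => ->.
rewrite mulrA -psiD /v !(altE altb) bee bfe eqxx /=.
rewrite -[LHS]mul1r -(addchar0 psiD psi_neq0); congr (psi _ * _).
by field.
Qed.

Lemma Sop_tau0_comp h phi : isom h -> covX phi ->
  Sop (tau0 \o h)%VF phi = Sop tau0 (Sop h phi).
Proof.
move=> ih cphi; rewrite -[in RHS](tau0_cancelV h).
apply/esym.
have i0h : isom (tau0 \o h)%VF by exact: isom_comp.
move: (tau0 \o h)%VF i0h phi cphi => g ig.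
apply: (sympl_induction altb dimV bee bff bef spanX two_neq0 (i0 := i0) (Q := Q)) => //.
- move=> p {}g sp sp' {}ig Qg phi cphi; set p' := (_ \o tau0)%VF in sp'.
  have ig' : isom (tau0^-1 \o g)%VF by exact: isom_comp (isV it0) ig.
  have -> : (tau0^-1 \o (p \o g))%VF = (p' \o (tau0^-1 \o g))%VF.
    by rewrite /p' -!comp_lfunA tau0_cancel.
  rewrite Sop_left // -Sop_right //; last exact: covX_Sop.
  have -> : (tau0 \o p')%VF = (p \o tau0)%VF.
    by rewrite /p' -comp_lfunA tau0_cancel.
  by rewrite Sop_left // Qg // -Sop_left.
- move=> {}g p {}ig sp Qg phi cphi; rewrite comp_lfunA.
  have ig' : isom (tau0^-1 \o g)%VF by exact: isom_comp (isV it0) ig.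
  rewrite (Sop_right ig' sp) // (Sop_right ig sp) // Qg //; exact: covX_Sop.
- exact: tauStep_tau.
- exact: tauStep_tauU.
- exact: tauStep_plane.
Qed.

End TauStep.

(** The g for which the rule holds against every h are closed under composition and contain the
    stabilizer of X and the tau_{i}; [sympl_induction], applied to this property, shows that they
    exhaust the isometries. *)
Theorem Sop_mult g h phi : isom g -> isom h -> covX phi ->
  Sop (g \o h)%VF phi = Sop g (Sop h phi).
Proof.
move=> ig; move: h phi.
pose Q g := forall h phi, isom h -> covX phi -> Sop (g \o h)%VF phi = Sop g (Sop h phi).
have Qmul g1 g2 : isom g2 -> Q g1 -> Q g2 -> Q (g1 \o g2)%VF.
  move=> i2 Q1 Q2 h phi ih cphi; rewrite -comp_lfunA (Q1 _ _ (isom_comp i2 ih) cphi).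
  by rewrite (Q2 _ _ ih cphi) (Q1 _ _ i2 (covX_Sop h phi)).
have Qstab p : stabX p -> Q p by move=> sp h phi ih cphi; rewrite Sop_left.
have Qtau J : Q (tau J).
  have [n] := ubnP #|J|; elim: n J => // n IHn J leJ.
  have [->|[i iJ]] := set_0Vmem J.
    apply: Qstab; apply: (stabX_intro altb dimV bee bff bef spanX) => // i.
    by rewrite tauEe inE.
  rewrite -(setD1K iJ) -tauU ?setD11 //; apply: Qmul => //.
    by move=> h phi; exact: Sop_tau0_comp.
  by apply: IHn; rewrite (cardsD1 i) iJ in leJ.
(* The reduction needs an index i0. For l = 0 there is none, but then every isometry stabilizes
   X. *)
case: (posnP l) => [l0|l_gt0].
  apply: Qstab; apply: (stabX_intro altb dimV bee bff bef spanX) => // i.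
  by case: i => i li; exfalso; move: li; rewrite l0.
apply: (sympl_induction altb dimV bee bff bef spanX two_neq0 (i0 := Ordinal l_gt0) (Q := Q))
  => //.
- by move=> p {}g sp _ {}ig Qg; apply: Qmul => //; exact: Qstab.
- by move=> {}g p {}ig sp Qg; apply: Qmul => //; [exact: sp.1|exact: Qstab].
- move=> J c _ _; apply: Qmul => //; apply: Qstab; apply: sX_plane.
  by rewrite mulr1.
Qed.

Lemma Sop1 phi : covX phi -> Sop \1%VF phi = phi.
Proof.
move=> cphi; apply: funext => w; rewrite /Sop kappa1 mul1r Mop_stabX //=.
by rewrite (isom_inv_uniq altb nondeg (isom1 _) (h := idfun)) // => v; rewrite id_lfunE.
Qed.

End FiniteWeilRepresentation.

From mathcomp Require Import sesquilinear finmap.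
From mathcomp Require Import boolp classical_sets functions cardinality fsbigop.
From mathcomp Require Import reals ereal topology esum.
From mathcomp Require Import complex.

Local Open Scope classical_set_scope.
Local Open Scope ring_scope.

(** * Local fields and lattices *)

Section Valuation.
Variable K : localField.
Local Notation v := (@lf_val K).
Local Notation vge := (val_ge v).
Local Notation pi := (unif K).

Lemma lf_val1 : v 1 = 0.
Proof.
have := @lf_valM K 1 1 (oner_neq0 _) (oner_neq0 _); rewrite mulr1 => /eqP.
by rewrite -[X in X == _]addr0 (inj_eq (addrI _)) eq_sym => /eqP.
Qed.

Lemma lf_valN x : v (- x) = v x.
Proof.
have [->|x0] := eqVneq x 0; first by rewrite oppr0.
have n1 : (-1 : K) != 0 by rewrite oppr_eq0 oner_neq0.
have : v (-1) + v (-1) = 0 by rewrite -lf_valM // mulrNN mulr1 lf_val1.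
move=> h; have h1 : v (-1) = 0 by lia.
by rewrite -mulN1r lf_valM // h1 add0r.
Qed.

Lemma lf_valV x : x != 0 -> v x^-1 = - v x.
Proof.
move=> x0; have := @lf_valM K x x^-1 x0; rewrite invr_eq0 => /(_ x0).
by rewrite divff // lf_val1 => /eqP; rewrite eq_sym addrC addr_eq0 => /eqP.
Qed.

Lemma lf_val_unifX (n : int) : v (pi ^ n) = n.
Proof.
have pos m : v (pi ^+ m) = m%:Z.
  elim: m => [|m IHm]; first by rewrite expr0 lf_val1.
  by rewrite exprS lf_valM ?expf_neq0 ?unif_neq0 // IHm val_unif; lia.
case: n => m; first exact: pos.
by rewrite NegzE -invr_expz lf_valV ?pos // expf_neq0 // unif_neq0.
Qed.

Lemma unifX_neq0 (n : int) : pi ^ n != 0.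
Proof. by rewrite expfz_neq0 // unif_neq0. Qed.

Lemma unifXD (m n : int) : pi ^ (m + n) = pi ^ m * pi ^ n.
Proof. by rewrite expfzDr // unif_neq0. Qed.

Lemma vge0 n : vge n 0.
Proof. by left. Qed.

Lemma vgeN n x : vge n x -> vge n (- x).
Proof. by case=> [->|h]; [left; rewrite oppr0|right; rewrite lf_valN]. Qed.

Lemma vgeD n x y : vge n x -> vge n y -> vge n (x + y).
Proof.
move=> [->|hx]; first by rewrite add0r.
move=> [->|hy]; first by rewrite addr0; right.
have [->|x0] := eqVneq x 0; first by rewrite add0r; right.
have [->|y0] := eqVneq y 0; first by rewrite addr0; right.
have [->|xy0] := eqVneq (x + y) 0; first by left.
by right; apply: le_trans (lf_valD x0 y0 xy0); rewrite le_min hx hy.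
Qed.

Lemma vgeB n x y : vge n x -> vge n y -> vge n (x - y).
Proof. by move=> hx hy; apply: vgeD => //; apply: vgeN. Qed.

Lemma vgeM m n x y : vge m x -> vge n y -> vge (m + n) (x * y).
Proof.
move=> [->|hx]; first by rewrite mul0r; left.
move=> [->|hy]; first by rewrite mulr0; left.
have [->|x0] := eqVneq x 0; first by rewrite mul0r; left.
have [->|y0] := eqVneq y 0; first by rewrite mulr0; left.
by right; rewrite lf_valM // lerD.
Qed.

Lemma vge_unifX (n : int) : vge n (pi ^ n).
Proof. by right; rewrite lf_val_unifX. Qed.

Lemma vge_shift (m n : int) x : vge (m + n) (pi ^ m * x) <-> vge n x.
Proof.
split=> h; last exact: vgeM (vge_unifX m) h.
have := vgeM (vge_unifX (- m)) h.
by rewrite mulrA -unifXD addNr expr0z mul1r addrA addNr add0r.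
Qed.

Lemma fracidE (n : int) x : fracid K n x <-> vge n x.
Proof.
split=> [[y hy <-]|h]; first by have := (vge_shift n 0 y).2 hy; rewrite addr0.
exists (pi ^ (- n) * x); last by rewrite mulrA -unifXD subrr expr0z mul1r.
by have := (vge_shift (- n) n x).2 h; rewrite addNr.
Qed.

Lemma integers1 : integers K 1.
Proof. by right; rewrite lf_val1. Qed.

Lemma integers0 : integers K 0.
Proof. by left. Qed.

Lemma red0 : red (0 : K) = 0.
Proof. by apply/(red_eq0 integers0); left. Qed.

Lemma redN x : vge 0 x -> red (- x) = - red x.
Proof.
move=> hx; apply/eqP; rewrite -addr_eq0; apply/eqP.
by rewrite -redD ?addNr ?red0 //; apply: vgeN.
Qed.

Lemma red_eqP x y : vge 0 x -> vge 0 y -> (red x = red y <-> vge 1 (x - y)).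
Proof.
move=> hx hy; rewrite -(red_eq0 (vgeB hx hy)) redD ?redN //; last exact: vgeN.
by split=> [->|/eqP]; rewrite ?subrr // subr_eq0 => /eqP.
Qed.

Hypothesis resK : 2%N \notin [pchar residue K].

Lemma residue2_neq0 : 2 != 0 :> residue K.
Proof. by move: resK; rewrite inE. Qed.

Lemma integers2 : integers K 2.
Proof. by apply: vgeD; exact: integers1. Qed.

Lemma red2 : red (2 : K) = 2.
Proof. by rewrite mulr2n redD ?red1 //; exact: integers1. Qed.

(** The reduction of 2 is nonzero, so 2 is a unit and the factors 1/2 in the phases preserve all the
    fractional ideals. *)
Lemma val2 : (2 != 0 :> K) /\ v 2 = 0.
Proof.
have n1 : ~ vge 1 2.
  by move/(red_eq0 integers2); rewrite red2 => /eqP; rewrite (negPf residue2_neq0).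
have n0 : 2 != 0 :> K by apply/eqP => h; apply: n1; left.
split=> //; case: integers2 => [/eqP|h0]; first by rewrite (negPf n0).
have h1 : ~ (1 <= v 2) by move=> h; apply: n1; right.
lia.
Qed.

Lemma two_neq0K : 2 != 0 :> K.
Proof. by case: val2. Qed.

Lemma integers_half : integers K 2^-1.
Proof. by right; rewrite lf_valV ?two_neq0K // val2.2. Qed.

Lemma red_half : red (2^-1 : K) = 2^-1.
Proof.
apply: (mulfI residue2_neq0); rewrite divff ?residue2_neq0 // -red2 -redM.
- by rewrite divff ?red1 // two_neq0K.
- exact: integers2.
exact: integers_half.
Qed.

Lemma vge_half n x : vge n x -> vge n (2^-1 * x).
Proof. by move=> h; rewrite -[n]add0r; apply: vgeM => //; exact: integers_half. Qed.

End Valuation.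

(** * The additive character and its reduction *)

Section Character.
Variables (R : realType) (K : localField) (psi : addChar R K).
Local Notation vge := (val_ge (@lf_val K)).
Local Notation lam := (conductor psi).
Local Notation pi := (unif K).

Lemma lamE1 : lam - 1 + (1 - lam) = 0.
Proof. by rewrite addrA subrK subrr. Qed.

Lemma lamE2 : 1 - lam + (lam - 1) = 0.
Proof. by rewrite addrA subrK subrr. Qed.

Lemma ac_neq0 x : psi x != 0.
Proof. by rewrite -normr_eq0 ac_unitary oner_neq0. Qed.

Lemma ac0 : psi 0 = 1.
Proof.
have := ac_add psi 0 0; rewrite addr0 => h; apply: (mulfI (ac_neq0 0)).
by rewrite mulr1 -h.
Qed.

Lemma ac_vge x : vge lam x -> psi x = 1.
Proof. by move=> h; apply: ac_triv; apply/fracidE. Qed.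

Lemma ac_eq x y : vge lam (x - y) -> psi x = psi y.
Proof. by move=> h; rewrite -[x](subrK y) ac_add (ac_vge h) mul1r. Qed.

Lemma red_liftP (y : residue K) : integers K (red_lift y) /\ red (red_lift y) = y.
Proof.
rewrite /red_lift; case: xgetP => [z _ //|h].
by have [x hx xy] := red_surj y; case: (h x).
Qed.

(** Two lifts of a residue differ by an element of valuation at least 1, which scaling by pi^(lam -
    1) sends into the kernel of psi; the choice in [red_lift] is therefore immaterial. *)
Lemma psibarE z : vge (lam - 1) z -> psibar psi (red (pi ^ (1 - lam) * z)) = psi z.
Proof.
move=> hz; set y := red _; have [hl hr] := red_liftP y; apply: ac_eq.
have hz' : vge 0 (pi ^ (1 - lam) * z).
  by have := (vge_shift (1 - lam) (lam - 1) z).2 hz; rewrite lamE2.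
have := (red_eqP hl hz').1 hr => h1.
have := (vge_shift (lam - 1) 1 _).2 h1; rewrite subrK mulrBr mulrA -unifXD.
by rewrite lamE1 expr0z mul1r.
Qed.

Lemma psibar_lift x : integers K x -> psibar psi (red x) = psi (pi ^ (lam - 1) * x).
Proof.
move=> hx; rewrite -psibarE; last first.
  by have := (vge_shift (lam - 1) 0 x).2 hx; rewrite addr0.
by rewrite mulrA -unifXD lamE2 expr0z mul1r.
Qed.

Lemma psibarD x y : psibar psi (x + y) = psibar psi x * psibar psi y.
Proof.
have [[hx rx] [hy ry]] := (red_liftP x, red_liftP y).
rewrite -rx -ry -redD // !psibar_lift //; last exact: vgeD.
by rewrite mulrDr ac_add.
Qed.

Lemma psibar_neq0 x : psibar psi x != 0.
Proof. exact: ac_neq0. Qed.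

Lemma psibar_ntriv : exists x, psibar psi x != 1.
Proof.
have [x /fracidE hx psix] := ac_ntriv psi.
by exists (red (pi ^ (1 - lam) * x)); rewrite psibarE.
Qed.

End Character.

Lemma sum_fibers (C : numFieldType) (T : finType) (P : pred T) (U : choiceType)
    (Q : {fset U}) (p : T -> U) (n : nat) (h : U -> C) :
  (forall x, P x -> p x \in Q) ->
  (forall Z, Z \in Q -> #|[pred x | P x && (p x == Z)]| = n) ->
  \sum_(x | P x) h (p x) = n%:R * \sum_(Z <- Q) h Z.
Proof.
move=> pQ nP; rewrite mulr_sumr.
transitivity (\sum_(x | P x) \sum_(Z <- Q | p x == Z) h Z).
  apply: eq_bigr => x /pQ xQ; rewrite (eq_bigl (pred1 (p x))); last first.
    by move=> Z; rewrite /= eq_sym.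
  rewrite -big_filter filter_pred1_uniq ?fset_uniq // big_seq1 //.
rewrite (exchange_big_dep xpredT) //=; rewrite big_seq [RHS]big_seq.
apply: eq_bigr => Z ZQ.
by rewrite sumr_const -[h Z *+ _]mulr_natl -(nP Z ZQ).
Qed.

(** The counting identity for the constant function 1 eliminates the fibre size n, which never has
    to be computed. *)
Lemma avg_fibers (C : numFieldType) (T : finType) (P : pred T) (U : choiceType)
    (Q : {fset U}) (p : T -> U) (n : nat) (h : U -> C) (x0 : T) : P x0 ->
  (forall x, P x -> p x \in Q) ->
  (forall Z, Z \in Q -> #|[pred x | P x && (p x == Z)]| = n) ->
  (#|` Q|%:R)^-1 * \sum_(Z <- Q) h Z = (#|[pred x | P x]|%:R)^-1 * \sum_(x | P x) h (p x).
Proof.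
move=> Px0 pQ nP; rewrite (sum_fibers h pQ nP).
have := sum_fibers (fun=> 1 : C) pQ nP; rewrite !sumr_const.
rewrite big_const_seq count_predT iter_addr_0 => cE.
have -> : #|[pred x | P x]|%:R = n%:R * #|` Q|%:R :> C by rewrite -cE.
have P0 : #|[pred x | P x]|%:R != 0 :> C.
  by rewrite pnatr_eq0 -lt0n; apply/card_gt0P; exists x0; rewrite inE.
have n0 : n%:R != 0 :> C by apply: contraNneq P0 => n0; rewrite [X in X == 0]cE n0 mul0r.
by rewrite invfM mulrACA mulVf // mul1r.
Qed.

Lemma fctZD (C : numFieldType) (T : Type) (V : lmodType C) (c : C) (u v : T -> V) t :
  (c *: u + v) t = c *: u t + v t.
Proof. by []. Qed.

HB.instance Definition _ (K : localField) (W : vectType K) :=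
  isPointed.Build (vtop W) (0 : W).

Section LocalWeil.
Variables (R : realType) (K : localField) (psi : addChar R K).
Hypothesis resK : 2%N \notin [pchar residue K].
Variables (W : vectType K) (beta : {skew_symmetric W}).
Hypothesis beta_sympl : is_psymplectic beta.
Variable (B : set W).
Hypothesis goodB : good_lattice psi beta B.
Local Notation vge := (val_ge (@lf_val K)).
Local Notation lam := (conductor psi).
Local Notation pi := (unif K).
Local Notation Bdual := (dual psi beta B).
Local Notation G := (stabB beta B).

(** * The form, the lattice B and its stabilizer *)

Lemma beta_alternating : alternating (beta : W -> W -> K).
Proof.
have skew u w : beta u w = - beta w u by rewrite hermC /= expr1 mulN1r.
split=> //; first by move=> c u w z; rewrite linearPl.
move=> w; have /eqP := skew w w; rewrite -addr_eq0 -mulr2n -mulr_natl mulf_eq0.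
by rewrite (negPf (two_neq0K resK)) => /eqP.
Qed.
Let altb := beta_alternating.

Lemma beta_nondeg u : (forall w, beta u w = 0) -> u = 0.
Proof.
move=> u0; have [/eqP nd _ _] := beta_sympl.
apply/eqP; rewrite -memv0 -nd; apply/mem_orthovP => w _; exact: u0.
Qed.
Let nondeg := beta_nondeg.

Lemma B_0 : B 0.
Proof. by case: goodB => -[]. Qed.

Lemma B_D x y : B x -> B y -> B (x + y).
Proof. by case: goodB => -[_ h _ _ _] _ _; exact: h. Qed.

Lemma B_Z a x : integers K a -> B x -> B (a *: x).
Proof. by case: goodB => -[_ _ h _ _] _ _; exact: h. Qed.

Lemma integersN1 : integers K (-1).
Proof. by apply: vgeN; exact: integers1. Qed.

Lemma B_N x : B x -> B (- x).
Proof. by rewrite -scaleN1r; apply: B_Z; exact: integersN1. Qed.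

Lemma dualP v : Bdual v <-> forall b, B b -> vge lam (beta v b).
Proof. by split=> h b /h /fracidE. Qed.

Lemma D_0 : Bdual 0.
Proof. by apply/dualP => b _; rewrite (alt0l altb); exact: vge0. Qed.

Lemma D_D x y : Bdual x -> Bdual y -> Bdual (x + y).
Proof.
move=> /dualP hx /dualP hy; apply/dualP => b Bb; rewrite (altDl altb).
by apply: vgeD; [exact: hx|exact: hy].
Qed.

Lemma D_Z a x : integers K a -> Bdual x -> Bdual (a *: x).
Proof.
move=> ha /dualP hx; apply/dualP => b Bb; rewrite (altZl altb).
by rewrite -[lam]add0r; apply: vgeM => //; exact: hx.
Qed.

Lemma D_N x : Bdual x -> Bdual (- x).
Proof. by rewrite -scaleN1r; apply: D_Z; exact: integersN1. Qed.

Lemma D_B x y : Bdual x -> Bdual y -> Bdual (x - y).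
Proof. by move=> hx hy; apply: D_D => //; apply: D_N. Qed.

Lemma B_sub_D x : B x -> Bdual x.
Proof. by case: goodB => _ _; apply. Qed.

Lemma piD_B x : Bdual x -> B (pi *: x).
Proof. by case: goodB => _ h _ Dx; apply: h; exists x => //; rewrite expr1z. Qed.

Lemma beta_DB x y : Bdual x -> B y -> vge lam (beta x y).
Proof. by move=> /dualP; apply. Qed.

Lemma beta_BD x y : B x -> Bdual y -> vge lam (beta x y).
Proof. by move=> Bx Dy; rewrite (altC altb); apply: vgeN; exact: beta_DB. Qed.

(** The uniformizer moves y into B because B is good; this makes the residual form integral. *)
Lemma beta_DD x y : Bdual x -> Bdual y -> vge (lam - 1) (beta x y).
Proof.
move=> Dx Dy; have := beta_DB Dx (piD_B Dy); rewrite (altZr altb) => h.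
by apply/(vge_shift 1); rewrite expr1z addrC subrK.
Qed.

Lemma stab_isom g : G g -> isom beta g.
Proof. by case. Qed.

Let isK g (Gg : G g) := isomK altb nondeg (stab_isom Gg).
Let isVK g (Gg : G g) := isomVK altb nondeg (stab_isom Gg).

Lemma stab_B g x : G g -> B x -> B (g x).
Proof. by case=> _ gB Bx; rewrite -gB; exists x. Qed.

Lemma stab1 : G \1%VF.
Proof.
split; first exact: isom1.
by apply/seteqP; split=> [_ [x Bx <-]|x Bx]; [|exists x => //]; rewrite id_lfunE.
Qed.

Lemma stab_comp g h : G g -> G h -> G (g \o h)%VF.
Proof.
move=> Gg Gh; split; first exact: isom_comp (stab_isom Gg) (stab_isom Gh).
apply/seteqP; split=> [_ [x Bx <-]|x Bx].
  by rewrite comp_lfunE; apply: stab_B => //; apply: stab_B.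
case: Gg => _ gB; case: Gh => _ hB.
have [y By yx] : (g @` B) x by rewrite gB.
have [z Bz zy] : (h @` B) y by rewrite hB.
by exists z => //; rewrite comp_lfunE zy.
Qed.

Lemma stabV_B g x : G g -> B x -> B ((g^-1)%VF x).
Proof.
move=> Gg Bx; have [y By <-] : (g @` B) x by case: (Gg) => _ ->.
by rewrite isK.
Qed.

Lemma stabV g : G g -> G (g^-1)%VF.
Proof.
move=> Gg; split; first exact: (isomV altb nondeg (stab_isom Gg)).
apply/seteqP; split=> [_ [x Bx <-]|x Bx]; first exact: stabV_B.
by exists (g x); rewrite ?isK //; apply: stab_B.
Qed.

Lemma stabN g : G g -> G (- g).
Proof.
move=> Gg; split; first exact: isomN (stab_isom Gg).
apply/seteqP; split=> [_ [x Bx <-]|x Bx].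
  by rewrite opp_lfunE; apply: B_N; apply: stab_B.
exists (- (g^-1)%VF x); first by apply: B_N; apply: stabV_B.
by rewrite opp_lfunE linearN /= opprK isVK.
Qed.

Lemma stab_D g x : G g -> Bdual x -> Bdual (g x).
Proof.
move=> Gg /dualP Dx; apply/dualP => b Bb.
rewrite -[b](isVK Gg) (stab_isom Gg); apply: Dx; exact: stabV_B.
Qed.

Lemma stabV_D g x : G g -> Bdual x -> Bdual ((g^-1)%VF x).
Proof. by move=> Gg; apply: stab_D; exact: stabV. Qed.

(** * The residual space and the action of the stabilizer on it *)

Variable b : resQuotient psi beta B.

Lemma qliftP (u : b) : Bdual (qlift u) /\ qpr b (qlift u) = u.
Proof.
rewrite /qlift; case: xgetP => [z _ //|h].
by have [x hx xu] := qpr_surj u; case: (h x).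
Qed.

Lemma qprN v : Bdual v -> qpr b (- v) = - qpr b v.
Proof.
move=> Dv; rewrite -scaleN1r qprZ //; last exact: integersN1.
by rewrite redN ?red1 ?scaleN1r //; exact: integers1.
Qed.

Lemma qpr0 : qpr b 0 = 0.
Proof. by apply/(qpr_eq0 _ D_0); exact: B_0. Qed.

Lemma qpr_eqP v w : Bdual v -> Bdual w -> (qpr b v = qpr b w <-> B (v - w)).
Proof.
move=> Dv Dw; rewrite -(qpr_eq0 b (D_B Dv Dw)) qprD ?qprN //; last exact: D_N.
by split=> [->|/eqP]; rewrite ?subrr // subr_eq0 => /eqP.
Qed.

Lemma integers_betab v w : Bdual v -> Bdual w -> integers K (pi ^ (1 - lam) * beta v w).
Proof.
move=> Dv Dw; have := (vge_shift (1 - lam) (lam - 1) _).2 (beta_DD Dv Dw).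
by rewrite lamE2.
Qed.

(** Changing a lift by an element of B changes beta by an element of valuation at least lam, which
    disappears after scaling and reduction. *)
Lemma betabE v w : Bdual v -> Bdual w ->
  betab (qpr b v) (qpr b w) = red (pi ^ (1 - lam) * beta v w).
Proof.
move=> Dv Dw; rewrite /betab.
have [[Dv' qv] [Dw' qw]] := (qliftP (qpr b v), qliftP (qpr b w)).
set v' := qlift _ in Dv' qv *; set w' := qlift _ in Dw' qw *.
apply/red_eqP; [exact: integers_betab|exact: integers_betab|].
have -> : (1 : int) = (1 - lam) + lam by rewrite subrK.
rewrite addrK -mulrBr; apply/vge_shift.
have -> : beta v' w' - beta v w = beta (v' - v) w' + beta v (w' - w).
  by rewrite !(altE altb) addrA subrK.
apply: vgeD.
  by apply: beta_BD => //; apply/qpr_eqP.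
by apply: beta_DB => //; apply/qpr_eqP.
Qed.

Lemma betab_alternating : alternating (@betab _ _ _ _ _ _ b).
Proof.
have lift u : exists2 v, Bdual v & qpr b v = u by have [h1 h2] := qliftP u; exists (qlift u).
split=> [c u v w|u v|v].
- have [[u' Du <-] [v' Dv <-] [w' Dw <-]] := And3 (lift u) (lift v) (lift w).
  have [a ha <-] := red_surj c.
  rewrite -qprZ // -qprD //; last exact: D_Z.
  rewrite !betabE //; last by apply: D_D => //; apply: D_Z.
  rewrite -redM //; last exact: integers_betab.
  rewrite -redD; [| |exact: integers_betab]; last first.
    by rewrite -[0]addr0; apply: vgeM => //; exact: integers_betab.
  by congr red; rewrite !(altE altb); ring.
- have [[u' Du <-] [v' Dv <-]] := (lift u, lift v); rewrite !betabE //.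
  rewrite -redN; last exact: integers_betab.
  by congr red; rewrite (altC altb) mulrN.
have [v' Dv <-] := lift v; rewrite betabE // (altxx altb) mulr0; exact: red0.
Qed.

Lemma psibar_betab v w : Bdual v -> Bdual w ->
  psibar psi (2^-1 * betab (qpr b v) (qpr b w)) = psi (2^-1 * beta v w).
Proof.
move=> Dv Dw; rewrite betabE // -(red_half resK) -redM.
- rewrite mulrCA psibarE //; apply: (vge_half resK); exact: beta_DD.
- exact: integers_half.
exact: integers_betab.
Qed.

Lemma pSpE g v : G g -> Bdual v -> pSp b g (qpr b v) = qpr b (g v).
Proof.
(* [pSp] is built from chosen lifts; independence of the lift comes first, since it also yields the
   linearity on which [linfun] depends. *)
move=> Gg Dv; have key u v' : Bdual v' -> qpr b v' = u -> qpr b (g (qlift u)) = qpr b (g v').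
  move=> Dv' uE; have [Du qu] := qliftP u.
  apply/qpr_eqP; [exact: stab_D|exact: stab_D|]; rewrite -linearB.
  by apply: stab_B => //; apply/qpr_eqP => //; rewrite qu.
rewrite linfun_linear; first exact: key.
move=> c u w; have [[Du qu] [Dw qw]] := (qliftP u, qliftP w).
have [a ha ac] := red_surj c.
rewrite (key _ (a *: qlift u + qlift w)).
- rewrite linearD linearZ /= qprD ?qprZ ?ac //; try exact: stab_D.
  by apply: D_Z => //; apply: stab_D.
- by apply: D_D => //; apply: D_Z.
by rewrite qprD ?qprZ ?ac ?qu ?qw //; apply: D_Z.
Qed.

Lemma End_qpr_ext (g h : 'End(b)) :
  (forall v, Bdual v -> g (qpr b v) = h (qpr b v)) -> g = h.
Proof.
by move=> gh; apply/lfunP => u; have [Du <-] := qliftP u; exact: gh.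
Qed.

Lemma pSp_isom g : G g -> isom (@betab _ _ _ _ _ _ b) (pSp b g).
Proof.
move=> Gg u w; have [[Du <-] [Dw <-]] := (qliftP u, qliftP w).
by rewrite !pSpE // !betabE // ?(stab_isom Gg) //; apply: stab_D.
Qed.

Lemma pSp_comp g h : G g -> G h -> pSp b (g \o h)%VF = (pSp b g \o pSp b h)%VF.
Proof.
move=> Gg Gh; apply: End_qpr_ext => v Dv.
rewrite comp_lfunE !pSpE ?comp_lfunE //; [exact: stab_D|exact: stab_comp].
Qed.

Lemma pSp1 : pSp b \1%VF = \1%VF.
Proof.
by apply: End_qpr_ext => v Dv; rewrite pSpE ?id_lfunE //; exact: stab1.
Qed.

Lemma pSpN1 : pSp b (- \1%VF) = - \1%VF.
Proof.
apply: End_qpr_ext => v Dv; rewrite pSpE ?opp_lfunE ?id_lfunE ?qprN //.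
by apply: stabN; exact: stab1.
Qed.


(** * The Lagrangian A/B and restriction to cosets of B^* *)

Variable A : set W.
Hypotheses (sdA : selfdual_lattice psi beta A) (BA : B `<=` A) (AB : A `<=` Bdual).
Variable l : nat.
Hypothesis dimb : \dim {:b} = l.*2.
Variables e f : 'I_l -> b.
Hypothesis ef_basis : symplectic_basis A e f.
Variable theta : 'End(b) -> residue K.
Hypothesis theta_spec : is_theta A e f theta.

Local Notation C := (R[i]).
Local Notation X := (lagr A b).
Local Notation F := (residue K).
Local Notation psb := (psibar psi : F -> C).
Local Notation btb := (@betab _ _ _ _ _ _ b : b -> b -> F).
Local Notation q := (#|F|%:R : C).
Let altbb := betab_alternating.
Let bee : forall i j, btb (e i) (e j) = 0 := let: And4 h _ _ _ := ef_basis in h.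
Let bff : forall i j, btb (f i) (f j) = 0 := let: And4 _ h _ _ := ef_basis in h.
Let bef : forall i j, btb (e i) (f j) = (i == j)%:R := let: And4 _ _ h _ := ef_basis in h.
Let spanX : <<[seq e i | i : 'I_l]>>%VS = X := let: And4 _ _ _ h := ef_basis in h.
Let nondegb := sympl_nondeg altbb dimb bee bff bef.

Lemma A_0 : A 0.
Proof. by case: sdA => -[]. Qed.

Lemma A_D x y : A x -> A y -> A (x + y).
Proof. by case: sdA => -[_ h _ _ _] _; exact: h. Qed.

Lemma A_Z a x : integers K a -> A x -> A (a *: x).
Proof. by case: sdA => -[_ _ h _ _] _; exact: h. Qed.

Lemma A_N x : A x -> A (- x).
Proof. by rewrite -scaleN1r; apply: A_Z; exact: integersN1. Qed.

Lemma beta_AA x y : A x -> A y -> vge lam (beta x y).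
Proof. by case: sdA => _ AE; rewrite {1}AE => h Ay; apply/fracidE/h. Qed.

(** A combination of classes of elements of A lifts, coefficients included, to an element of A, and
    two lifts differ by an element of B, contained in A. *)
Lemma lagrP v : Bdual v -> (qpr b v \in X <-> A v).
Proof.
move=> Dv; split=> [|Av]; last first.
  apply: memv_span; rewrite mem_filter; apply/andP; split.
    by apply/asboolP; exists v.
  apply: etrans; [exact: (@mem_enum (finvect_type b))|exact: memvf].
rewrite /lagr; set s := [seq _ <- _ | _].
have sA u : u \in s -> exists2 a, A a & qpr b a = u.
  by rewrite mem_filter => /andP[/asboolP].
move=> vs; have [a Aa va] : exists2 a, A a & qpr b a = qpr b v.
  rewrite (@coord_span _ _ _ (in_tuple s) (qpr b v)) //.
  elim/big_ind: _ => [|x y [a Aa <-] [a' Aa' <-]|i _].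
  - by exists 0; rewrite ?qpr0 //; exact: A_0.
  - by exists (a + a'); [exact: A_D|rewrite qprD //; exact: AB].
  have [a Aa <-] := sA _ (mem_nth 0 (ltn_ord i)).
  have [c hc <-] := red_surj (coord (in_tuple s) i (qpr b v)).
  by exists (c *: a); [exact: A_Z|rewrite qprZ //; exact: AB].
have /(qpr_eqP Dv (AB Aa)) /BA h := esym va.
by rewrite -[v](subrK a); apply: A_D.
Qed.

Lemma half_dimE : half_dim b = l.
Proof. by rewrite /half_dim dimb doubleK. Qed.

Lemma qlift_lagr (u : b) : u \in X -> A (qlift u).
Proof. by have [Du qu] := qliftP u; rewrite -{1}qu => /lagrP; apply. Qed.

Definition covA (h : W -> C) := forall a w, A a ->
  h (a + w) = psi (2^-1 * beta w a) * h w.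

(* The restriction of h to the coset x + B^*, as a function on B^*/B. *)
Definition ev (x : W) (h : W -> C) : b -> C :=
  fun u => psi (2^-1 * beta (qlift u) x) * h (x + qlift u).

(** The phase in [ev] compensates the covariance of h under B, so any lift of a class may be
    used. *)
Lemma evE x h w : covA h -> Bdual w ->
  ev x h (qpr b w) = psi (2^-1 * beta w x) * h (x + w).
Proof.
move=> ch Dw; rewrite /ev; have [Dw' qw] := qliftP (qpr b w).
set w' := qlift _ in Dw' qw *.
have Bd : B (w' - w) by apply/qpr_eqP.
have -> : x + w' = (w' - w) + (x + w) by rewrite addrCA subrK.
rewrite ch; last exact: BA.
rewrite mulrA -ac_add; congr (_ * _); apply: ac_eq.
rewrite -mulrDr -mulrBr; apply: (vge_half resK).
have -> : beta w' x + beta (x + w) (w' - w) - beta w x = beta w (w' - w).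
  rewrite !(altE altb) (altC altb x w') (altC altb x w) (altxx altb); ring.
exact: beta_DB.
Qed.

Lemma ev_cov x h : covA h -> covX psb btb X (ev x h).
Proof.
move=> ch a w; have [Da <-] := qliftP a; have [Dw <-] := qliftP w => /(lagrP Da) Aa.
rewrite -qprD // !evE //; last exact: D_D.
rewrite psibar_betab // !mulrA -!ac_add.
rewrite (addrCA x) (ch _ _ Aa) mulrA -ac_add; congr (psi _ * _).
by rewrite !(altE altb) (altC altb (qlift a) x); ring.
Qed.

Lemma ev_shift x v h : covA h -> Bdual v ->
  ev (x + v) h = (fun u => psi (2^-1 * beta x v) * rhoop psb btb (qpr b v) (ev x h) u).
Proof.
move=> ch Dv; apply: funext => u; rewrite /rhoop.
have [Du <-] := qliftP u; rewrite -qprD // !evE //; last exact: D_D.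
rewrite psibar_betab // !mulrA -!ac_add -addrA [v + _]addrC; congr (psi _ * _).
by rewrite !(altE altb) (altC altb x v); ring.
Qed.

Lemma ev0 x h : covA h -> ev x h 0 = h x.
Proof.
by move=> ch; rewrite -qpr0 evE ?alt0l ?mulr0 ?ac0 ?mul1r ?addr0 //; exact: D_0.
Qed.

(** The summand of M_A is constant on cosets of N, the intersection of A and gA. As N contains B,
    the average may be taken over A/B, where it is the finite operator evaluated at the origin. *)
Lemma MA_avg g h w : G g -> covA h ->
  MA psi beta A g h w = Mop psb btb l X (pSp b g) (ev ((g^-1)%VF w) h) 0.
Proof.
move=> Gg ch; rewrite /MA; set Q := cosets _ _.
pose Fn a := psi (2^-1 * beta a w) * h ((g^-1)%VF (a + w)).
pose N := A `&` g @` A.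
have BN x : B x -> N x.
  move=> Bx; split; first exact: BA.
  by exists ((g^-1)%VF x); [apply/BA/stabV_B|rewrite isVK].
have ND x y : N x -> N y -> N (x + y).
  move=> [Ax [x' Ax' xE]] [Ay [y' Ay' yE]]; split; first exact: A_D.
  by exists (x' + y'); [exact: A_D|rewrite linearD /= xE yE /=].
have NN x : N x -> N (- x).
  move=> [Ax [x' Ax' xE]]; split; first exact: A_N.
  by exists (- x'); [exact: A_N|rewrite linearN /= xE /=].
have N0 : N 0 by apply/BN/B_0.
have FnN a c : A a -> N c -> Fn (a + c) = Fn a.
  move=> Aa [Ac [c' Ac' cE]]; rewrite /Fn.
  have -> : (g^-1)%VF (a + c + w) = c' + (g^-1)%VF (a + w).
    by rewrite (addrAC a c w) [LHS]linearD /= -cE isK // [RHS]addrC.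
  rewrite ch // mulrA -ac_add; congr (_ * _); apply: ac_eq.
  rewrite -mulrDr -mulrBr; apply: (vge_half resK).
  have -> : beta ((g^-1)%VF (a + w)) c' = beta (a + w) c.
    by rewrite -(stab_isom Gg) isVK // cE.
  have -> : beta (a + c) w + beta (a + w) c - beta a w = beta a c.
    by rewrite !(altE altb) (altC altb c w); ring.
  exact: beta_AA.
pose p (x : finvect_type b) := [set qlift (x : b) + u | u in N].
have pP x a : (x : b) \in X -> A a -> (p x = [set a + u | u in N]) <-> N (a - qlift (x : b)).
  move=> xX Aa; split=> [pE|Nd].
    have [u Nu uE] : p x a by rewrite pE; exists 0; rewrite ?addr0.
    by rewrite -uE addrAC subrr add0r.
  apply/seteqP; split=> [_ [u Nu <-]|_ [u Nu <-]].
    exists (qlift (x : b) - a + u); last by rewrite addrA [a + _]addrC subrK.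
    by apply: ND => //; rewrite -opprB; apply: NN.
  exists (a - qlift (x : b) + u); first exact: ND.
  by rewrite addrA (addrC (qlift _)) subrK.
have pQ (x : finvect_type b) : (x : b) \in X -> Q (p x).
  by move=> xX; exists (qlift (x : b)) => //; exact: qlift_lagr.
have QE : Q = p @` [set x : finvect_type b | (x : b) \in X].
  apply/seteqP; split=> [_ [a Aa <-]|_ [x xX <-]]; last exact: pQ.
  have qX : qpr b a \in X by apply/lagrP => //; exact: AB.
  exists (qpr b a) => //; apply/pP => //; apply: BN.
  by have [Dq qE] := qliftP (qpr b a); apply/qpr_eqP; rewrite ?qE //; exact: AB.
have finQ : finite_set Q.
  by rewrite QE; apply: finite_image; exact: (@finite_finset (finvect_type b)).
(* The order of N/B, which is the common fibre size: translation by x0 maps N/B onto the fibre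
   through x0. *)
pose n := #|[pred x : finvect_type b | ((x : b) \in X) && `[< N (qlift (x : b)) >]]|.
rewrite fsbig_finite //=.
rewrite (@avg_fibers _ _ (fun x : finvect_type b => (x : b) \in X) _ (fset_set Q) p n
  (fun Z => Fn (Defs.repr (Z : set W))) 0); first last.
- move=> Z; rewrite in_fset_set // inE QE => -[x0 x0X <-].
  have [D0 q0] := qliftP (x0 : b).
  rewrite /n -!sum1_card [RHS](reindex_inj (addIr (- x0))) /=.
  apply: eq_bigl => x; rewrite !inE.
  have [xX|xX] := boolP ((x : b) \in X); last first.
    by rewrite (@rpredDr b) ?(negPf xX) // rpredN.
  rewrite (@rpredDr b) ?rpredN // xX /=.
  have [Dx qx] := qliftP (x : b); have [Dd qd] := qliftP (x - x0 : b).
  have Bd : B (qlift (x - x0 : b) - (qlift (x : b) - qlift (x0 : b))).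
    by apply/qpr_eqP => //; [exact: D_B|rewrite qd qprD ?qprN ?qx ?q0 //; exact: D_N].
  apply/eqP/asboolP => [/(pP _ _ xX (qlift_lagr x0X)) Nx|Nx].
    rewrite -[qlift (x - x0)](subrK (qlift (x : b) - qlift (x0 : b))).
    by apply: ND; [exact: BN|rewrite -opprB; exact: NN].
  apply/(pP _ _ xX (qlift_lagr x0X)); rewrite -opprB; apply/NN.
  rewrite -[_ - _](subKr (qlift (x - x0 : b))); apply: ND => //.
  exact/NN/BN.
- by move=> x xX; rewrite in_fset_set // inE; exact: pQ.
- exact: mem0v.
rewrite /Mop -natrX.
have <- : #|[pred x : finvect_type b | (x : b) \in X]| = (#|F| ^ l)%N.
  exact: (card_lagr altbb bef spanX).
congr (_ * _); apply: eq_bigr => x xX.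
have [Dx qx] := qliftP (x : b); have Ax := qlift_lagr xX.
have [u Nu <-] : p x (Defs.repr (p x)).
  by rewrite /Defs.repr; case: xgetP => // /(_ (qlift (x : b))) []; exists 0; rewrite ?addr0.
rewrite FnN // (alt0r altbb) mulr0 (addchar0 (psibarD psi) (psibar_neq0 psi)) mul1r add0r.
have gI := pSp_isom Gg.
have -> : ((pSp b g)^-1)%VF x = qpr b ((g^-1)%VF (qlift (x : b))).
  rewrite -{1}qx -{1}[qlift _](isVK Gg) -pSpE; [|by []|exact: stabV_D].
  exact: (isomK altbb nondegb).
rewrite evE //; last exact: stabV_D.
by rewrite (isomV altb nondeg (stab_isom Gg)) -linearD addrC.
Qed.

(** [MA_avg] only evaluates at the origin of the finite model; [ev_shift] turns the displacement w
    into a Heisenberg translation, which [Mop_rho] carries through the operator. *)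
Lemma MA_shift g h x w : G g -> covA h -> Bdual w ->
  MA psi beta A g h (x + w) =
  psi (2^-1 * beta x w) * Mop psb btb l X (pSp b g) (ev ((g^-1)%VF x) h) (qpr b w).
Proof.
move=> Gg ch Dw; rewrite MA_avg // linearD /= ev_shift //; last exact: stabV_D.
rewrite Mop_scale (Mop_rho (psibarD psi) altbb dimb bee bff bef) //; last exact: pSp_isom.
rewrite /rhoop (alt0l altbb) mulr0 (addchar0 (psibarD psi) (psibar_neq0 psi)) mul1r add0r.
rewrite (isomV altb nondeg (stab_isom Gg)) pSpE ?isVK //; exact: stabV_D.
Qed.

Lemma covA_MA g h : G g -> covA h -> covA (MA psi beta A g h).
Proof.
(* The roles are exchanged: w is the base point and a the displacement, whose class lies in X. *)
move=> Gg ch a w Aa; rewrite [a + w]addrC MA_shift //; last exact: AB.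
congr (_ * _); rewrite -[qpr b a]addr0 (MA_avg _ Gg) //.
rewrite (covX_Mop (psibarD psi) (psibar_neq0 psi) altbb dimb bee bff bef spanX) //.
  by rewrite (alt0l altbb) mulr0 (addchar0 (psibarD psi) (psibar_neq0 psi)) mul1r.
by apply/lagrP => //; exact: AB.
Qed.

Lemma ev_MA g h x : G g -> covA h ->
  ev x (MA psi beta A g h) = Mop psb btb l X (pSp b g) (ev ((g^-1)%VF x) h).
Proof.
move=> Gg ch; apply: funext => u; have [Du <-] := qliftP u.
rewrite evE //; last exact: covA_MA.
rewrite MA_shift // mulrA -ac_add -mulrDr (altC altb x) subrr mulr0.
by rewrite ac0 mul1r.
Qed.


(** * The normalized operators and the representation of the stabilizer *)

Let thn0 : forall g, isom btb g -> theta g != 0 := theta_neq0 theta_spec.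
Let thstab : forall p1 g p2, stabX btb X p1 -> isom btb g -> stabX btb X p2 ->
  eqsq (theta (p1 \o g \o p2)%VF) (theta p1 * theta g * theta p2) := theta_bi theta_spec.
Let thdet : forall p, stabX btb X p -> eqsq (theta p) (detX X p) := theta_P theta_spec.
Let two0 := residue2_neq0 resK.
Let pD := psibarD psi.
Let pn0 := psibar_neq0 psi.
Let pnt := psibar_ntriv psi.

Lemma theta_tau_std S : eqsq (theta (tau btb e f S)) 1.
Proof.
apply: (theta_tau theta_spec (S := S)) => i.
rewrite (tau_e altbb bee bef) (tau_f altbb bff bef).
by case: (i \in S).
Qed.
Let thtau := theta_tau_std.

Lemma sqrtq_sqr : sqrtq R K ^+ 2 = q.
Proof. exact: sqrtCK. Qed.

Lemma sqrtq_neq0 : sqrtq R K != 0.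
Proof. by rewrite -sqrf_eq0 sqrtq_sqr card_residue_neq0. Qed.

Lemma jbE g : jb A g = jdim l X g.
Proof. by rewrite /jb half_dimE. Qed.

Lemma mb_kappa g : mb A theta g * sqrtq R K ^+ jb A g = kappa psb l X theta g.
Proof.
have sq0 := sqrtq_neq0; have g0 := gauss1_neq0 two0 pD pn0 pnt.
have o1 : omega psi 1 = (sqrtq R K)^-1 * gauss psb 1 by [].
have o10 : omega psi 1 != 0 by rewrite o1 mulf_neq0 // invr_eq0.
rewrite /mb /kappa -jbE /gsign -[omega psi (theta g)]/((sqrtq R K)^-1 * gauss psb (theta g)).
rewrite expfzDr // expr1z -exprz_inv -[_ ^ (Posz _)]/(_ ^+ _) -sqrtq_sqr.
rewrite expr_div_n o1 !invfM !invrK !exprMn !exprVn.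
set j := jb A g; set s := sqrtq R K; set g1 := gauss psb 1; set gt := (gauss _ _)^-1.
have sj0 : s ^+ j != 0 by rewrite expf_neq0.
have gj0 : g1 ^+ j != 0 by rewrite expf_neq0.
by move: (s ^+ j) (g1 ^+ j) sj0 gj0 => x y x0 y0; field; rewrite sq0 y0.
Qed.

Lemma S_barE g phi : S_bar A theta g phi = Sop psb btb l X theta g phi.
Proof.
by apply: funext => w; rewrite /S_bar /Sop mb_kappa half_dimE -mulrA.
Qed.

Lemma Hbar_S_bar g phi : Hbar A (S_bar A theta g phi).
Proof.
by rewrite S_barE; apply: (covX_Sop pD pn0 altbb dimb bee bff bef spanX).
Qed.

Lemma S_tilde_comp g h phi : G g -> G h -> Hbar A phi ->
  S_tilde A theta (g \o h)%VF phi = S_tilde A theta g (S_tilde A theta h phi).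
Proof.
move=> Gg Gh cphi; rewrite /S_tilde pSp_comp // !S_barE.
by apply: (Sop_mult two0 pD pn0 pnt altbb dimb bee bff bef spanX thn0 thstab thdet thtau) => //;
  exact: pSp_isom.
Qed.

Lemma S_tilde1 phi : Hbar A phi -> S_tilde A theta \1%VF phi = phi.
Proof.
move=> cphi; rewrite /S_tilde pSp1 S_barE.
exact: (Sop1 two0 pD pn0 pnt altbb dimb bee bff bef spanX thdet).
Qed.

Lemma S_tilde_linear g c phi phi' :
  S_tilde A theta g (c *: phi + phi') = c *: S_tilde A theta g phi + S_tilde A theta g phi'.
Proof.
apply: funext => w; rewrite /S_tilde /S_bar !fctE /= /GRing.scale /= mulrCA -mulrDr.
congr (_ * _); rewrite mulr_sumr -big_split; apply: eq_bigr => x _ /=.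
by rewrite ?fctE /= /GRing.scale /=; ring.
Qed.

Lemma S_tildeZ g c phi : S_tilde A theta g (c *: phi) = c *: S_tilde A theta g phi.
Proof.
have S0 : S_tilde A theta g 0 = 0.
  have := S_tilde_linear g 1 0 0; rewrite !scale1r addr0 => /eqP.
  by rewrite -subr_eq0 opprD addrA subrr sub0r oppr_eq0 => /eqP.
by have := S_tilde_linear g c phi 0; rewrite S0 !addr0.
Qed.

Lemma stabX_N1 : stabX btb X (- \1%VF).
Proof.
apply: (stabX_intro altbb dimb bee bff bef spanX).
  by apply: (@isomN _ _ btb) => //; exact: isom1.
by move=> i; rewrite opp_lfunE id_lfunE rpredN (mem_e spanX).
Qed.

Lemma jb_N1 : jb A (pSp b (- \1%VF)) = 0%N.
Proof. by rewrite jbE pSpN1; exact: (jdim_stab0 altbb bef spanX stabX_N1). Qed.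

(** -Id stabilizes X, so its j is 0 and the sign is the quadratic character of its theta. *)
Lemma central_sign_sqr : central_sign A theta * central_sign A theta = 1.
Proof.
have -> : central_sign A theta = gsign psb (theta (- \1%VF)).
  have := mb_kappa (pSp b (- \1%VF)); rewrite jb_N1 mulr1 /kappa -jbE jb_N1 mulr1 pSpN1.
  by rewrite /central_sign pSpN1.
by apply: gsign_sqr1 => //; apply: thn0; exact: stabX_N1.1.
Qed.

Lemma S_tildeN1 phi : Hbar A phi ->
  S_tilde A theta (- \1%VF) phi = (fun u => central_sign A theta * phi (- u)).
Proof.
move=> cphi; rewrite /S_tilde S_barE; apply: funext => u.
rewrite /Sop -mb_kappa jb_N1 mulr1; congr (_ * _); rewrite pSpN1.
rewrite (Mop_stabX pD pn0 altbb dimb bee bff bef spanX stabX_N1) //=; congr phi.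
apply: (isom_inv_uniq altbb nondegb stabX_N1.1 (h := -%R)) => v.
by rewrite opp_lfunE id_lfunE opprK.
Qed.

Lemma SAE g h : SA A theta g h = (fun w => kappa psb l X theta (pSp b g) * MA psi beta A g h w).
Proof. by apply: funext => w; rewrite -mb_kappa. Qed.

Lemma covA_SA g h : G g -> covA h -> covA (SA A theta g h).
Proof. by move=> Gg ch a w Aa; rewrite SAE covA_MA // mulrCA. Qed.

Lemma ev_SA g h x : G g -> covA h ->
  ev x (SA A theta g h) = S_tilde A theta g (ev ((g^-1)%VF x) h).
Proof.
move=> Gg ch; apply: funext => u; rewrite /S_tilde S_barE /Sop -ev_MA // SAE /ev.
by rewrite mulrCA.
Qed.

Lemma ev_inj h h' : covA h -> covA h' -> (forall x, ev x h = ev x h') -> h = h'.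
Proof. by move=> ch ch' hh; apply: funext => x; rewrite -ev0 // hh ev0. Qed.

Lemma invV_comp g h x : G g -> G h -> ((g \o h)^-1)%VF x = (h^-1)%VF ((g^-1)%VF x).
Proof.
move=> Gg Gh; rewrite (isom_invM altb nondeg) ?comp_lfunE //; exact: stab_isom.
Qed.

Lemma SA_comp g h k : G g -> G h -> covA k ->
  SA A theta (g \o h)%VF k = SA A theta g (SA A theta h k).
Proof.
move=> Gg Gh ck; have Ggh := stab_comp Gg Gh.
apply: ev_inj; [exact: covA_SA|by apply: covA_SA => //; exact: covA_SA|] => x.
rewrite !ev_SA //; last exact: covA_SA.
rewrite S_tilde_comp ?invV_comp //; exact: ev_cov.
Qed.

Lemma inv1 : (\1^-1)%VF =1 (id : W -> W).
Proof. by apply: (isom_inv_uniq altb nondeg (isom1 _)) => v; rewrite id_lfunE. Qed.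

Lemma SA1 k : covA k -> SA A theta \1%VF k = k.
Proof.
move=> ck; have G1 := stab1; apply: ev_inj => //; first exact: covA_SA.
by move=> x; rewrite ev_SA // S_tilde1 ?inv1 //; exact: ev_cov.
Qed.

Lemma covA_linear c k k' : covA k -> covA k' ->
  covA (c *: (k : W -> C^o) + (k' : W -> C^o)).
Proof.
move=> ck ck' a w Aa; rewrite !fctE /= ck // ck' // /GRing.scale /=.
by rewrite mulrDr mulrCA.
Qed.

Lemma ev_linear x c k k' : ev x (c *: (k : W -> C^o) + (k' : W -> C^o)) =
  c *: (ev x k : b -> C^o) + (ev x k' : b -> C^o).
Proof.
apply: funext => u; rewrite /ev !fctE /= /GRing.scale /=.
by rewrite mulrDr mulrCA.
Qed.

Lemma SA_at g k x : G g -> covA k ->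
  SA A theta g k x = S_tilde A theta g (ev ((g^-1)%VF x) k) 0.
Proof. by move=> Gg ck; rewrite -ev_SA // ev0 //; exact: covA_SA. Qed.

Lemma SA_linear g c k k' : G g -> covA k -> covA k' ->
  SA A theta g (c *: (k : W -> C^o) + (k' : W -> C^o)) =
  c *: SA A theta g k + SA A theta g k'.
Proof.
move=> Gg ck ck'; apply: funext => w; rewrite SA_at //; last exact: covA_linear.
by rewrite ev_linear S_tilde_linear !fctE /= !SA_at.
Qed.

Lemma invN1 : ((- \1)^-1)%VF =1 (-%R : W -> W).
Proof.
apply: (isom_inv_uniq altb nondeg (isomN altb (isom1 _))) => v.
by rewrite opp_lfunE id_lfunE opprK.
Qed.

Lemma stabN1 : G (- \1%VF).
Proof. by apply: stabN; exact: stab1. Qed.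

Lemma SA_N1 k : covA k -> SA A theta (- \1%VF) k = (fun w => central_sign A theta * k (- w)).
Proof.
move=> ck; apply: funext => w; rewrite -(ev0 w (covA_SA stabN1 ck)) ev_SA //; last exact: stabN1.
by rewrite S_tildeN1 ?invN1 ?oppr0 ?ev0 //; exact: ev_cov.
Qed.

Lemma rho_tildeE v phi : rho_tilde v 0 phi = rhoop psb btb (qpr b v) phi.
Proof.
apply: funext => u; rewrite /rho_tilde fctE /= ac0 scale1r /rho_bar add0r.
by [].
Qed.

(** The phase and the translation in [sigma] are those that [ev_shift] produces when the base point
    moves from x to g^-1 x inside x + B^*. *)
Lemma sigma_ev x g h : K_hat psi beta B x g -> covA h ->
  sigma A theta x g (ev x h) = S_tilde A theta g (ev ((g^-1)%VF x) h).
Proof.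
move=> [Gg Dg] ch; rewrite /sigma rho_tildeE -S_tildeZ; congr S_tilde.
have Dv : Bdual ((g^-1)%VF x - x).
  by rewrite -opprB -[X in X - _](isK Gg) -linearB; apply: D_N; exact: stabV_D.
rewrite -[(g^-1)%VF x in RHS](subrK x) [_ - x + x]addrC ev_shift //.
by apply: funext => u; rewrite !(altE altb) (altxx altb) subr0.
Qed.

(* The map to the induced representation sends k to g |-> ev x (SA g k); a function is
   recovered from its image on the translates g^-1 x + B^*, which cover D. *)
Section MainEquivalence.
Variables (D : set W) (x : W) (eps : C).
Hypothesis Ddual : forall w d, D w -> Bdual d -> D (w + d).
Hypothesis Dopp : forall w, D w -> D (- w).
Hypothesis Dstab : forall g w, G g -> D w -> D (g w).
Hypothesis Dfin : finite_set (cosets D A).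
Hypothesis Dx : D x.
Hypothesis Dtrans : forall y, D y -> exists2 g, G g & Bdual (g y - x).

Local Notation cs := (central_sign A theta).
Local Notation E := (E_supp psi beta A D eps).
Local Notation E' := (ind_sigma_space A theta x (cs * eps)).
Local Notation St := (S_tilde A theta).
Local Notation U := (SA A theta).

(** Only the finitely many cosets of A that meet D contribute to the norm, so square-integrability
    is automatic. *)
Lemma HA_supp (k : W -> C^o) : covA k -> (forall w, k w != 0 -> D w) -> HA psi beta A k.
Proof.
move=> ck kD; split=> //.
have cosE w w' : A (w' - w) -> [set w + u | u in A] = [set w' + u | u in A].
  move=> Aw; apply/seteqP; split=> [_ [u Au <-]|_ [u Au <-]].
    exists (u - (w' - w)); first by apply: A_D => //; exact: A_N.
    by rewrite opprB [u + _]addrC addrA addrCA subrr addr0.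
  by exists (w' - w + u); [exact: A_D|rewrite addrA [w + _]addrC subrK].
rewrite (@esumID _ _ (cosets D A)); last by move=> Z _; rewrite lee_fin sqr_ge0.
rewrite [X in (_ + X)%E]esum1 ?adde0 => [|Z [[w _ wZ] nD]]; last first.
  have rZ : Z (Defs.repr Z).
    rewrite /Defs.repr; case: xgetP => // /(_ w) []; rewrite -wZ.
    by exists 0; rewrite ?addr0 //; exact: A_0.
  suff -> : k (Defs.repr Z) = 0 by rewrite Normc.normc0 expr0n.
  apply: contrapT => /eqP /kD Dr; apply: nD; exists (Defs.repr Z) => //.
  rewrite -wZ in rZ *; case: rZ => u Au uE; apply: cosE.
  by rewrite -uE opprD addrA subrr sub0r; exact: A_N.
have finI : finite_set (cosets setT A `&` cosets D A).
  by apply: sub_finite_set Dfin => Z [].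
rewrite esum_fset //; last by move=> Z _; rewrite lee_fin sqr_ge0.
by rewrite fsbig_finite //= sumEFin ltry.
Qed.

Lemma E_cov k : E k -> covA k.
Proof. by case=> -[]. Qed.

Lemma E_intro (k : W -> C^o) : covA k -> (forall w, k w != 0 -> D w) ->
  (forall w, k (- w) = eps * k w) -> E k.
Proof. by move=> ck kD kN; split=> //; exact: HA_supp. Qed.

(** The origin of the index [cs * eps]: besides the parity, the normalization of the operator of -Id
    contributes its own sign. *)
Lemma E_N1 k : E k -> U (- \1%VF) k = (cs * eps) *: (k : W -> C^o).
Proof.
move=> Ek; have [_ _ kN] := Ek; rewrite SA_N1; last exact: E_cov.
by apply: funext => w; rewrite fctE /= kN mulrA.
Qed.

Lemma compN1 (g : 'End(W)) : (- \1 \o g)%VF = (- g)%R /\ (g \o - \1)%VF = (- g)%R.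
Proof.
split; apply/lfunP => v; rewrite comp_lfunE !opp_lfunE ?id_lfunE //.
by rewrite linearN.
Qed.

Lemma St0 g : St g 0 = 0.
Proof. by have := S_tildeZ g 0 0; rewrite !scale0r. Qed.

Lemma SA_Z g c k : G g -> covA k -> U g (c *: (k : W -> C^o)) = c *: U g k.
Proof.
move=> Gg ck; have c0 : covA (0 : W -> C^o) by move=> a w _; rewrite mulr0.
have U0 : U g 0 = 0.
  have := SA_linear 0 Gg c0 c0; rewrite !scale0r !add0r //.
  move=> h; apply: funext => w; rewrite SA_at //.
  have -> : ev ((g^-1)%VF w) (0 : W -> C^o) = 0.
    by apply: funext => u; rewrite /ev mulr0.
  by rewrite St0.
by have := SA_linear c Gg ck c0; rewrite U0 !addr0.
Qed.

Lemma E_stable g k : G g -> E k -> E (U g k).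
Proof.
move=> Gg Ek; have ck := E_cov Ek; have [_ kD kN] := Ek.
apply: E_intro; first exact: covA_SA.
  move=> w; rewrite SA_at // => nz; apply: contrapT => nD; move/negP: nz; apply.
  have -> : ev ((g^-1)%VF w) k = 0; last by rewrite St0.
  apply: funext => u; rewrite /ev; have [Du _] := qliftP u.
  case: (eqVneq (k ((g^-1)%VF w + qlift u)) 0) => [->|/kD Dk]; first by rewrite mulr0.
  exfalso; apply: nD; rewrite -(isVK Gg w); apply: Dstab => //.
  by rewrite -[(g^-1)%VF w](addrK (qlift u)); apply: Ddual => //; exact: D_N.
(* Parity is read off from the operator of -Id, which commutes with that of g because -Id is
   central; its sign has to be cancelled. *)
move=> w; have cs0 : cs != 0.
  apply/eqP => c0; have := central_sign_sqr; rewrite c0 mul0r => /eqP.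
  by rewrite eq_sym oner_eq0.
apply: (mulfI cs0).
have := SA_N1 (covA_SA Gg ck); rewrite -SA_comp //; last exact: stabN1.
rewrite (compN1 g).1 -(compN1 g).2 SA_comp //; last exact: stabN1.
rewrite E_N1 // SA_Z // => /(congr1 (@^~ w)) <-.
by rewrite fctE /= mulrA.
Qed.

Lemma is_rep_E : is_rep G E U.
Proof.
split.
- apply: E_intro => [a w _|w|w]; rewrite ?mulr0 //.
  by rewrite eqxx.
- move=> c u v Eu Ev; have [_ uD uN] := Eu; have [_ vD vN] := Ev.
  apply: E_intro; first exact: covA_linear (E_cov Eu) (E_cov Ev).
    move=> w; rewrite !fctE => nz; apply: contrapT => nD; move/negP: nz; apply.
    have z (k : W -> C^o) : (forall w, k w != 0 -> D w) -> k w = 0.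
      by move=> kD; apply: contrapT => /eqP /kD.
    by rewrite (z u) // (z v) // scaler0 addr0.
  by move=> w; rewrite !fctE uN vN /GRing.scale /= mulrDr mulrCA.
- by move=> g u Gg Eu; exact: E_stable.
- by move=> g c u v Gg Eu Ev; apply: SA_linear => //; exact: E_cov.
- by move=> u Eu; apply: SA1; exact: E_cov.
- by move=> g h u Gg Gh Eu; apply: SA_comp => //; exact: E_cov.
Qed.

Lemma sigma_linear g c phi phi' :
  sigma A theta x g (c *: phi + phi') =
  c *: sigma A theta x g phi + sigma A theta x g phi'.
Proof.
rewrite /sigma !rho_tildeE.
have -> : rhoop psb btb (qpr b ((g^-1)%VF x - x)) (c *: phi + phi') =
    c *: (rhoop psb btb (qpr b ((g^-1)%VF x - x)) phi : b -> C^o) +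
    (rhoop psb btb (qpr b ((g^-1)%VF x - x)) phi' : b -> C^o).
  by apply: funext => u; rewrite /rhoop !fctE /GRing.scale /= mulrDr mulrCA.
by rewrite S_tilde_linear scalerDr !scalerA [_ * c]mulrC.
Qed.

Lemma sigma_pm_linear d g c phi phi' :
  sigma_pm A theta x d g (c *: phi + phi') =
  c *: sigma_pm A theta x d g phi + sigma_pm A theta x d g phi'.
Proof.
rewrite /sigma_pm; case: ifP => _; rewrite sigma_linear //.
by rewrite scalerDr !scalerA [d * c]mulrC.
Qed.

Lemma sigma0 g : sigma A theta x g 0 = 0.
Proof.
have := sigma_linear g 1 0 0; rewrite !scale1r addr0 => /eqP.
by rewrite -subr_eq0 opprD addrA subrr sub0r oppr_eq0 => /eqP.
Qed.

Lemma sigma_pm0 d g : sigma_pm A theta x d g 0 = 0.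
Proof. by rewrite /sigma_pm !sigma0 scaler0; case: ifP. Qed.

Lemma K_hat_pm_G h : K_hat_pm psi beta B x h -> G h.
Proof. by case=> -[Gh _] //; rewrite -[h]opprK; apply: stabN. Qed.

Lemma is_rep_ind : is_rep G E' (@ind_act _ _ _ (b -> C^o)).
Proof.
split.
- split=> // [g _|h g _ _]; last by rewrite sigma_pm0.
  split=> [a w _|_]; first by rewrite mulr0.
  by rewrite sigma0 scaler0.
- move=> c u v [u0 uE uH] [v0 vE vH]; split=> [g nG|g Gg|h g Hh Gg].
  + by rewrite fctZD u0 // v0 // scaler0 addr0.
  + have [[uh us] [vh vs]] := (uE _ Gg, vE _ Gg); split=> [a w aX|Dx'].
      by rewrite !fctZD uh // vh // /GRing.scale /= mulrDr mulrCA.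
    by rewrite fctZD sigma_linear us // vs // scalerDr !scalerA [c * _]mulrC.
  by rewrite !fctZD uH // vH // sigma_pm_linear.
- move=> g u Gg [u0 uE uH]; split=> [g' nG|g' Gg'|h g' Hh Gg']; rewrite /ind_act.
  + apply: u0 => Gg'; apply: nG; have := stab_comp Gg' (stabV Gg).
    by rewrite -comp_lfunA (isom_compV altb nondeg) ?comp_lfun1r //; exact: stab_isom.
  + by apply: uE; exact: stab_comp.
  by rewrite -comp_lfunA uH //; exact: stab_comp.
- by [].
- by move=> u _; apply: funext => g; rewrite /ind_act comp_lfun1r.
by move=> g h u _ _ _; apply: funext => g'; rewrite /ind_act comp_lfunA.
Qed.

(** The map that Frobenius reciprocity attaches to evaluation at the base point x. *)
Definition Tind (k : W -> C^o) : 'End(W) -> (b -> C^o) :=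
  fun g => if `[< G g >] then ev x (U g k) else 0.

Lemma TindE k g : G g -> Tind k g = ev x (U g k).
Proof. by move=> Gg; rewrite /Tind; case: asboolP. Qed.

Lemma Tind_out k g : ~ G g -> Tind k g = 0.
Proof. by move=> Gg; rewrite /Tind; case: asboolP. Qed.

Lemma evZ y c k : ev y (c *: (k : W -> C^o)) = c *: (ev y k : b -> C^o).
Proof. by apply: funext => u; rewrite /ev !fctE /GRing.scale /= mulrCA. Qed.

Lemma K_hat_dual g : Bdual x -> G g -> K_hat psi beta B x g.
Proof. by move=> Dx' Gg; split=> //; apply: D_B => //; exact: stab_D. Qed.

Lemma sigma_ev_SA h k : K_hat psi beta B x h -> covA k ->
  sigma A theta x h (ev x k) = ev x (U h k).
Proof. by move=> Kh ck; rewrite sigma_ev // ev_SA //; case: Kh. Qed.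

Lemma Tind_ind k : E k -> E' (Tind k).
Proof.
move=> Ek; have ck := E_cov Ek; split=> [g|g Gg|h g Hh Gg]; first exact: Tind_out.
  have Eg := E_stable Gg Ek; have cg := E_cov Eg; rewrite TindE //; split=> [|Dx'].
    exact: ev_cov.
  rewrite sigma_ev_SA //; last by apply: K_hat_dual => //; exact: stabN1.
  by rewrite E_N1 // evZ.
have Gh := K_hat_pm_G Hh; have Eg := E_stable Gg Ek; have cg := E_cov Eg.
rewrite !TindE //; last exact: stab_comp.
rewrite SA_comp // /sigma_pm; case: asboolP => [Kh|nKh]; first by rewrite sigma_ev_SA.
have KNh : K_hat psi beta B x (- h) by case: Hh.
have GNh := KNh.1.
(* Here -h fixes x + B^*, and the extra factor -Id acts on [E] by the scalar that [sigma_pm]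
   prescribes. *)
have hE : h = ((- h) \o - \1)%VF by rewrite (compN1 (- h)).2 opprK.
by rewrite {1}hE (SA_comp GNh stabN1 cg) E_N1 // SA_Z // evZ sigma_ev_SA.
Qed.

Lemma Tind_linear c u v : E u -> E v -> Tind (c *: u + v) = c *: Tind u + Tind v.
Proof.
move=> Eu Ev; apply: funext => g; rewrite fctZD.
case: (pselect (G g)) => Gg; last by rewrite !Tind_out // scaler0 addr0.
by rewrite !TindE // SA_linear ?ev_linear //; exact: E_cov.
Qed.

Lemma Tind_equiv g u : G g -> E u -> Tind (U g u) = ind_act g (Tind u).
Proof.
move=> Gg Eu; apply: funext => g'; rewrite /ind_act.
case: (pselect (G g')) => Gg'.
  by rewrite !TindE ?SA_comp //; [exact: E_cov|exact: stab_comp].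
rewrite !Tind_out // => Ggg; apply: Gg'; have := stab_comp Ggg (stabV Gg).
by rewrite -comp_lfunA (isom_compV altb nondeg) ?comp_lfun1r //; exact: stab_isom.
Qed.

Lemma StK g phi : G g -> Hbar A phi -> St (g^-1)%VF (St g phi) = phi.
Proof.
move=> Gg cphi; rewrite -S_tilde_comp //; last exact: stabV.
by rewrite (isom_Vcomp altb nondeg (stab_isom Gg)) S_tilde1.
Qed.

Lemma StVK g phi : G g -> Hbar A phi -> St g (St (g^-1)%VF phi) = phi.
Proof.
move=> Gg cphi; rewrite -S_tilde_comp //; last exact: stabV.
by rewrite (isom_compV altb nondeg (stab_isom Gg)) S_tilde1.
Qed.

(** A point y of D is g^-1 x + w with w in the dual of B; undoing the invertible finite operator in
    the image at g gives back the value at y. *)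
Lemma Tind_inj : set_inj E Tind.
Proof.
move=> u v; rewrite !inE => Eu Ev uv; apply: funext => y.
have [_ uD _] := Eu; have [_ vD _] := Ev.
case: (pselect (D y)) => [Dy|nD]; last first.
  have z (k : W -> C^o) : (forall w, k w != 0 -> D w) -> k y = 0.
    by move=> kD; apply: contrapT => /eqP /kD.
  by rewrite !z.
have [g Gg Dg] := Dtrans Dy.
have := congr1 (@^~ g) uv; rewrite /= !TindE // !ev_SA //; try exact: E_cov.
move/(congr1 (St (g^-1)%VF)); rewrite !StK //; try by apply: ev_cov; exact: E_cov.
pose w := y - (g^-1)%VF x.
have Dw : Bdual w by rewrite /w -{1}(isK Gg y) -linearB; exact: stabV_D.
move/(congr1 (@^~ (qpr b w))); rewrite /= !evE //; try exact: E_cov.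
move/(mulfI (ac_neq0 psi _)).
by rewrite /w addrC subrK.
Qed.

Section Surjectivity.
Variable Phi : 'End(W) -> (b -> C^o).
Hypothesis EPhi : E' Phi.

Lemma Phi_cov g : G g -> Hbar A (Phi g).
Proof. by case: EPhi => _ h _ /h []. Qed.

(** The value at y forced on a preimage of [Phi]: solve [ev_SA] for a g carrying y into x + B^*,
    then remove the phase of [ev]. *)
Let Fv (g : 'End(W)) (y : W) : C :=
  psi (- (2^-1 * beta (y - (g^-1)%VF x) ((g^-1)%VF x))) *
  St (g^-1)%VF (Phi g) (qpr b (y - (g^-1)%VF x)).

Lemma St_rho g v phi : G g -> Bdual v ->
  St g (rhoop psb btb (qpr b v) phi) = rhoop psb btb (qpr b (g v)) (St g phi).
Proof.
move=> Gg Dv; rewrite /S_tilde !S_barE -pSpE //; apply: funext => u.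
rewrite /Sop (Mop_rho pD altbb dimb bee bff bef) /rhoop; last exact: pSp_isom.
by rewrite mulrCA.
Qed.

(** Two choices differ by h = g' g^-1, which fixes x + B^*. The covariance of [Phi] under h then
    becomes the change of base point from g^-1 x to g'^-1 x. *)
Lemma Fv_indep g g' y : G g -> G g' -> Bdual (g y - x) -> Bdual (g' y - x) ->
  Fv g y = Fv g' y.
Proof.
move=> Gg Gg' Dg Dg'.
pose h := (g' \o g^-1)%VF; have Gh : G h by apply: stab_comp => //; exact: stabV.
have Kh : K_hat psi beta B x h.
  split=> //; rewrite comp_lfunE.
  have -> : g' ((g^-1)%VF x) - x = (g' y - x) - g' ((g^-1)%VF (g y - x)).
    have -> : g' ((g^-1)%VF (g y - x)) = g' y - g' ((g^-1)%VF x).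
      by rewrite !linearB /= isK.
    by rewrite opprB [RHS]addrC subrKA.
  by apply: D_B => //; apply: stab_D => //; exact: stabV_D.
have hg : (h \o g)%VF = g'.
  by rewrite -comp_lfunA (isom_Vcomp altb nondeg (stab_isom Gg)) comp_lfun1r.
have [_ _ PhiH] := EPhi; have cP := Phi_cov Gg.
have hV : (h^-1)%VF x = g ((g'^-1)%VF x).
  rewrite invV_comp //; last exact: stabV.
  by rewrite (isom_invV altb nondeg (stab_isom Gg)).
set X1 := (g^-1)%VF x; set X2 := (g'^-1)%VF x.
have Dv : Bdual ((h^-1)%VF x - x).
  by rewrite -opprB -{1}(isK Gh x) -linearB; apply: D_N; apply: stabV_D => //; case: Kh.
have P2 : St (g'^-1)%VF (Phi g') = psi (2^-1 * beta X1 X2) *: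
    (rhoop psb btb (qpr b (X2 - X1)) (St (g^-1)%VF (Phi g)) : b -> C^o).
  rewrite -{2}hg PhiH //; last by left.
  rewrite /sigma_pm; case: asboolP => // _; rewrite /sigma S_tildeZ rho_tildeE.
  rewrite -S_tilde_comp //; [|exact: stabV|exact: covX_rho].
  have -> : (g'^-1 \o h)%VF = (g^-1)%VF.
    by rewrite comp_lfunA (isom_Vcomp altb nondeg (stab_isom Gg')) comp_lfun1l.
  rewrite St_rho //; last exact: stabV.
  have -> : beta x ((h^-1)%VF x) = beta X1 X2.
    by rewrite hV -(isomV altb nondeg (stab_isom Gg)) isK.
  by have -> : (g^-1)%VF ((h^-1)%VF x - x) = X2 - X1 by rewrite linearB /= hV isK.
rewrite /Fv -/X1 -/X2 P2 fctE; move: (St (g^-1)%VF (Phi g)) => S1.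
rewrite /GRing.scale /= /rhoop.
have DX1 : Bdual (y - X1) by rewrite -[y](isK Gg) -linearB; exact: stabV_D.
have DX2 : Bdual (y - X2) by rewrite -[y](isK Gg') -linearB; exact: stabV_D.
have DX : Bdual (X2 - X1).
  have -> : X2 - X1 = (y - X1) - (y - X2) by rewrite opprB [RHS]addrC subrKA.
  exact: D_B.
rewrite -qprD // psibar_betab // !mulrA -!ac_add addrA subrK.
congr (psi _ * _).
rewrite !(altE altb) !(altxx altb) (altC altb X2 X1); ring.
Qed.

Let gy (y : W) : 'End(W) := xget \1%VF [set g | G g /\ Bdual (g y - x)].
Let k (y : W) : C^o := if `[< D y >] then Fv (gy y) y else 0.

Lemma D_of_g g y : G g -> Bdual (g y - x) -> D y.
Proof.
move=> Gg Dg; rewrite -(isK Gg y); apply: Dstab; first exact: stabV.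
by rewrite -(subrK x (g y)) addrC; exact: Ddual.
Qed.

Lemma kE g y : G g -> Bdual (g y - x) -> k y = Fv g y.
Proof.
move=> Gg Dg; rewrite /k; case: asboolP => [_|[]]; last exact: D_of_g Dg.
rewrite /gy; case: xgetP => [g' _ [Gg' Dg']|/(_ g) []]; last by [].
exact: Fv_indep.
Qed.

Lemma k_out y : ~ D y -> k y = 0.
Proof. by move=> nD; rewrite /k; case: asboolP. Qed.

(** If -Id fixes x + B^*, then 2 x and hence x lie in the dual of B, and the eigenspace condition of
    [sigma_space] applies; otherwise the scalar is built into [sigma_pm]. *)
Lemma PhiN g : G g -> Phi (- g) = (cs * eps) *: Phi g.
Proof.
move=> Gg; have [_ PhiE PhiH] := EPhi.
have K1 : K_hat psi beta B x \1%VF.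
  by split; [exact: stab1|rewrite id_lfunE subrr; exact: D_0].
rewrite -(compN1 g).1 PhiH //; last by right; rewrite opprK.
rewrite /sigma_pm; case: asboolP => [[_ DN]|_].
  have [_ ->] := PhiE _ Gg => //.
  move: DN; rewrite opp_lfunE id_lfunE -opprD => /D_N; rewrite opprK => DN.
  have := D_Z (integers_half resK) DN.
  by rewrite -mulr2n -scaler_nat scalerA mulVf ?scale1r // (two_neq0K resK).
congr (_ *: _); rewrite opprK /sigma inv1 subrr rho_tildeE (altxx altb) mulr0 ac0 scale1r.
have -> : rhoop psb btb (qpr b 0) (Phi g) = Phi g.
  apply: funext => u; rewrite /rhoop qpr0 (alt0r altbb) mulr0 addr0.
  by rewrite (addchar0 pD pn0) mul1r.
by apply: S_tilde1; exact: Phi_cov.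
Qed.

Lemma covA_k : covA k.
Proof.
move=> a w Aa; case: (pselect (D w)) => [Dw|nD]; last first.
  rewrite !k_out ?mulr0 // => Daw; apply: nD; rewrite -(addKr a w) addrC.
  by apply: Ddual => //; apply: D_N; exact: AB.
have [g Gg Dg] := Dtrans Dw.
(* Since A is contained in B^*, the g found for w also serves a + w. *)
have Dga : Bdual (g (a + w) - x).
  by rewrite linearD -addrA; apply: D_D => //; apply: stab_D => //; exact: AB.
rewrite (kE Gg Dg) (kE Gg Dga) /Fv; set X1 := (g^-1)%VF x.
have DX1 : Bdual (w - X1) by rewrite -[w](isK Gg) -linearB; exact: stabV_D.
rewrite -addrA (qprD b (AB Aa) DX1).
have cS : Hbar A (St (g^-1)%VF (Phi g)) by exact: Hbar_S_bar.
have aX : qpr b a \in X by apply/lagrP => //; exact: AB.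
move: (St _ _) cS => S1 cS; rewrite (cS _ _ aX) psibar_betab //; last exact: AB.
rewrite !mulrA -!ac_add; congr (psi _ * _).
by rewrite !(altE altb) (altC altb a X1); ring.
Qed.

Lemma k_parity y : k (- y) = eps * k y.
Proof.
case: (pselect (D y)) => [Dy|nD]; last first.
  by rewrite !k_out ?mulr0 // => /Dopp; rewrite opprK.
(* -g carries -y to g y. The central sign enters twice, through [PhiN] and through the operator of
   -Id, and cancels. *)
have [g Gg Dg] := Dtrans Dy; have GN := stabN Gg.
have DgN : Bdual ((- g) (- y) - x) by rewrite opp_lfunE linearN opprK.
rewrite (kE Gg Dg) (kE GN DgN) /Fv.
have gNV : ((- g)^-1)%VF =1 (fun v => - (g^-1)%VF v).
  apply: (isom_inv_uniq altb nondeg (stab_isom GN)) => v.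
  by rewrite opp_lfunE linearN /= opprK isVK.
have -> : ((- g)^-1)%VF = (- \1 \o g^-1)%VF.
  by apply/lfunP => v; rewrite gNV (compN1 _).1 opp_lfunE.
have cP := Phi_cov Gg; have cN : Hbar A (Phi (- g)) by exact: Phi_cov.
rewrite S_tilde_comp //; [|exact: stabN1|exact: stabV].
rewrite S_tildeN1; last exact: Hbar_S_bar.
rewrite PhiN // S_tildeZ (compN1 _).1 opp_lfunE -opprD.
rewrite !(altNl altb) !(altNr altb) !opprK qprN; last first.
  by rewrite -{1}(isK Gg y) -linearB; exact: stabV_D.
rewrite opprK fctE /GRing.scale /=; move: (St _ _) => S1.
have -> : cs * (cs * eps * S1 (qpr b (y - (g^-1)%VF x))) =
    cs * cs * eps * S1 (qpr b (y - (g^-1)%VF x)) by rewrite !mulrA.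
by rewrite central_sign_sqr mul1r mulrCA; congr (_ * (psi _ * _)).
Qed.

Lemma E_k : E k.
Proof.
apply: E_intro; [exact: covA_k| |exact: k_parity].
by move=> w nz; apply: contrapT => nD; move: nz; rewrite k_out // eqxx.
Qed.

Lemma Tind_k : Tind k = Phi.
Proof.
have [Phi0 _ _] := EPhi; apply: funext => g.
case: (pselect (G g)) => Gg; last by rewrite Tind_out // Phi0.
rewrite TindE // ev_SA //; last exact: covA_k.
have cP := Phi_cov Gg; rewrite -[RHS](StVK Gg cP); congr (St g _).
apply: funext => u; have [Du <-] := qliftP u; set w := qlift u in Du *.
rewrite evE //; last exact: covA_k.
have Dg : Bdual (g ((g^-1)%VF x + w) - x).
  by rewrite linearD /= isVK // addrAC subrr add0r; exact: stab_D.
rewrite (kE Gg Dg) /Fv addrAC subrr add0r; move: (St _ _) => S1.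
by rewrite mulrA -ac_add subrr ac0 mul1r.
Qed.

End Surjectivity.

Theorem ind_equiv : rep_equiv G E U E' (@ind_act _ _ _ (b -> C^o)).
Proof.
split; [exact: is_rep_E|exact: is_rep_ind|exists Tind; split].
- split; [exact: Tind_ind|exact: Tind_inj|] => Phi EPhi.
  by eexists; [exact: E_k EPhi|exact: Tind_k].
- exact: Tind_linear.
exact: Tind_equiv.
Qed.

End MainEquivalence.

(** * Finiteness modulo A and transvections *)

Lemma uscaleP (m : int) (Y : set W) w : uscale m Y w <-> Y (pi ^ (- m) *: w).
Proof.
split=> [[y Yy <-]|Yw]; first by rewrite scalerA -unifXD addNr expr0z scale1r.
by exists (pi ^ (- m) *: w) => //; rewrite scalerA -unifXD subrr expr0z scale1r.
Qed.

(** The compact set A is covered by finitely many open translates of pi^m A; dividing these by pi^m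
    gives finitely many cosets of A that cover D. *)
Lemma finite_cosets (m : int) (D : set W) : (forall w, D w -> A (pi ^ m *: w)) ->
  finite_set (cosets D A).
Proof.
move=> DA; have [[A0 AD AZ Acomp Aopen] _] := sdA.
pose U (a : W) : set (vtop W) := [set a + pi ^ m *: u | u in A].
have Uopen a : open (U a).
  move=> _ [u Au <-]; have [n hn] := Aopen u Au; exists (n + m) => y hy.
  exists (pi ^ (- m) *: (y - a)); last first.
    by rewrite scalerA -unifXD subrr expr0z scale1r addrC subrK.
  apply: hn => i.
  have -> : pi ^ (- m) *: (y - a) - u = pi ^ (- m) *: (y - (a + pi ^ m *: u)).
    by rewrite opprD addrA [RHS]scalerBr scalerA -unifXD addNr expr0z scale1r.
  rewrite linearZ /=; have := (vge_shift (- m) (n + m) _).2 (hy i).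
  by rewrite addrC addrK.
have Acov : A `<=` cover A U.
  by move=> a Aa; exists a => //; exists 0 => //; rewrite scaler0 addr0.
move: Acomp; rewrite compact_cover => /(_ W A U (fun a _ => Uopen a) Acov) [S _ AS].
apply: (@sub_finite_set _ _ ((fun i : W => [set pi ^ (- m) *: i + u | u in A]) @` [set` S])).
  move=> _ [w Dw <-]; have [i iS [u Au uE]] := AS _ (DA _ Dw).
  exists i => //.
  have -> : w = pi ^ (- m) *: i + u.
    have : pi ^ (- m) *: (i + pi ^ m *: u) = pi ^ (- m) *: (pi ^ m *: w) by rewrite uE.
    by rewrite scalerDr !scalerA -!unifXD addNr expr0z !scale1r.
  apply/seteqP; split=> [_ [v Av <-]|_ [v Av <-]].
    by exists (v - u); [apply: A_D => //; exact: A_N|rewrite -addrA [u + _]addrC subrK].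
  by exists (u + v); [exact: A_D|rewrite addrA].
exact/finite_image/finite_fset.
Qed.

(** The half makes up for the two equal terms of [Esp] when both vectors are multiples of v. *)
Definition transv (c : K) (v : W) : 'End(W) := Esp beta ((2^-1 * c) *: v) v.

Lemma transvE c v w : transv c v w = w + (c * beta w v) *: v.
Proof.
rewrite EspE // (altZr altb) scalerA -addrA -scalerDl; congr (_ + _ *: _).
by field; exact: two_neq0K.
Qed.

Lemma transvK c v : cancel (transv (- c) v) (transv c v).
Proof.
move=> w; rewrite !transvE (altDl altb) (altZl altb) (altxx altb) mulr0 addr0.
by rewrite -addrA -scalerDl mulNr addNr scale0r addr0.
Qed.

(** Both signs are needed since the inverse transvection must preserve B too. *)
Lemma stab_transv c v :
  (forall c', c' = c \/ c' = - c -> forall w, B w -> B ((c' * beta w v) *: v)) ->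
  G (transv c v).
Proof.
move=> cB; split.
  by apply: isom_Esp => //; rewrite (altZl altb) (altxx altb) mulr0.
have st c' w : c' = c \/ c' = - c -> B w -> B (transv c' v w).
  by move=> hc Bw; rewrite transvE; apply: B_D => //; exact: cB.
apply/seteqP; split=> [_ [w Bw <-]|w Bw]; first by apply: st => //; left.
by exists (transv (- c) v w); [apply: st => //; right|rewrite transvK].
Qed.

(** * Orbits of the lattice stabilizer *)

Section Transitivity.
Variables (M : set W) (mu : int).
Hypothesis MB : forall u v, M u -> M v -> M (u - v).
Hypothesis MG : forall c v, M v -> vge (- mu) c -> G (transv c v).
(** y pairs with M as strongly as the form permits; the two cases used are B^* with mu = lam - 1 and
    B with mu = lam. *)
Let prim y := exists2 z, M z & ~ vge (mu + 1) (beta y z).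

(** With v = z - y and c the inverse of beta y z, c beta y v = 1 and y moves to y + v. The bound on
    the valuation of beta y z makes c admissible in [MG]. *)
Lemma transv_move y z : M y -> M z -> ~ vge (mu + 1) (beta y z) ->
  exists2 g, G g & g y = z.
Proof.
move=> My Mz nb; have b0 : beta y z != 0.
  by apply/eqP => b0; apply: nb; rewrite b0; exact: vge0.
exists (transv (beta y z)^-1 (z - y)); last first.
  by rewrite transvE !(altE altb) (altxx altb) subr0 mulVf // scale1r addrC subrK.
apply: MG; first exact: MB.
right; rewrite lf_valV // lerN2.
have : ~ (mu + 1 <= lf_val (beta y z)) by move=> h; apply: nb; right.
lia.
Qed.

(** Two moves pass through a z that pairs well with both vectors. If z1 serves only y and z2 only
    y', then z1 - z2 serves both. *)
Lemma transv_trans y y' : M y -> M y' -> prim y -> prim y' -> exists2 g, G g & g y = y'.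
Proof.
move=> My My' [z1 Mz1 h1] [z2 Mz2 h2].
have M0 : M 0 by rewrite -(subrr y); exact: MB.
suff [z [Mz hz hz']] : exists z, [/\ M z, ~ vge (mu + 1) (beta y z) & ~ vge (mu + 1) (beta y' z)].
  have [g Gg gy] := transv_move My Mz hz.
  have [g' Gg' gz] : exists2 g, G g & g z = y'.
    apply: transv_move => // h; apply: hz'; rewrite (altC altb); exact: vgeN.
  by exists (g' \o g)%VF; [exact: stab_comp|rewrite comp_lfunE gy].
case: (pselect (vge (mu + 1) (beta y' z1))) => [h3|h3]; last by exists z1.
case: (pselect (vge (mu + 1) (beta y z2))) => [h4|h4]; last by exists z2.
exists (z1 - z2); split; first exact: MB.
- rewrite (altDr altb) (altNr altb) => h; apply: h1.
  by rewrite -(subrK (beta y z2) (beta y z1)); exact: vgeD.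
rewrite (altDr altb) (altNr altb) => h; apply: h2.
by rewrite -(subKr (beta y' z1) (beta y' z2)); exact: vgeB.
Qed.

End Transitivity.

Lemma B_sub x y : B x -> B y -> B (x - y).
Proof. by move=> Bx By; apply: B_D => //; exact: B_N. Qed.

(** Outside B, primitivity is the nondegeneracy of the residual form. The transvections allowed here
    add to a vector of B an element of pi B^*, which lies in B. *)
Lemma trans_dual y y' : Bdual y -> ~ B y -> Bdual y' -> ~ B y' ->
  exists2 g, G g & g y = y'.
Proof.
have prim z : Bdual z -> ~ B z -> exists2 u, Bdual u & ~ vge (lam - 1 + 1) (beta z u).
  move=> Dz nBz; apply: contrapT => np; apply: nBz; apply/(qpr_eq0 b Dz).
  apply: nondegb => u; have [Du <-] := qliftP u; rewrite betabE //.
  apply/red_eq0; first exact: integers_betab.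
  have hz : vge lam (beta z (qlift u)).
    by apply: contrapT => h; apply: np; exists (qlift u) => //; rewrite subrK.
  by have := (vge_shift (1 - lam) lam _).2 hz; rewrite subrK.
move=> Dy nBy Dy' nBy'.
apply: (@transv_trans Bdual (lam - 1)) => //.
- exact: D_B.
- move=> c v Dv hc; apply: stab_transv => c' hc' w Bw.
  have {}hc' : vge (- (lam - 1)) c' by case: hc' => -> //; exact: vgeN.
  have h := vgeM hc' (beta_BD Bw Dv).
  have -> : (c' * beta w v) *: v = (pi ^ (-1) * (c' * beta w v)) *: (pi *: v).
    by rewrite scalerA mulrAC exprN1 mulVf ?unif_neq0 // mul1r.
  apply: B_Z; last exact: piD_B.
  have := (vge_shift (-1) _ _).2 h; rewrite opprB.
  by have -> : -1 + (1 - lam + lam) = 0 :> int by rewrite subrK addNr.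
- exact: prim.
exact: prim.
Qed.

(** Primitivity is now the very definition of the dual, applied to pi^-1 y; the transvections add
    integral multiples of vectors of B. *)
Lemma trans_lattice y y' : B y -> ~ Bdual (pi ^ (-1) *: y) ->
  B y' -> ~ Bdual (pi ^ (-1) *: y') -> exists2 g, G g & g y = y'.
Proof.
have prim z : ~ Bdual (pi ^ (-1) *: z) -> exists2 u, B u & ~ vge (lam + 1) (beta z u).
  move=> nD; apply: contrapT => np; apply: nD; apply/dualP => u Bu; rewrite (altZl altb).
  have hz : vge (lam + 1) (beta z u).
    by apply: contrapT => h; apply: np; exists u.
  by have := (vge_shift (-1) _ _).2 hz; rewrite addrC addrK.
move=> By nDy By' nDy'.
apply: (@transv_trans B lam) => //; [exact: B_sub| |exact: prim|exact: prim].
move=> c v Bv hc; apply: stab_transv => c' hc' w Bw; apply: B_Z => //.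
have {}hc' : vge (- lam) c' by case: hc' => -> //; exact: vgeN.
by have := vgeM hc' (beta_BD Bw (B_sub_D Bv)); rewrite addNr.
Qed.

(** * The layers *)

Local Notation equiv D x eps := (rep_equiv G (E_supp psi beta A D eps) (SA A theta)
  (ind_sigma_space A theta x (central_sign A theta * eps)) (@ind_act _ _ _ (b -> C^o))).

Lemma scaled_equiv (m : int) (Y : set W) (x : W) (eps : C) :
  (forall y, Y y -> Bdual y) ->
  (forall y d, Y y -> Bdual d -> Y (y + pi ^ m *: d)) ->
  (forall y, Y y -> Y (- y)) ->
  (forall g y, G g -> Y y -> Y (g y)) ->
  (forall y y', Y y -> Y y' -> exists2 g, G g & g y = y') ->
  uscale (- m) Y x -> equiv (uscale (- m) Y) x eps.
Proof.
move=> YD Yadd Yopp Yst Ytr Yx; have := Yx; move/uscaleP; rewrite opprK => Yx'.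
apply: ind_equiv => //.
- move=> w d /uscaleP Yw Dd; apply/uscaleP; move: Yw; rewrite opprK scalerDr => Yw.
  exact: Yadd.
- by move=> w /uscaleP Yw; apply/uscaleP; rewrite scalerN; exact: Yopp.
- by move=> g w Gg /uscaleP Yw; apply/uscaleP; rewrite -linearZ; exact: Yst.
(* Scaling by pi^m only brings the layer into B^*; one more factor pi brings it into A. *)
- apply: (@finite_cosets (1 + m)) => w /uscaleP; rewrite opprK => /YD /piD_B /BA.
  by rewrite scalerA unifXD expr1z.
move=> y /uscaleP; rewrite opprK => Yy; have [g Gg gy] := Ytr _ _ Yy Yx'.
exists g => //; suff -> : g y = x by rewrite subrr; exact: D_0.
apply: (scalerI (unifX_neq0 K m)); by rewrite -gy linearZ.
Qed.

Lemma unifX_integers n : integers K (pi ^+ n).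
Proof. by right; have := lf_val_unifX K n%:Z; rewrite -exprnP => ->. Qed.

Lemma layerS_equiv n x eps :
  setsum (uscale (- n.+1%:Z) Bdual `\` uscale (- n.+1%:Z) B) Bdual x ->
  equiv (layer psi beta B n.+1) x eps.
Proof.
have pB d : Bdual d -> B (pi ^ n.+1%:Z *: d).
  move=> Dd; rewrite -exprnP exprSr -scalerA; apply: B_Z; last exact: piD_B.
  exact: unifX_integers.
move=> [y [/uscaleP Dy nBy] [d Dd yd]]; rewrite opprK in Dy.
have Yadd y' d' : (Bdual `\` B) y' -> Bdual d' -> (Bdual `\` B) (y' + pi ^ n.+1%:Z *: d').
  move=> [Dy' nB'] Dd'; split; first by apply: D_D => //; exact/B_sub_D/pB.
  by move=> h; apply: nB'; rewrite -(addrK (pi ^ n.+1%:Z *: d') y'); apply: B_sub => //; exact: pB.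
apply: scaled_equiv => //.
- by move=> ? [].
- by move=> y' [Dy' nB']; split; [exact: D_N|move=> /B_N; rewrite opprK].
- move=> g y' Gg [Dy' nB']; split; first exact: stab_D.
  by move=> /(stabV_B Gg); rewrite isK.
- by move=> y' y'' [Dy' nB'] [Dy'' nB'']; exact: trans_dual.
apply/uscaleP; rewrite opprK -yd scalerDr; apply: Yadd => //; split=> //.
by move=> h; apply: nBy; apply/uscaleP; rewrite opprK.
Qed.

Lemma finite_cosets_dual : finite_set (cosets Bdual A).
Proof. by apply: (@finite_cosets 1) => w /piD_B /BA; rewrite expr1z. Qed.

(** B^* is a single coset modulo itself, so the identity already provides transitivity. *)
Lemma layer0_equiv x eps : Bdual x -> equiv Bdual x eps.
Proof.
move=> Dx; apply: ind_equiv => //.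
- exact: D_D.
- exact: D_N.
- by move=> g w; exact: stab_D.
- exact: finite_cosets_dual.
move=> y Dy; exists \1%VF; [exact: stab1|rewrite id_lfunE; exact: D_B].
Qed.

Lemma layer_equiv n x eps :
  setsum (uscale (- n%:Z) Bdual `\` uscale (- n%:Z) B) Bdual x ->
  equiv (layer psi beta B n) x eps.
Proof.
case: n => [|n]; last exact: layerS_equiv.
move=> [y [/uscaleP Dy _] [d Dd <-]]; apply: layer0_equiv; apply: D_D => //.
by move: Dy; rewrite !oppr0 expr0z scale1r.
Qed.

(** Up to dilation the layer is one subset of B independent of n, the form in which [scaled_equiv]
    and [trans_lattice] apply. *)
Lemma layer1E n : layer1 psi beta B n =
  uscale (- n.+1%:Z) [set y | B y /\ ~ Bdual (pi ^ (-1) *: y)].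
Proof.
have nE : -1 + n.+1%:Z = n%:Z by rewrite addrC -addn1 PoszD addrK.
apply/seteqP; split=> [w [/uscaleP Bw nD]|w /uscaleP [Bw nD]].
  apply/uscaleP; split=> //; rewrite scalerA opprK -unifXD nE => Dw.
  by apply: nD; apply/uscaleP; rewrite opprK.
split; first by apply/uscaleP.
move=> /uscaleP; rewrite opprK => Dw; apply: nD.
by rewrite scalerA opprK -unifXD nE.
Qed.

Lemma layer1_equiv n x eps : setsum (layer1 psi beta B n) Bdual x ->
  equiv (layer1 psi beta B n) x eps.
Proof.
rewrite layer1E => -[y Yy [d Dd yd]].
have nE : -1 + n.+1%:Z = n%:Z by rewrite addrC -addn1 PoszD addrK.
have piD d' : Bdual d' -> Bdual (pi ^ (-1) *: (pi ^ n.+1%:Z *: d')).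
  move=> Dd'; rewrite scalerA -unifXD nE; apply: D_Z => //; exact: unifX_integers.
have pB d' : Bdual d' -> B (pi ^ n.+1%:Z *: d').
  move=> Dd'; rewrite -exprnP exprSr -scalerA; apply: B_Z; last exact: piD_B.
  exact: unifX_integers.
have Yadd y' d' : B y' /\ ~ Bdual (pi ^ (-1) *: y') -> Bdual d' ->
    B (y' + pi ^ n.+1%:Z *: d') /\ ~ Bdual (pi ^ (-1) *: (y' + pi ^ n.+1%:Z *: d')).
  move=> [By nD] Dd'; split; first by apply: B_D => //; exact: pB.
  rewrite scalerDr => h; apply: nD.
  rewrite -[X in Bdual X](addrK (pi ^ (-1) *: (pi ^ n.+1%:Z *: d'))).
  by apply: D_B => //; exact: piD.
apply: scaled_equiv => //.
- by move=> y' [By' _]; exact: B_sub_D.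
- move=> y' [By' nD]; split; first exact: B_N.
  by rewrite scalerN => /D_N; rewrite opprK.
- move=> g y' Gg [By' nD]; split; first exact: stab_B.
  by rewrite -linearZ => /(stabV_D Gg); rewrite isK.
- by move=> y' y'' [By' nD'] [By'' nD'']; exact: trans_lattice.
apply/uscaleP; rewrite opprK -yd scalerDr; apply: Yadd => //.
by move/uscaleP: Yy; rewrite opprK.
Qed.

(** The residual space is 0, so B, A and B^* coincide and the finite operators are the identity. A
    covariant function supported on A is constant there, hence determined by its value at 0. *)
Lemma trivial_layer : l = 0%N ->
  rep_equiv G (E_supp psi beta A (layer psi beta B 0) 1) (SA A theta)
    (setT : set C^o) (fun _ z => z).
Proof.
move=> l0; have b0 (u : b) : u = 0.
  apply/eqP; rewrite -memv0; have -> : (0 : {vspace b})%VS = fullv.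
    by apply/esym/eqP; rewrite -dimv_eq0 dimb l0.
  exact: memvf.
have DB w : Bdual w -> B w by move=> Dw; apply/(qpr_eq0 b Dw).
have DA w : Bdual w -> A w by move=> /DB /BA.
have pS1 g : pSp b g = \1%VF by apply/lfunP => u; rewrite [LHS]b0 [RHS]b0.
have S1 g phi : Hbar A phi -> S_tilde A theta g phi = phi.
  by move=> cphi; rewrite -[RHS]S_tilde1 // /S_tilde !pS1.
have kA (k : W -> C^o) w : covA k -> A w -> k w = k 0.
  by move=> ck Aw; rewrite -{1}[w]addr0 ck // (alt0l altb) mulr0 ac0 mul1r.
split.
- apply: is_rep_E => //.
  + exact: D_D.
  + by move=> g w; exact: stab_D.
  + exact: finite_cosets_dual.
- by split.
exists (fun k : W -> C^o => k 0); split.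
- split=> [//|k k'|z _].
    rewrite !inE => -[[ck _] kD _] [[ck' _] kD' _] kk; apply: funext => w.
    case: (pselect (A w)) => [Aw|nA]; first by rewrite !(kA _ w).
    have z (h : W -> C^o) : (forall w, h w != 0 -> Bdual w) -> h w = 0.
      by move=> hD; apply: contrapT => /eqP /hD /DA.
    by rewrite !z.
  exists (fun w => if `[< A w >] then z else 0); last first.
    by case: asboolP => // -[]; exact: A_0.
  apply: E_intro => [|a w Aa|w|w].
  + exact: finite_cosets_dual.
  + have -> : `[< A (a + w) >] = `[< A w >].
      apply/asboolP/asboolP => h; last exact: A_D.
      by rewrite -(addKr a w) addrC; apply: A_D => //; exact: A_N.
    case: asboolP => Aw; rewrite ?mulr0 //.
    by rewrite (ac_vge (vge_half resK (beta_AA Aw Aa))) mul1r.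
  + by case: asboolP => [Aw _|]; [exact: AB|rewrite eqxx].
  have -> : `[< A (- w) >] = `[< A w >].
    by apply/asboolP/asboolP => /A_N; rewrite ?opprK.
  by rewrite mul1r.
- by [].
move=> g k Gg [[ck _] _ _]; rewrite SA_at // S1 ?linear0 ?ev0 //; exact: ev_cov.
Qed.

End LocalWeil.

Theorem mainTheorem8 (R : realType)
    (K : localField) (charK : [pchar K] =i pred0) (resK : 2%N \notin [pchar residue K])
    (psi : addChar R K)
    (r : nat) (W : vectType K) (dimW : \dim {:W} = r.*2)
    (beta : {skew_symmetric W}) (beta_sympl : is_psymplectic beta)
    (B : set W) (goodB : good_lattice psi beta B)
    (A : set W) (sdA : selfdual_lattice psi beta A)
    (BA : B `<=` A) (AB : A `<=` dual psi beta B)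
    (b : resQuotient psi beta B) (l : nat) (dimb : \dim {:b} = l.*2)
    (e f : 'I_l -> b) (ef_basis : symplectic_basis A e f)
    (theta : 'End(b) -> residue K) (theta_spec : is_theta A e f theta) :
  [/\ l = 0%N ->
      rep_equiv (stabB beta B)
        (E_supp psi beta A (layer psi beta B 0) 1) (SA A theta)
        (setT : set R[i]^o) (fun _ z => z),
      (0 < l)%N ->
      forall (n : nat) (x : W) (eps : R[i]), eps = 1 \/ eps = -1 ->
      setsum (uscale (- n%:Z) (dual psi beta B) `\` uscale (- n%:Z) B)
        (dual psi beta B) x ->
      rep_equiv (stabB beta B)
        (E_supp psi beta A (layer psi beta B n) eps) (SA A theta)
        (ind_sigma_space A theta x (central_sign A theta * eps))
        (@ind_act _ _ _ (b -> R[i]^o)) &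
      (l < r)%N ->
      forall (n : nat) (x : W) (eps : R[i]), eps = 1 \/ eps = -1 ->
      setsum (layer1 psi beta B n) (dual psi beta B) x ->
      rep_equiv (stabB beta B)
        (E_supp psi beta A (layer1 psi beta B n) eps) (SA A theta)
        (ind_sigma_space A theta x (central_sign A theta * eps))
        (@ind_act _ _ _ (b -> R[i]^o))].
Proof.
split=> [l0|_ n x eps _ hx|_ n x eps _ hx].
- by apply: (trivial_layer resK beta_sympl goodB sdA BA AB dimb ef_basis theta_spec).
- by apply: (layer_equiv resK beta_sympl goodB sdA BA AB dimb ef_basis theta_spec).
by apply: (layer1_equiv resK beta_sympl goodB sdA BA AB dimb ef_basis theta_spec).
Qed.
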